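(* Let $s>1$ be an integer and let $g$ be sufficiently large compared to $s$. There is an epimorphism of $\mathrm{Sp}(H)$-modules $$\mathsf C_s\twoheadrightarrow [H^{\langle s\rangle}]_{D_{2s}},$$ where the dihedral group $D_{2s}$ (of order $2s$) acts on $H^{\otimes s}$, and hence on $H^{\langle s\rangle}$, in the natural way, twisted by the nontrivial $\mathbb Z_2$-representation when $s$ is even.
   Context: Let $\Bbbk$ be a field of characteristic $0$, $\Sigma_{g,1}$ a compact oriented surface of genus $g$ with one boundary component, and $H=H_1(\Sigma_{g,1};\Bbbk)$, a symplectic vector space of dimension $2g$ with symplectic form $\langle\cdot,\cdot\rangle$ and symplectic basis $p_1,\dots,p_g,q_1,\dots,q_g$. Johnson cokernel. Let $\mathsf L_k(H)$ be the degree $k$ part of the free Lie algebra on $H$, and let $\mathsf D_s(H)$ be the kernel of the bracketing map $H\otimes \mathsf L_{s+1}(H)\to\mathsf L_{s+2}(H)$. Let $\mathrm{Mod}(g,1)$ be the mapping class group of $\Sigma_{g,1}$ and $F=\pi_1(\Sigma_{g,1})$ (free of rank $2g$), with lower central series $F_1=F$, $F_{k+1}=[F,F_k]$. Let $\mathbb J_s=\ker(\mathrm{Mod}(g,1)\to\mathrm{Aut}(F/F_{s+1}))$ and $\mathsf J_s=(\mathbb J_s/\mathbb J_{s+1})\otimes\Bbbk$. The Johnson homomorphism $\tau:\mathsf J_s\to\mathsf D_s(H)$ ($s\ge1$) sends the class of $\varphi\in\mathbb J_s$ to the element of $\mathrm{Hom}(H,\mathsf L_{s+1}(H))\cong H\otimes\mathsf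 L_{s+1}(H)$ (identification via the symplectic form) induced by $z\mapsto [z^{-1}\varphi(z)]\in (F_{s+1}/F_{s+2})\otimes\Bbbk\cong\mathsf L_{s+1}(H)$; its image lies in $\mathsf D_s(H)$. The Johnson cokernel is $\mathsf C_s=\mathsf D_s(H)/\tau(\mathsf J_s)$, an $\mathrm{Sp}(H)$-module. Dihedral action. $H^{\langle s\rangle}\subset H^{\otimes s}$ is the intersection of the kernels of all the pairwise contractions $H^{\otimes s}\to H^{\otimes(s-2)}$ given by the symplectic form. $D_{2s}=\langle a,b\mid a^s=b^2=1,\ bab=a^{-1}\rangle$ acts on $H^{\otimes s}$ by $a(v_1\otimes\cdots\otimes v_s)=v_2\otimes\cdots\otimes v_s\otimes v_1$ and $b(v_1\otimes\cdots\otimes v_s)=(-1)^{s+1}v_s\otimes\cdots\otimes v_1$, preserving $H^{\langle s\rangle}$. $[\,\cdot\,]_{D_{2s}}$ denotes coinvariants. *)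

(* Defs.v *)
From HB Require Import structures.
From mathcomp Require Import all_boot all_order all_algebra.
From mathcomp Require Import generic_quotient ring_quotient.
From mathcomp Require Import all_classical all_reals topology normedtype.
From mathcomp Require Import lra.

Set Implicit Arguments.
Unset Strict Implicit.
Unset Printing Implicit Defensive.
Import Order.TTheory GRing.Theory Num.Theory.
Import numFieldNormedType.Exports.

Local Open Scope classical_set_scope.
Local Open Scope quotient_scope.
Local Open Scope ring_scope.

Section Continuity.
Context {R : realType} {X : topologicalType}.
Implicit Types f h : X -> R.

Lemma cont_comp (Y Z : topologicalType) (u : X -> Y) (v : Y -> Z) :
  continuous u -> continuous v -> continuous (fun x => v (u x)).
Proof. by move=> cu cv x; apply: (@continuous_comp _ _ _ u v); [exact: cu|exact: cv]. Qed.

Lemma cont_pair (Y Z : topologicalType) (u : X -> Y) (v : X -> Z) :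
  continuous u -> continuous v -> continuous (fun x => (u x, v x)).
Proof. by move=> cu cv x; apply: cvg_pair; [exact: cu|exact: cv]. Qed.

Lemma cont_cst (y : R) : continuous (fun _ : X => y).
Proof. by move=> x; exact: cvg_cst. Qed.

Lemma contD f h : continuous f -> continuous h -> continuous (fun x => f x + h x).
Proof. by move=> cf ch x; apply: cvgD; [exact: cf|exact: ch]. Qed.

Lemma contB f h : continuous f -> continuous h -> continuous (fun x => f x - h x).
Proof. by move=> cf ch x; apply: cvgB; [exact: cf|exact: ch]. Qed.

Lemma contM f h : continuous f -> continuous h -> continuous (fun x => f x * h x).
Proof. by move=> cf ch x; apply: cvgM; [exact: cf|exact: ch]. Qed.

Lemma cont_maxr f h : continuous f -> continuous h ->
  continuous (fun x => Num.max (f x) (h x)).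
Proof. by move=> cf ch x; apply: continuous_max; [exact: cf|exact: ch]. Qed.

Lemma cont_minr f h : continuous f -> continuous h ->
  continuous (fun x => Num.min (f x) (h x)).
Proof. by move=> cf ch x; apply: continuous_min; [exact: cf|exact: ch]. Qed.
End Continuity.

Lemma cont_id (X : topologicalType) : continuous (fun x : X => x).
Proof. by move=> x; exact: cvg_id. Qed.

Lemma cont_fst (X Y : topologicalType) : continuous (fun p : X * Y => p.1).
Proof. by move=> p; exact: cvg_fst. Qed.

Lemma cont_snd (X Y : topologicalType) : continuous (fun p : X * Y => p.2).
Proof. by move=> p; exact: cvg_snd. Qed.

Ltac cont := repeat lazymatch goal with
  | |- continuous (fun x => GRing.add (@?f x) (GRing.opp (@?h x))) => apply: (@contB _ _ f h)
  | |- continuous (fun x => GRing.add (@?f x) (@?h x)) => apply: (@contD _ _ f h)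
  | |- continuous (fun x => GRing.mul (@?f x) (@?h x)) => apply: (@contM _ _ f h)
  | |- continuous (fun x => Num.min (@?f x) (@?h x)) => apply: (@cont_minr _ _ f h)
  | |- continuous (fun x => Num.max (@?f x) (@?h x)) => apply: (@cont_maxr _ _ f h)
  | |- continuous (fun x => pair (@?f x) (@?h x)) => apply: (@cont_pair _ _ _ f h)
  | |- continuous fst => exact: cont_fst
  | |- continuous snd => exact: cont_snd
  | |- continuous (fun x => fst x) => exact: cont_fst
  | |- continuous (fun x => snd x) => exact: cont_snd
  | |- continuous (fun x => x) => exact: cont_id
  | |- continuous (fun x => _) => exact: cont_cst
  end.

Section Topology.
Context {R : realType}.

Lemma continuous_glue (X Y : topologicalType) (c : X -> R) (f h : X -> Y) :
  continuous c -> continuous f -> continuous h ->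
  (forall x, c x = 0 -> f x = h x) ->
  continuous (fun x => if c x <= 0 then f x else h x).
Proof.
move=> cc cf ch E.
set k := (X in continuous X).
have cA : closed [set x | c x <= 0].
  by apply: (@preimage_closed _ _ c [set y | y <= 0]) => //; exact: closed_le.
have cB : closed [set x | 0 <= c x].
  by apply: (@preimage_closed _ _ c [set y | 0 <= y]) => //; exact: closed_ge.
have kf : {within [set x | c x <= 0], continuous k}.
  apply: (@subspace_eq_continuous _ _ _ f) => [x|]; last exact: continuous_subspaceT.
  by rewrite inE /k /from_subspace /= => c0; rewrite c0.
have kh : {within [set x | 0 <= c x], continuous k}.
  apply: (@subspace_eq_continuous _ _ _ h) => [x|]; last exact: continuous_subspaceT.
  rewrite inE /k /from_subspace /= => c0; case: ifPn => // c1.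
  by rewrite E //; apply/eqP; rewrite eq_le c0 c1.
have := withinU_continuous cA cB kf kh.
have -> : [set x | c x <= 0] `|` [set x | 0 <= c x] = setT.
  by apply/seteqP; split=> // x _ /=; case: (leP (c x) 0) => [|/ltW]; [left|right].
by move=> kc; apply: (proj2 (continuous_subspace_setT k)).
Qed.

(* A loop on the unit interval, extended to the line by its base point outside
   of the interval. Homotopies are restricted to the unit interval only in the
   variable s: a homotopy on the unit square extends to the plane by clamping s
   and by the base point. *)
Record loop (X : topologicalType) (x0 : X) := Loop {
  loop_fun :> R -> X;
  loop_continuous : continuous loop_fun;
  loop_out : forall t, ~~ (0 < t < 1) -> loop_fun t = x0 }.

HB.instance Definition _ X x0 := gen_eqMixin (@loop X x0).
HB.instance Definition _ X x0 := gen_choiceMixin (@loop X x0).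

Lemma notin01 (t : R) : ~~ (0 < t < 1) <-> t <= 0 \/ 1 <= t.
Proof. by rewrite negb_and -!leNgt; split=> [/orP|] //; move/orP. Qed.

Section FundamentalGroup.
Context {X : topologicalType} {x0 : X}.
Implicit Types a b c : loop x0.

Definition homotopic a b := exists H : R * R -> X, [/\ continuous H,
  forall t, H (0, t) = a t, forall t, H (1, t) = b t
  & forall s t, 0 <= s <= 1 -> ~~ (0 < t < 1) -> H (s, t) = x0].

Lemma homotopic_refl a : homotopic a a.
Proof.
exists (fun p => a p.2); split=> //= [|s t _]; last exact: loop_out.
by apply: cont_comp; [cont|exact: loop_continuous].
Qed.

Lemma homotopic_sym a b : homotopic a b -> homotopic b a.
Proof.
move=> [H [cH H0 H1 Ho]]; exists (fun p => H (1 - p.1, p.2)); split=> /=.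
- by apply: cont_comp cH; cont.
- by move=> t; rewrite subr0.
- by move=> t; rewrite subrr.
- by move=> s t s01; apply: Ho; lra.
Qed.

Lemma homotopic_trans b a c : homotopic a b -> homotopic b c -> homotopic a c.
Proof.
move=> [H [cH H0 H1 Ho]] [K [cK K0 K1 Ko]].
exists (fun p => if 2 * p.1 - 1 <= 0 then H (2 * p.1, p.2)
                 else K (2 * p.1 - 1, p.2)); split=> /=.
- apply: (@continuous_glue _ _ (fun p : R * R => 2 * p.1 - 1)
    (fun p => H (2 * p.1, p.2)) (fun p => K (2 * p.1 - 1, p.2))).
  + by cont.
  + by apply: cont_comp cH; cont.
  + by apply: cont_comp cK; cont.
  + by move=> [u v] /= u1; rewrite u1 K0; move/subr0_eq : u1 => ->.
- by move=> t; rewrite mulr0 sub0r lerN10 H0.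
- move=> t; rewrite ifF; last by apply/negP; lra.
  by rewrite (_ : 2 * 1 - 1 = 1 :> R) ?K1//; lra.
- move=> s t s01 t01; case: (leP (2 * s - 1) 0) => s2.
    by apply: Ho => //; lra.
  by apply: Ko => //; lra.
Qed.

Lemma homotopic_equiv : equiv_class_of (fun a b => `[< homotopic a b >]).
Proof.
split=> [a|a b|b a c].
- exact/asboolP/homotopic_refl.
- by apply/asboolP/asboolP; exact: homotopic_sym.
- by move=> /asboolP ab /asboolP bc; apply/asboolP; exact: homotopic_trans bc.
Qed.

Definition homotopic_rel := EquivRelPack homotopic_equiv.

Definition pi1 := {eq_quot homotopic_rel}.
HB.instance Definition _ := Choice.on pi1.
HB.instance Definition _ := EqQuotient.on pi1.

Lemma pi1P a b : \pi_pi1 a = \pi_pi1 b <-> homotopic a b.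
Proof. by split=> [/eqmodP/asboolP|ab]; [|apply/eqmodP/asboolP]. Qed.

Lemma homotopic_reparam a b (p : R -> R) : continuous p ->
  (forall t, t <= 0 -> p t <= 0) -> (forall t, 1 <= t -> 1 <= p t) ->
  (forall t, b t = a (p t)) -> homotopic b a.
Proof.
move=> cp p0 p1 ba.
exists (fun q => a ((1 - q.1) * p q.2 + q.1 * q.2)); split=> /=.
- apply: cont_comp; last exact: loop_continuous.
  apply: contD; last by cont.
  by apply: contM; [cont|apply: cont_comp cp; cont].
- by move=> t; rewrite subr0 mul1r mul0r addr0.
- by move=> t; rewrite subrr mul1r mul0r add0r.
- move=> s t s01 /notin01 t01; apply: loop_out; apply/notin01.
  by case: t01 => t01; [left; have := p0 _ t01|right; have := p1 _ t01]; nra.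
Qed.

Definition loop1 : loop x0.
Proof. by exists (fun=> x0) => // x; exact: cvg_cst. Defined.

Definition loopV a : loop x0.
Proof.
exists (fun t => a (1 - t)).
  by apply: cont_comp; [cont|exact: loop_continuous].
by move=> t /notin01 t01; apply: loop_out; apply/notin01; lra.
Defined.

(* first a, then b *)
Definition loopM a b : loop x0.
Proof.
exists (fun t => if 2 * t - 1 <= 0 then a (2 * t) else b (2 * t - 1)).
  apply: (@continuous_glue _ _ (fun t : R => 2 * t - 1)
    (fun t => a (2 * t)) (fun t => b (2 * t - 1))); first by cont.
  - by apply: (@cont_comp _ _ _ (fun t : R => 2 * t)); [cont|exact: loop_continuous].
  - by apply: cont_comp; [cont|exact: loop_continuous].
  - by move=> t t0; rewrite !loop_out//; apply/notin01; lra.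
by move=> t /notin01 t01; case: ifP => ?; apply: loop_out; apply/notin01; lra.
Defined.

Lemma homotopicM a a' b b' :
  homotopic a a' -> homotopic b b' -> homotopic (loopM a b) (loopM a' b').
Proof.
move=> [H [cH H0 H1 Ho]] [K [cK K0 K1 Ko]].
pose k (x : R) := Num.min 1 (Num.max 0 x).
have k01 x : 0 <= k x <= 1 by rewrite /k le_min ler01 le_max lexx ge_min lexx.
have k0 : k 0 = 0 by rewrite /k maxxx min_r.
have k1 : k 1 = 1 by rewrite /k max_r // minxx.
have ck (Y : topologicalType) (u : Y -> R) : continuous u -> continuous (fun x => k (u x)).
  by move=> cu; apply: cont_minr; [cont|apply: cont_maxr => //; cont].
exists (fun p => if 2 * p.2 - 1 <= 0 then H (k p.1, 2 * p.2)
                 else K (k p.1, 2 * p.2 - 1)); split=> /=.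
- apply: (@continuous_glue _ _ (fun p : R * R => 2 * p.2 - 1)
    (fun p => H (k p.1, 2 * p.2)) (fun p => K (k p.1, 2 * p.2 - 1))).
  + by cont.
  + by apply: cont_comp cH; apply: cont_pair; [apply: ck|]; cont.
  + by apply: cont_comp cK; apply: cont_pair; [apply: ck|]; cont.
  + by move=> [s t] /= t1; rewrite Ho ?Ko//; apply/notin01; lra.
- by move=> t; rewrite k0 H0 K0.
- by move=> t; rewrite k1 H1 K1.
- move=> s t s01 /notin01 t01; case: ifP => ?; [apply: Ho|apply: Ko] => //;
  by apply/notin01; lra.
Qed.

Lemma homotopicV a b : homotopic a b -> homotopic (loopV a) (loopV b).
Proof.
move=> [H [cH H0 H1 Ho]]; exists (fun p => H (p.1, 1 - p.2)); split=> //=.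
- by apply: cont_comp cH; cont.
- by move=> s t s01 /notin01 t01; apply: Ho => //; apply/notin01; lra.
Qed.

Lemma loopMA a b c : homotopic (loopM (loopM a b) c) (loopM a (loopM b c)).
Proof.
apply: (@homotopic_reparam _ _
    (fun t => Num.min (2 * t) (Num.min (t + 4^-1) ((t + 1) / 2)))).
- by cont.
- by move=> t t0; case: (leP (t + 4^-1) ((t + 1) / 2)) => ?;
         [case: (leP (2 * t) (t + 4^-1))|case: (leP (2 * t) ((t + 1) / 2))] => ?; lra.
- by move=> t t0; case: (leP (t + 4^-1) ((t + 1) / 2)) => ?;
         [case: (leP (2 * t) (t + 4^-1))|case: (leP (2 * t) ((t + 1) / 2))] => ?; lra.
- move=> t /=; case: (leP (2 * t - 1) 0) => t1.
    case: (leP (2 * (2 * t) - 1) 0) => t2.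
      have -> : Num.min (2 * t) (Num.min (t + 4^-1) ((t + 1) / 2)) = 2 * t.
        by case: (leP (t + 4^-1) ((t + 1) / 2)) => ?;
         [case: (leP (2 * t) (t + 4^-1))|case: (leP (2 * t) ((t + 1) / 2))] => ?; lra.
      by rewrite ifT //; lra.
    have -> : Num.min (2 * t) (Num.min (t + 4^-1) ((t + 1) / 2)) = t + 4^-1.
      by case: (leP (t + 4^-1) ((t + 1) / 2)) => ?;
         [case: (leP (2 * t) (t + 4^-1))|case: (leP (2 * t) ((t + 1) / 2))] => ?; lra.
    rewrite ifF; last by apply/negP; lra.
    rewrite ifT; last lra.
    by congr (b _); lra.
  have -> : Num.min (2 * t) (Num.min (t + 4^-1) ((t + 1) / 2)) = (t + 1) / 2.
    by case: (leP (t + 4^-1) ((t + 1) / 2)) => ?;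
         [case: (leP (2 * t) (t + 4^-1))|case: (leP (2 * t) ((t + 1) / 2))] => ?; lra.
  rewrite ifF; last by apply/negP; lra.
  rewrite ifF; last by apply/negP; lra.
  by congr (c _); lra.
Qed.

Lemma loop1M a : homotopic (loopM loop1 a) a.
Proof.
apply: (@homotopic_reparam _ _ (fun t => 2 * t - 1)); first by cont.
- by move=> t; lra.
- by move=> t; lra.
- move=> t /=; case: ifP => // ?; rewrite loop_out //; apply/notin01; lra.
Qed.

Lemma loopM1 a : homotopic (loopM a loop1) a.
Proof.
apply: (@homotopic_reparam _ _ (fun t => 2 * t)); first by cont.
- by move=> t; lra.
- by move=> t; lra.
- move=> t /=; case: ifPn => // /negP ?; rewrite loop_out //; apply/notin01; lra.
Qed.

Lemma loopVM a : homotopic (loopM (loopV a) a) loop1.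
Proof.
exists (fun p => a (Num.max (Num.max (2 * p.2 - 1) (1 - 2 * p.2)) p.1)).
split=> /=.
- by apply: cont_comp; [cont|exact: loop_continuous].
- move=> t; case: ifPn => [|/negP] t1; congr (a _);
  by case: (leP (2 * t - 1) (1 - 2 * t)) => ?;
     [case: (leP (1 - 2 * t) 0)|case: (leP (2 * t - 1) 0)] => ?; lra.
- move=> t; apply: loop_out; apply/notin01; right.
  by rewrite le_max lexx orbT.
- move=> s t _ /notin01 t01; apply: loop_out; apply/notin01; right.
  by rewrite !le_max; apply/orP; left; apply/orP; lra.
Qed.

Lemma loopVK a : loopV (loopV a) = a :> (R -> X).
Proof. by apply/funext => t /=; congr (a _); lra. Qed.

Lemma loopMV a : homotopic (loopM a (loopV a)) loop1.
Proof.
have [H [cH H0 H1 Ho]] := loopVM (loopV a); exists H; split=> // t.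
by rewrite H0 /=; case: ifP => // _; congr (a _); lra.
Qed.

Let mul (x y : pi1) : pi1 := \pi_pi1 (loopM (repr x) (repr y)).
Let inv (x : pi1) : pi1 := \pi_pi1 (loopV (repr x)).

Let homotopic_repr a : homotopic (repr (\pi_pi1 a)) a.
Proof. by apply/pi1P; rewrite reprK. Qed.

Lemma pi1_mulE a b : mul (\pi_pi1 a) (\pi_pi1 b) = \pi_pi1 (loopM a b).
Proof. by apply/pi1P; apply: homotopicM. Qed.

Lemma pi1_invE a : inv (\pi_pi1 a) = \pi_pi1 (loopV a).
Proof. by apply/pi1P; apply: homotopicV. Qed.

Let mulA : associative mul.
Proof.
elim/quotW=> a; elim/quotW=> b; elim/quotW=> c.
rewrite (pi1_mulE b c) (pi1_mulE a b) (pi1_mulE a) (pi1_mulE _ c).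
by apply/esym/pi1P; exact: loopMA.
Qed.
Let mul1 : left_id (\pi_pi1 loop1) mul.
Proof. by elim/quotW=> a; rewrite pi1_mulE; apply/pi1P; exact: loop1M. Qed.
Let mulr1 : right_id (\pi_pi1 loop1) mul.
Proof. by elim/quotW=> a; rewrite pi1_mulE; apply/pi1P; exact: loopM1. Qed.
Let mulV : left_inverse (\pi_pi1 loop1) inv mul.
Proof. by elim/quotW=> a; rewrite (pi1_invE a) pi1_mulE; apply/pi1P; exact: loopVM. Qed.
Let mulrV : right_inverse (\pi_pi1 loop1) inv mul.
Proof. by elim/quotW=> a; rewrite (pi1_invE a) pi1_mulE; apply/pi1P; exact: loopMV. Qed.

HB.instance Definition _ := isGroup.Build pi1 mulA mul1 mulr1 mulV mulrV.
End FundamentalGroup.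
End Topology.

Arguments loop R {X} x0.
Arguments pi1 R {X} x0.

Section MappingClassGroup.
Context {R : realType} {S : topologicalType}.

Record bhomeo (B : set S) := BHomeo {
  bhomeo_fun :> S -> S;
  bhomeo_inv : S -> S;
  bhomeo_continuous : continuous bhomeo_fun;
  bhomeo_inv_continuous : continuous bhomeo_inv;
  bhomeoK : cancel bhomeo_fun bhomeo_inv;
  bhomeo_invK : cancel bhomeo_inv bhomeo_fun;
  bhomeo_fix : forall x, B x -> bhomeo_fun x = x }.

HB.instance Definition _ B := gen_eqMixin (bhomeo B).
HB.instance Definition _ B := gen_choiceMixin (bhomeo B).

Context {B : set S}.
Implicit Types f h : bhomeo B.

(* Fixing the nonempty boundary of a connected oriented surface, homeomorphisms
   preserve the orientation. *)
Definition isotopic f h := exists H : R * S -> S, [/\ continuous H,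
  forall x, H (0, x) = f x, forall x, H (1, x) = h x
  & forall s, 0 <= s <= 1 -> exists k : bhomeo B, forall x, H (s, x) = k x].

Lemma isotopic_refl f : isotopic f f.
Proof.
exists (fun p => f p.2); split=> //= [|s _]; last by exists f.
by apply: cont_comp; [cont|exact: bhomeo_continuous].
Qed.

Lemma isotopic_sym f h : isotopic f h -> isotopic h f.
Proof.
move=> [H [cH H0 H1 Hk]]; exists (fun p => H (1 - p.1, p.2)); split=> /=.
- by apply: cont_comp cH; cont.
- by move=> x; rewrite subr0.
- by move=> x; rewrite subrr.
- by move=> s s01; apply: Hk; lra.
Qed.

Lemma isotopic_trans h f k : isotopic f h -> isotopic h k -> isotopic f k.
Proof.
move=> [H [cH H0 H1 Hk]] [K [cK K0 K1 Kk]].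
exists (fun p => if 2 * p.1 - 1 <= 0 then H (2 * p.1, p.2)
                 else K (2 * p.1 - 1, p.2)); split=> /=.
- apply: (@continuous_glue _ _ _ (fun p : R * S => 2 * p.1 - 1)
    (fun p => H (2 * p.1, p.2)) (fun p => K (2 * p.1 - 1, p.2))).
  + by cont.
  + by apply: cont_comp cH; cont.
  + by apply: cont_comp cK; cont.
  + by move=> [u v] /= u1; rewrite u1 K0; move/subr0_eq : u1 => ->.
- by move=> t; rewrite mulr0 sub0r lerN10 H0.
- move=> t; rewrite ifF; last by apply/negP; lra.
  by rewrite (_ : 2 * 1 - 1 = 1 :> R) ?K1//; lra.
- move=> s s01; case: (leP (2 * s - 1) 0) => s2.
    by apply: Hk; lra.
  by apply: Kk; lra.
Qed.

Lemma isotopic_equiv : equiv_class_of (fun f h => `[< isotopic f h >]).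
Proof.
split=> [a|a b|b a c].
- exact/asboolP/isotopic_refl.
- by apply/asboolP/asboolP; exact: isotopic_sym.
- by move=> /asboolP ab /asboolP bc; apply/asboolP; exact: isotopic_trans bc.
Qed.

Definition isotopic_rel := EquivRelPack isotopic_equiv.

Definition mapping_class := {eq_quot isotopic_rel}.
HB.instance Definition _ := Choice.on mapping_class.
HB.instance Definition _ := EqQuotient.on mapping_class.

Lemma mapping_classP f h :
  \pi_mapping_class f = \pi_mapping_class h <-> isotopic f h.
Proof. by split=> [/eqmodP/asboolP|fh]; [|apply/eqmodP/asboolP]. Qed.

Context {x0 : S} (Bx0 : B x0).

Definition bhomeo_loop f (a : loop R x0) : loop R x0.
Proof.
exists (fun t => f (a t)).
  by apply: cont_comp; [exact: loop_continuous|exact: bhomeo_continuous].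
by move=> t t01; rewrite loop_out // bhomeo_fix.
Defined.

Definition mapping_class_pi1 (phi : mapping_class) (x : pi1 R x0) : pi1 R x0 :=
  \pi_(pi1 R x0) (bhomeo_loop (repr phi) (repr x)).

Lemma mapping_class_pi1E f a :
  mapping_class_pi1 (\pi_mapping_class f) (\pi_(pi1 R x0) a) =
  \pi_(pi1 R x0) (bhomeo_loop f a).
Proof.
rewrite /mapping_class_pi1; set h := repr _; set b := repr _.
have hf : isotopic h f by apply/mapping_classP; rewrite reprK.
have ba : homotopic b a by apply/pi1P; rewrite reprK.
apply/pi1P; apply: (@homotopic_trans _ _ _ (bhomeo_loop h a)).
  move: ba => [H [cH H0 H1 Ho]]; exists (fun p => h (H p)); split=> /=.
  - by apply: cont_comp; [exact: cH|exact: bhomeo_continuous].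
  - by move=> t; rewrite H0.
  - by move=> t; rewrite H1.
  - by move=> s t s01 t01; rewrite Ho // bhomeo_fix.
move: hf => [H [cH H0 H1 Hk]]; exists (fun p => H (p.1, a p.2)); split=> //=.
- apply: cont_comp cH; apply: cont_pair; first by cont.
  by apply: cont_comp; [cont|exact: loop_continuous].
- by move=> s t s01 t01; have [k ->] := Hk s s01; rewrite loop_out // bhomeo_fix.
Qed.
End MappingClassGroup.

Arguments mapping_class R {S} B.

Section Surface.
Context {R : realType} {S : topologicalType}.

(* f is a homeomorphism of U, a neighbourhood of x, with an open subset of the
   closed upper half plane *)
Definition half_plane_chart (x : S) (U : set S) (f : S -> R * R) :=
  exists (V : set (R * R)) (h : R * R -> S),
    let V' := V `&` [set y | 0 <= y.2] in
    [/\ open U, U x & open V] /\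
    [/\ f @` U `<=` V', h @` V' `<=` U,
        {within U, continuous f}, {within V', continuous h}
      & {in U, cancel f h} /\ {in V', cancel h f}].

Definition surface_boundary : set S :=
  [set x | exists U f, half_plane_chart x U f /\ (f x).2 = 0].

Definition surface_with_boundary :=
  [/\ compact [set: S], hausdorff_space S, connected [set: S]
    & forall x, exists U f, half_plane_chart x U f].
End Surface.

Arguments surface_boundary R S : clear implicits.
Arguments surface_with_boundary R S : clear implicits.

(* the universal property of the free group on x *)
Definition free_basis (n : nat) (G : groupType) (x : 'I_n -> G) :=
  forall (L : groupType) (y : 'I_n -> L),
    exists! h : G -> L,
      {morph h : a b / (a * b)%g >-> (a * b)%g} /\ forall i, h (x i) = y i.

(* The surface of genus g with one boundary component, with a standard basis of
   its fundamental group: p_1, ..., p_g (the first g elements) and q_1, ..., q_g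
   (the last g elements). That the boundary is a product of g commutators in a
   basis of length 2g forces S to be orientable and its genus to be g, and the
   classes of the p_i and of the q_i to form a symplectic basis of the first
   homology for the intersection form of one of the orientations. *)
Record bounded_surface (R : realType) (g : nat) := BoundedSurface {
  surface_space :> topologicalType;
  surface_pt : surface_space;
  surface_curve : loop R surface_pt;
  surface_gen : 'I_(g + g) -> pi1 R surface_pt;
  surfaceP : surface_with_boundary R surface_space;
  surface_curve_inj : {in [set t : R | 0 <= t < 1] &, injective surface_curve};
  surface_curve_image :
    surface_curve @` [set t : R | 0 <= t <= 1] = surface_boundary R surface_space;
  surface_gen_free : free_basis surface_gen;
  surface_curveE : \pi_(pi1 R surface_pt) surface_curve =
    (\prod_(i < g) [~ surface_gen (lshift g i), surface_gen (rshift g i)])%g }.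

Lemma surface_pt_boundary R g (S : bounded_surface R g) :
  surface_boundary R S (surface_pt S).
Proof.
rewrite -surface_curve_image; exists 0 => /=; first by rewrite lexx ler01.
by rewrite loop_out // ltxx.
Qed.

Section LowerCentralSeries.
Context {G : groupType}.

Inductive generated (A : set G) : set G :=
| generated_mem x of A x : generated A x
| generated1 : generated A 1%g
| generatedM x y of generated A x & generated A y : generated A (x * y)%g
| generatedV x of generated A x : generated A x^-1%g.

(* indexed from 1 *)
Fixpoint lower_central (k : nat) : set G :=
  match k with
  | 0 | 1 => setT
  | (k'.+1 as k1).+1 =>
      generated [set [~ p.1, p.2]%g | p in [set: G] `*` lower_central k1]
  end.
End LowerCentralSeries.

Section LinearAlgebra.
Context {K : fieldType} {V : vectType K}.

Lemma ex_span (A : set V) : exists U : {vspace V},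
  (forall x, A x -> x \in U) /\
  (forall W : {vspace V}, (forall x, A x -> x \in W) -> (U <= W)%VS).
Proof.
pose P d := `[< exists X : seq V, (forall x, x \in X -> A x) /\ \dim <<X>>%VS = d >].
have exP : exists d, P d.
  by exists 0%N; apply/asboolP; exists [::]; rewrite span_nil dimv0.
have ubP d : P d -> (d <= \dim {:V})%N.
  by move=> /asboolP[X [_ <-]]; rewrite dimvS ?subvf.
have [d /asboolP[X [XA dX]] dmax] := ex_maxnP exP ubP.
exists <<X>>%VS; split=> [x Ax|W AW]; last by apply/span_subvP => x /XA/AW.
have sub : (<<X>> <= <<x :: X>>)%VS by rewrite span_cons addvSr.
have : \dim <<X>>%VS == \dim <<x :: X>>%VS.
  rewrite eqn_leq dimvS //= dX; apply: dmax; apply/asboolP; exists (x :: X).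
  by split=> // y; rewrite inE => /predU1P[->//|/XA].
have [_ ->] := dimv_leqif_eq sub; move/eqP => ->.
by rewrite memv_span ?mem_head.
Qed.

Definition vspan (A : set V) : {vspace V} := sval (cid (ex_span A)).

Lemma mem_vspan (A : set V) x : A x -> x \in vspan A.
Proof. by rewrite /vspan; case: cid => U /= [+ _] => /[apply]. Qed.

Lemma vspan_subvP (A : set V) (W : {vspace V}) :
  (forall x, A x -> x \in W) <-> (vspan A <= W)%VS.
Proof.
split; first by rewrite /vspan; case: cid => U /= [_ +] => /[apply].
by move=> AW x /mem_vspan; apply: subvP.
Qed.

Definition vquot (U : {vspace V}) := Quotient.quot U.
HB.instance Definition _ U := GRing.Zmodule.on (vquot U).
HB.instance Definition _ U := EqQuotient.on (vquot U).

Definition vquot_pi (U : {vspace V}) (x : V) : vquot U := \pi_(vquot U) x.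

Lemma vquot_piP U x y : (vquot_pi U x == vquot_pi U y) = (x - y \in U).
Proof. by rewrite /vquot_pi -Quotient.idealrBE. Qed.

Let scale U (a : K) (x : vquot U) : vquot U := vquot_pi U (a *: repr x).

Lemma vquot_scaleE U a x : scale a (vquot_pi U x) = vquot_pi U (a *: x).
Proof.
apply/eqP; rewrite vquot_piP -scalerBr memvZ // -vquot_piP /vquot_pi.
by rewrite reprK.
Qed.

Lemma vquot_addE U x y : vquot_pi U x + vquot_pi U y = vquot_pi U (x + y).
Proof. by rewrite /vquot_pi !piE. Qed.

Let scalerA U a b (x : vquot U) : scale a (scale b x) = scale (a * b) x.
Proof.
elim/quotW: x => x; rewrite -/(vquot_pi U x).
by rewrite (vquot_scaleE U b) (vquot_scaleE U a) (vquot_scaleE U (a * b)) scalerA.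
Qed.
Let scale1r U : left_id 1 (@scale U).
Proof. by elim/quotW => x; rewrite -/(vquot_pi U x) vquot_scaleE scale1r. Qed.
Let scalerDr U : right_distributive (@scale U) +%R.
Proof.
move=> a; elim/quotW => x; elim/quotW => y; rewrite -/(vquot_pi U x) -/(vquot_pi U y).
by rewrite vquot_addE !vquot_scaleE vquot_addE scalerDr.
Qed.
Let scalerDl U (x : vquot U) : {morph (@scale U)^~ x : a b / a + b}.
Proof.
elim/quotW: x => x a b; rewrite -/(vquot_pi U x).
by rewrite !vquot_scaleE vquot_addE scalerDl.
Qed.

HB.instance Definition _ U := GRing.Zmodule_isLmodule.Build K (vquot U)
  (@scalerA U) (@scale1r U) (@scalerDr U) (@scalerDl U).

Fact vquot_pi_is_linear U : linear (vquot_pi U).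
Proof. by move=> a x y; rewrite -vquot_addE -vquot_scaleE. Qed.

HB.instance Definition _ U :=
  GRing.isLinear.Build K V (vquot U) _ (vquot_pi U) (vquot_pi_is_linear U).
End LinearAlgebra.

(* The k-th tensor power of K^n, in coordinates: u I is the coefficient of
   e_(I 0) (x) ... (x) e_(I (k - 1)). *)
Notation multi n k := {ffun 'I_k -> 'I_n}.
Notation tensor K n k := {ffun multi n k -> K^o}.

Section Tensor.
Context {K : fieldType} {n : nat}.
Local Notation T k := (tensor K n k).

Definition tens k l (u : T k) (v : T l) : T (k + l) :=
  [ffun I : multi n (k + l) =>
     u [ffun i => I (lshift l i)] * v [ffun i => I (rshift k i)]].

Definition tens_cast k l (e : k = l) (u : T k) : T l :=
  [ffun I : multi n l => u [ffun i => I (cast_ord e i)]].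

Definition lie k l (u : T k) (v : T l) : T (k + l) :=
  tens u v - tens_cast (addnC l k) (tens v u).

Definition basis_vec (j : 'I_n) : T 1 := [ffun I : multi n 1 => (I ord0 == j)%:R].

(* The free Lie algebra on K^n, realized as the Lie subalgebra of the tensor
   algebra generated by K^n (Witt). *)
Inductive lie_monomial : forall k, T k -> Prop :=
| lie_monomial1 (u : T 1) : lie_monomial u
| lie_monomial_lie k l (u : T k) (v : T l) of
    lie_monomial u & lie_monomial v : lie_monomial (lie u v).

Definition free_lie (k : nat) : {vspace T k} := vspan [set u | lie_monomial u].

Definition multi_cons m (j : 'I_n) (I : multi n m) : multi n m.+1 :=
  [ffun i => if unlift ord0 i is Some i' then I i' else j].

(* t is the sum over j of basis_vec j (x) tens_slice j t *)
Definition tens_slice m (j : 'I_n) (t : T m.+1) : T m :=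
  [ffun I : multi n m => t (multi_cons j I)].

Definition bracketing m (t : T m.+1) : T m.+1 :=
  \sum_j lie (basis_vec j) (tens_slice j t).

Definition tens_free_lie m : {vspace T m.+1} :=
  vspan [set t | exists (u : T 1) (v : T m), v \in free_lie m /\ t = tens u v].

Definition multi_insert m (a : 'I_m.+2) (b : 'I_m.+1) (i j : 'I_n) (I : multi n m) :
    multi n m.+2 :=
  [ffun c => if unlift a c is Some c' then
               if unlift b c' is Some c'' then I c'' else j
             else i].

Definition tensor_act k (A : 'M[K]_n) (t : T k) : T k :=
  [ffun I : multi n k => \sum_(J : multi n k) (\prod_l A (I l) (J l)) * t J].

(* the generators a and b of the dihedral group: tens_rot sends v_1 (x) ... (x) v_k
   to v_2 (x) ... (x) v_k (x) v_1 *)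
Definition tens_rot k (t : T k) : T k :=
  [ffun I : multi n k => t [ffun i => I (ord_pred i)]].

Definition tens_flip k (t : T k) : T k :=
  [ffun I : multi n k => (-1) ^+ k.+1 * t [ffun i => I (rev_ord i)]].

Fact tensor_act_is_linear k (A : 'M[K]_n) : linear (@tensor_act k A).
Proof.
move=> a u v; apply/ffunP=> I; rewrite !ffunE scaler_sumr -big_split /=.
by apply: eq_bigr => J _; rewrite !ffunE /= mulrDr; congr (_ + _); exact: mulrCA.
Qed.
HB.instance Definition _ k A :=
  GRing.isLinear.Build K (T k) (T k) _ (tensor_act A) (@tensor_act_is_linear k A).

Fact tens_slice_is_linear m j : linear (@tens_slice m j).
Proof. by move=> a u v; apply/ffunP=> I; rewrite !ffunE. Qed.
HB.instance Definition _ m j :=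
  GRing.isLinear.Build K (T m.+1) (T m) _ (tens_slice j) (@tens_slice_is_linear m j).

Fact lie_is_linear k l (u : T k) : linear (@lie k l u).
Proof.
move=> a v w; apply/ffunP=> I; rewrite !ffunE /= mulrDr mulrDl scalerBr.
rewrite opprD addrACA; congr (_ - _ + _); last by rewrite -scalerAl.
by rewrite scalerAr.
Qed.
HB.instance Definition _ k l (u : T k) :=
  GRing.isLinear.Build K (T l) (T (k + l)) _ (@lie k l u) (@lie_is_linear k l u).

Fact bracketing_is_linear m : linear (@bracketing m).
Proof.
move=> a u v; rewrite /bracketing scaler_sumr -big_split /=.
by apply: eq_bigr => j _; rewrite !linearP.
Qed.
HB.instance Definition _ m :=
  GRing.isLinear.Build K (T m.+1) (T m.+1) _ (@bracketing m) (@bracketing_is_linear m).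
End Tensor.

Section TensorAction.
Context {K : fieldType} {n : nat}.
Local Notation T k := (tensor K n k).
Implicit Type A : 'M[K]_n.

Definition multi_cat k l (I : multi n k) (J : multi n l) : multi n (k + l) :=
  [ffun i => match fintype.split i with inl i => I i | inr j => J j end].

Lemma multi_catl k l (I : multi n k) (J : multi n l) :
  [ffun i => multi_cat I J (lshift l i)] = I.
Proof. by apply/ffunP=> i; rewrite !ffunE (unsplitK (inl i)). Qed.

Lemma multi_catr k l (I : multi n k) (J : multi n l) :
  [ffun i => multi_cat I J (rshift k i)] = J.
Proof. by apply/ffunP=> i; rewrite !ffunE (unsplitK (inr i)). Qed.

Lemma big_multi_cat k l (F : multi n (k + l) -> K) :
  \sum_J F J = \sum_J1 \sum_J2 F (multi_cat J1 J2).
Proof.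
rewrite pair_big /=.
rewrite (reindex (fun p : multi n k * multi n l => multi_cat p.1 p.2)) //=.
exists (fun J : multi n (k + l) =>
  ([ffun i => J (lshift l i)], [ffun i => J (rshift k i)])).
  by move=> [J1 J2] _ /=; rewrite multi_catl multi_catr.
move=> J _; apply/ffunP=> i; rewrite ffunE.
by case: splitP => j ij; rewrite ffunE; congr (J _); apply: val_inj.
Qed.

Lemma tensor_act_tens k l A (u : T k) (v : T l) :
  tensor_act A (tens u v) = tens (tensor_act A u) (tensor_act A v).
Proof.
apply/ffunP=> I; rewrite !ffunE big_multi_cat mulr_suml; apply: eq_bigr => J1 _.
rewrite mulr_sumr; apply: eq_bigr => J2 _.
rewrite ffunE multi_catl multi_catr big_split_ord /= mulrACA.
congr (_ * _ * (_ * _)); apply: eq_bigr => i _; rewrite !ffunE.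
  by rewrite (unsplitK (inl i)).
by rewrite (unsplitK (inr i)).
Qed.

Lemma tensor_act_cast k l A (e : k = l) (u : T k) :
  tensor_act A (tens_cast e u) = tens_cast e (tensor_act A u).
Proof.
have id_cast m (w : T m) : tens_cast erefl w = w.
  apply/ffunP=> I; rewrite ffunE; congr (w _); apply/ffunP=> i.
  by rewrite ffunE cast_ord_id.
by case: l / e; rewrite !id_cast.
Qed.

Lemma tensor_act_lie k l A (u : T k) (v : T l) :
  tensor_act A (lie u v) = lie (tensor_act A u) (tensor_act A v).
Proof. by rewrite /lie linearB /= tensor_act_cast !tensor_act_tens. Qed.

Lemma tensor_act_free_lie k A (u : T k) :
  u \in free_lie k -> tensor_act A u \in free_lie k.
Proof.
suff: (free_lie k <= linfun (tensor_act A) @^-1: free_lie k)%VS.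
  by move=> /subvP sub /sub; rewrite -memv_preim lfunE.
apply/vspan_subvP => {}u /= Lu; rewrite -memv_preim lfunE /=; apply: mem_vspan => /=.
elim: Lu => [w|k' l w v _ IHw _ IHv]; first exact: lie_monomial1.
by rewrite tensor_act_lie; apply: lie_monomial_lie.
Qed.

Lemma tensor_act_tens_free_lie m A (t : T m.+1) :
  t \in tens_free_lie m -> tensor_act A t \in tens_free_lie m.
Proof.
suff: (tens_free_lie m <= linfun (tensor_act A) @^-1: tens_free_lie m)%VS.
  by move=> /subvP sub /sub; rewrite -memv_preim lfunE.
apply/vspan_subvP => _ [u [v [Lv ->]]]; rewrite -memv_preim lfunE /=.
apply: mem_vspan; exists (tensor_act A u), (tensor_act A v).
by split; [exact: tensor_act_free_lie|exact: (@tensor_act_tens 1)].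
Qed.

Lemma tens_sliceE m (t : T m.+1) :
  t = \sum_j (tens (basis_vec j) (tens_slice j t) : T m.+1).
Proof.
apply/ffunP=> I; rewrite sum_ffunE (bigD1 (I ord0)) //= big1 => [|j jI].
  rewrite !ffunE addr0 (_ : lshift m ord0 = ord0); last exact: val_inj.
  rewrite eqxx mul1r; congr (t _); apply/ffunP => i; rewrite !ffunE.
  case: unliftP => [i' ->|->] //; rewrite ffunE; congr (I _); exact: val_inj.
rewrite !ffunE (_ : lshift m ord0 = ord0); last exact: val_inj.
by rewrite eq_sym (negbTE jI) mul0r.
Qed.

Lemma bracketing_tens m (u : T 1) (v : T m) : bracketing (tens u v) = lie u v.
Proof.
have sl j : tens_slice j (tens u v : T m.+1) = u [ffun=> j] *: v.
  apply/ffunP=> I; rewrite !ffunE; congr (u _ * v _); apply/ffunP=> i; rewrite !ffunE.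
    by rewrite (_ : lshift m i = ord0) ?unlift_none //; apply: val_inj; rewrite /= ord1.
  by rewrite (_ : rshift 1 i = lift ord0 i) ?liftK //; exact: val_inj.
rewrite /bracketing; apply/ffunP=> I; rewrite sum_ffunE.
under eq_bigr => j _ do rewrite sl linearZ /=.
rewrite !ffunE.
under eq_bigr => j _ do rewrite !ffunE scalerBr.
rewrite sumrB; congr (_ - _).
  rewrite (bigD1 (I (lshift m (ord0 : 'I_1)))) //= big1 => [|j jI].
    rewrite eqxx addr0 mul1r; congr (u _ * _).
    by apply/ffunP=> i; rewrite !ffunE (ord1 i).
  by rewrite eq_sym (negbTE jI) mul0r scaler0.
set i0 := cast_ord (addnC m 1) (rshift m (ord0 : 'I_1)).
rewrite (bigD1 (I i0)) //= big1 => [|j jI].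
  rewrite eqxx addr0 mulr1 mulrC; congr (u _ * _).
  by apply/ffunP=> i; rewrite !ffunE (ord1 i).
by rewrite eq_sym (negbTE jI) mulr0 scaler0.
Qed.

Lemma tensor_act_bracketing m A (t : T m.+1) :
  tensor_act A (bracketing t) = bracketing (tensor_act A t).
Proof.
rewrite [in RHS](tens_sliceE t) {1}/bracketing !linear_sum /=; apply: eq_bigr => j _.
apply: (etrans (tensor_act_lie A (basis_vec j) (tens_slice j t))).
apply: (etrans (esym (bracketing_tens _ _))); congr bracketing.
exact/esym/(@tensor_act_tens 1 m).
Qed.
End TensorAction.

Section Symplectic.
Context (K : fieldType) (g : nat).
Local Notation T k := (tensor K (g + g) k).

(* The first homology of the surface is identified with K^(2g): p_1, ..., p_g are
   the first g vectors of the canonical basis and q_1, ..., q_g the last ones. *)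
Definition omega : 'M[K]_(g + g) := block_mx 0 1%:M (- 1%:M) 0.

Definition Sp : set 'M[K]_(g + g) := [set A | A^T *m omega *m A = omega].

(* contraction of the factors number a and lift a b *)
Definition tens_contraction m (a : 'I_m.+2) (b : 'I_m.+1) (t : T m.+2) : T m :=
  [ffun I : multi (g + g) m => \sum_i \sum_j omega i j * t (multi_insert a b i j I)].

(* the image of u by the element t of H (x) H^(x)m = Hom(H, H^(x)m) *)
Definition eval_tensor m (t : T m.+1) (u : T 1) : T m :=
  \sum_i \sum_j (u [ffun=> i] * omega i j) *: tens_slice j t.

Fact tens_contraction_is_linear m a b : linear (@tens_contraction m a b).
Proof.
move=> c u v; apply/ffunP=> I; rewrite !ffunE scaler_sumr -big_split /=.
apply: eq_bigr => i _; rewrite scaler_sumr -big_split /=.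
by apply: eq_bigr => j _; rewrite !ffunE /= mulrDr; congr (_ + _); exact: mulrCA.
Qed.
HB.instance Definition _ m a b := GRing.isLinear.Build K (T m.+2) (T m) _
  (@tens_contraction m a b) (@tens_contraction_is_linear m a b).

Definition johnson_target (s : nat) : {vspace T s.+2} :=
  (tens_free_lie s.+1 :&: lker (linfun (@bracketing K (g + g) s.+1)))%VS.

Definition traceless (s : nat) : {vspace T s} :=
  match s with
  | m.+2 => (\bigcap_a \bigcap_b lker (linfun (@tens_contraction m a b)))%VS
  | _ => fullv
  end.

Definition dihedral_relations (s : nat) : {vspace subvs_of (traceless s)} :=
  vspan [set z | exists (i j : nat) (x : subvs_of (traceless s)),
    vsval z = iter i (@tens_rot K (g + g) s) (iter j (@tens_flip K (g + g) s) (vsval x))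
              - vsval x].

Definition dihedral_coinvariants (s : nat) := vquot (dihedral_relations s).

Implicit Type A : 'M[K]_(g + g).

Lemma tensor_act_johnson_target s A (t : T s.+2) :
  t \in johnson_target s -> tensor_act A t \in johnson_target s.
Proof.
rewrite !memv_cap !memv_ker !lfunE /= => /andP[Lt /eqP t0].
by rewrite tensor_act_tens_free_lie //= -tensor_act_bracketing t0 linear0.
Qed.

Lemma big_multi_insert m (a : 'I_m.+2) (b : 'I_m.+1) (F : multi (g + g) m.+2 -> K) :
  \sum_J F J = \sum_i \sum_j \sum_J F (multi_insert a b i j J).
Proof.
under [RHS]eq_bigr do rewrite pair_big /=.
rewrite pair_big /= (reindex (fun p : 'I_(g + g) * ('I_(g + g) * multi (g + g) m) =>
  multi_insert a b p.1 p.2.1 p.2.2)) //=.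
exists (fun J : multi (g + g) m.+2 =>
  (J a, (J (lift a b), [ffun c => J (lift a (lift b c))]))).
  move=> [i [j J]] _ /=; rewrite !ffunE unlift_none liftK unlift_none.
  by congr (_, (_, _)); apply/ffunP=> c; rewrite !ffunE !liftK.
move=> J _; apply/ffunP=> c; rewrite !ffunE.
case: unliftP => [c' ->|-> //]; case: unliftP => [c'' ->|-> //].
by rewrite ffunE.
Qed.

Lemma tens_contraction_act m a b A (t : T m.+2) :
  Sp A -> tens_contraction a b (tensor_act A t) = tensor_act A (tens_contraction a b t).
Proof.
move=> SpA; apply/ffunP=> I; rewrite !ffunE.
have actE i j : tensor_act A t (multi_insert a b i j I) =
    \sum_i' \sum_j' A i i' * A j j' *
      \sum_(J : multi (g + g) m) (\prod_c A (I c) (J c)) * t (multi_insert a b i' j' J).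
  rewrite ffunE (big_multi_insert a b); apply: eq_bigr => i' _; apply: eq_bigr => j' _.
  rewrite mulr_sumr; apply: eq_bigr => J _; rewrite mulrA; congr (_ * _).
  rewrite (bigD1_ord a) //= (bigD1_ord b) //= !ffunE unlift_none liftK unlift_none.
  by rewrite mulrA; congr (_ * _); apply: eq_bigr => c _; rewrite !ffunE !liftK.
under eq_bigr do under eq_bigr do rewrite actE.
pose W i' j' := \sum_(J : multi (g + g) m) (\prod_c A (I c) (J c)) * t (multi_insert a b i' j' J).
transitivity (\sum_i' \sum_j' omega i' j' * W i' j').
  transitivity (\sum_i \sum_j \sum_i' \sum_j' omega i j * (A i i' * A j j') * W i' j').
    apply: eq_bigr => i _; apply: eq_bigr => j _; rewrite mulr_sumr.
    by apply: eq_bigr => i' _; rewrite mulr_sumr; apply: eq_bigr => j' _; rewrite mulrA.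
  under eq_bigr do rewrite exchange_big /=.
  rewrite exchange_big /=; apply: eq_bigr => i' _.
  under eq_bigr do rewrite exchange_big /=.
  rewrite exchange_big /=; apply: eq_bigr => j' _.
  under eq_bigr do rewrite -mulr_suml.
  rewrite -mulr_suml; congr (_ * _); rewrite -{2}SpA mxE exchange_big /=.
  apply: eq_bigr => j _; rewrite mxE mulr_suml; apply: eq_bigr => i _.
  by rewrite !mxE mulrA (mulrC (A i i')).
rewrite /W; under eq_bigr do under eq_bigr do rewrite mulr_sumr.
under eq_bigr do rewrite exchange_big /=.
rewrite exchange_big /=; apply: eq_bigr => J _.
rewrite !ffunE mulr_sumr; apply: eq_bigr => i _; rewrite mulr_sumr.
by apply: eq_bigr => j _; rewrite mulrCA.
Qed.

Lemma tensor_act_traceless s A (t : T s) :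
  Sp A -> t \in traceless s -> tensor_act A t \in traceless s.
Proof.
case: s t => [|[|m]] t SpA; rewrite ?memvf // /traceless.
have capP (u : T m.+2) : reflect (forall a b, tens_contraction a b u = 0)
    (u \in (\bigcap_a \bigcap_b lker (linfun (@tens_contraction m a b)))%VS).
  rewrite memvE; apply: (iffP subv_bigcapP) => [u0 a b|u0 a _].
    have /subv_bigcapP/(_ b isT) := u0 a isT.
    by rewrite -memvE memv_ker lfunE => /eqP.
  by apply/subv_bigcapP => b _; rewrite -memvE memv_ker lfunE /= u0.
by move/capP => t0; apply/capP => a b; rewrite tens_contraction_act // t0 linear0.
Qed.

(* The restriction to U of the action of A on a tensor power, meaningful when U
   is stable: the projection is then the identity on the values it is applied to. *)
Definition subvs_act k (U : {vspace T k}) A (x : subvs_of U) : subvs_of U :=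
  vsproj U (tensor_act A (vsval x)).

Lemma johnson_target_actE s A (x : subvs_of (johnson_target s)) :
  vsval (subvs_act A x) = tensor_act A (vsval x).
Proof. by rewrite vsprojK // tensor_act_johnson_target ?subvsP. Qed.

Lemma traceless_actE s A (x : subvs_of (traceless s)) :
  Sp A -> vsval (subvs_act A x) = tensor_act A (vsval x).
Proof. by move=> SpA; rewrite vsprojK // tensor_act_traceless ?subvsP. Qed.
End Symplectic.

Section Johnson.
Context {n : nat} {G : groupType} (x : 'I_n -> G).

(* For a basis x of a free group G, gr_class x y u holds if and only if y lies in
   the k-th term G_k of the lower central series of G, and u is the image of the
   class of y by the isomorphism (G_k / G_(k + 1)) (x) K = L_k(K^n). *)
Inductive gr_class (K : fieldType) : forall k, G -> tensor K n k -> Prop :=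
| gr_class_gen i : gr_class (x i) (basis_vec i)
| gr_class_lie k l y z (u : tensor K n k) (v : tensor K n l) of
    gr_class y u & gr_class z v : gr_class [~ y, z]%g (lie u v)
| gr_classM k y z (u v : tensor K n k) of
    gr_class y u & gr_class z v : gr_class (y * z)%g (u + v)
| gr_classV k y (u : tensor K n k) of gr_class y u : gr_class y^-1%g (- u)
| gr_class0 k y of (0 < k)%N & lower_central k.+1 y :
    gr_class y (0 : tensor K n k).
End Johnson.

Section JohnsonCokernel.
Context {R : realType} {g : nat} (S : bounded_surface R g).
Local Notation Mod := (mapping_class R (surface_boundary R S)).
Local Notation gen := (@surface_gen R g S).
Local Notation act phi := (mapping_class_pi1 (surface_pt_boundary S) phi).

Definition johnson_filtration (s : nat) : set Mod :=
  [set phi | forall z, lower_central s.+1 (z^-1 * act phi z)%g].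

Definition johnson_hom (K : fieldType) (s : nat) (phi : Mod)
    (t : subvs_of (johnson_target K g s)) :=
  forall z (u : tensor K (g + g) 1), gr_class gen z u ->
    gr_class gen (z^-1 * act phi z)%g (eval_tensor (vsval t) u).

Definition johnson_image (K : fieldType) (s : nat) :
    {vspace subvs_of (johnson_target K g s)} :=
  vspan [set t | exists2 phi, johnson_filtration s phi & johnson_hom phi t].

Definition johnson_cokernel (K : fieldType) (s : nat) := vquot (johnson_image K s).
End JohnsonCokernel.

(* Main.v *)
From HB Require Import structures.
Require Import Defs.
From mathcomp Require Import all_boot all_order all_algebra.
From mathcomp Require Import all_classical all_reals.
From mathcomp Require Import perm generic_quotient topology normedtype.
From mathcomp Require Import ring lra zify.

(**
The epimorphism sends the class of t to the class of the traceless part of the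
contraction of the first and last factors of t (the Satoh trace).

It kills the Johnson image for the following reason. Send the generators x_i of
the free group to products of transvections 1 + 'X E_(c, c+1) over K['X]. The
Fox Jacobian of an automorphism phi is invertible up to a power of 'X by the
chain rule, so its determinant is a monomial; if phi lies in the s-th term of
the Johnson filtration, the trace of its leading term therefore vanishes. For
suitable transvections this trace is a coefficient of the sum of the cyclic
rotations of the contraction of tau(phi), so that the contraction is zero in
the cyclic coinvariants.

For surjectivity, let v_1, ..., v_s be pairwise orthogonal vectors and a, b a
hyperbolic pair orthogonal to them. The contraction of the caterpillar tree with
leaves a, v_1, ..., v_s, b is twice the class of v_1 (x) ... (x) v_s. When g is
large such isotropic tensors, together with the insertions of the symplectic
form, span all tensors, and hence the former span the traceless ones: a linear
functional lam vanishing on both is zero over the rationals, because adding a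
fresh hyperbolic pair (p_k, q_k) to two factors of a tensor kills their pairing,
and averaging over k bounds the sup norm of lam by a small multiple of itself.
*)

Set Implicit Arguments.
Unset Strict Implicit.
Unset Printing Implicit Defensive.
Import Order.TTheory GRing.Theory Num.Theory.
Local Open Scope classical_set_scope.
Local Open Scope quotient_scope.
Local Open Scope ring_scope.

(** * Matrix representations of free groups *)

Section FreeInduction.
Context {n : nat} {G : groupType} {x : 'I_n -> G} (P : pred G).
Hypotheses (P1 : P 1%g) (PM : forall y z, P y -> P z -> P (y * z)%g)
  (PV : forall y, P y -> P y^-1%g).

Definition subgroup_of := {y : G | P y}.
HB.instance Definition _ := Choice.on subgroup_of.

Let mul (y z : subgroup_of) : subgroup_of := exist _ (val y * val z)%g (PM (valP y) (valP z)).
Let inv (y : subgroup_of) : subgroup_of := exist _ (val y)^-1%g (PV (valP y)).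
Let one : subgroup_of := exist _ 1%g P1.
Let mulA : associative mul.
Proof. by move=> a b c; apply: val_inj; rewrite /= mulgA. Qed.
Let mul1 : left_id one mul.
Proof. by move=> a; apply: val_inj; rewrite /= mul1g. Qed.
Let mulr1 : right_id one mul.
Proof. by move=> a; apply: val_inj; rewrite /= mulg1. Qed.
Let mulV : left_inverse one inv mul.
Proof. by move=> a; apply: val_inj; rewrite /= mulVg. Qed.
Let mulrV : right_inverse one inv mul.
Proof. by move=> a; apply: val_inj; rewrite /= mulgV. Qed.
HB.instance Definition _ := isGroup.Build subgroup_of mulA mul1 mulr1 mulV mulrV.

(** The lift of [x] to the subgroup, followed by the inclusion, is an endomorphism of [G] fixing the
    basis. By uniqueness it is the identity, so every element is a value of the inclusion. *)
Lemma free_basis_subgroup : free_basis x -> (forall i, P (x i)) -> forall y, P y.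
Proof.
move=> fx Px y.
have [h [[hM hx] _]] := fx subgroup_of (fun i => exist _ (x i) (Px i)).
have [k [_ k_uniq]] := fx G x.
have hE : k = (fun z => val (h z)).
  by apply: k_uniq; split=> [a b|i]; rewrite ?hM ?hx.
have idE : k = (fun z => z) by apply: k_uniq.
by have /(congr1 (@^~ y)) := etrans (esym hE) idE; move=> /= <-; exact: valP.
Qed.
End FreeInduction.

(** The predicate that [P] holds at y and at its inverse defines a subgroup, so it suffices to treat
    the generators and their inverses. *)
Lemma free_basis_ind (n : nat) (G : groupType) (x : 'I_n -> G) (P : G -> Prop) :
  free_basis x -> P 1%g -> (forall y z, P y -> P z -> P (y * z)%g) ->
  (forall i, P (x i)) -> (forall i, P (x i)^-1%g) -> forall y, P y.
Proof.
move=> fx P1 PM Px PVx y.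
suff /asboolP[] : `[< P y /\ P y^-1%g >] by [].
apply: (@free_basis_subgroup _ _ x (fun y => `[< P y /\ P y^-1%g >])) => //.
- by apply/asboolP; rewrite invg1.
- move=> a b /asboolP[Pa PVa] /asboolP[Pb PVb]; apply/asboolP.
  by rewrite invgM; split; exact: PM.
- by move=> a /asboolP[Pa PVa]; apply/asboolP; rewrite invgK.
- by move=> i; apply/asboolP.
Qed.

Section GeneralLinear.
Context {R : comNzRingType} {m : nat}.

(** Keeping the inverse as data gives a group over any commutative ring, in particular over
    polynomials, with inversion a swap of components. *)
Definition gl := {p : 'M[R]_m * 'M[R]_m | (p.1 *m p.2 == 1%:M) && (p.2 *m p.1 == 1%:M)}.
HB.instance Definition _ := Choice.on gl.

Lemma gl_inj (a b : gl) : (val a).1 = (val b).1 -> a = b.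
Proof.
case: a b => [[A A'] Aeq] [[B B'] Beq] /= AB; apply: val_inj; rewrite /= AB.
case/andP: (Aeq) (Beq) => /= _ /eqP A'A /andP[/= /eqP BB' _].
by rewrite -[A']mulmx1 -BB' mulmxA -AB A'A mul1mx.
Qed.

Let mul (a b : gl) : gl.
Proof.
exists ((val a).1 *m (val b).1, (val b).2 *m (val a).2).
case: a b => [[A A'] /= /andP[/eqP AA' /eqP A'A]] [[B B'] /= /andP[/eqP BB' /eqP B'B]].
apply/andP; split; apply/eqP.
  by rewrite mulmxA -(mulmxA A) BB' mulmx1.
by rewrite mulmxA -(mulmxA B') A'A mulmx1.
Defined.
Let inv (a : gl) : gl.
Proof. by exists ((val a).2, (val a).1); rewrite andbC; exact: (valP a). Defined.
Let one : gl.
Proof. by exists (1%:M, 1%:M); rewrite mulmx1 eqxx. Defined.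

Let mulA : associative mul.
Proof. by move=> a b c; apply: gl_inj; rewrite /= mulmxA. Qed.
Let mul1 : left_id one mul.
Proof. by move=> a; apply: gl_inj; rewrite /= mul1mx. Qed.
Let mulr1 : right_id one mul.
Proof. by move=> a; apply: gl_inj; rewrite /= mulmx1. Qed.
Let mulV : left_inverse one inv mul.
Proof. by move=> a; apply: gl_inj; case/andP: (valP a) => _ /eqP. Qed.
Let mulrV : right_inverse one inv mul.
Proof. by move=> a; apply: gl_inj; case/andP: (valP a) => /eqP. Qed.
HB.instance Definition _ := isGroup.Build gl mulA mul1 mulr1 mulV mulrV.
End GeneralLinear.
Arguments gl : clear implicits.

Definition mx_morphism (R : comNzRingType) (m : nat) (G : groupType) (r : G -> 'M[R]_m) :=
  r 1%g = 1%:M /\ forall y z, r (y * z)%g = r y *m r z.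

Lemma mx_morphismV (R : comNzRingType) (m : nat) (G : groupType) (r : G -> 'M[R]_m) y :
  mx_morphism r -> r y *m r y^-1%g = 1%:M.
Proof. by move=> [r1 rM]; rewrite -rM mulgV. Qed.

Lemma mx_morphism_ext (R : comNzRingType) (m n : nat) (G : groupType) (x : 'I_n -> G)
    (A A' : 'I_n -> 'M[R]_m) :
  free_basis x -> (forall i, A i *m A' i = 1%:M) -> (forall i, A' i *m A i = 1%:M) ->
  exists r : G -> 'M[R]_m, [/\ mx_morphism r, forall i, r (x i) = A i
    & forall i, r (x i)^-1%g = A' i].
Proof.
move=> fx AA' A'A.
have AP i : ((A i, A' i).1 *m (A i, A' i).2 == 1%:M)
   && ((A i, A' i).2 *m (A i, A' i).1 == 1%:M) by rewrite /= AA' A'A !eqxx.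
have [h [[hM hx] _]] := fx (gl R m) (fun i => exist _ (A i, A' i) (AP i)).
have h1 : h 1%g = 1%g by apply: (@mulgI _ (h 1%g)); rewrite -hM !mulg1.
have rmor : mx_morphism (fun y => (val (h y)).1).
  by split=> [|y z]; rewrite ?h1 // hM.
exists (fun y => (val (h y)).1); split=> // i; first by rewrite hx.
have := mx_morphismV (x i) rmor; rewrite hx /= => E.
by have := congr1 (mulmx (A' i)) E; rewrite mulmxA A'A mul1mx mulmx1.
Qed.

Lemma mx_morphism_eq (R : comNzRingType) (m n : nat) (G : groupType) (x : 'I_n -> G)
    (r r' : G -> 'M[R]_m) : free_basis x -> mx_morphism r -> mx_morphism r' ->
  (forall i, r (x i) = r' (x i)) -> r =1 r'.
Proof.
move=> fx rmor r'mor E; have [r1 rM] := rmor; have [r'1 r'M] := r'mor.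
apply: (@free_basis_ind _ _ x) => //; first by rewrite r1 r'1.
- by move=> y z Ey Ez; rewrite rM r'M Ey Ez.
- move=> i; have := mx_morphismV (x i)^-1%g rmor; have := mx_morphismV (x i) r'mor.
  rewrite invgK -E => a b.
  by rewrite -[LHS]mulmx1 -a mulmxA b mul1mx.
Qed.

(** A derivation along [r] is the same as the upper right corner of a block triangular
    representation with diagonal [r], 1. The universal property provides the latter from its values
    on the basis, and the product of blocks is the Leibniz rule. *)
Lemma fox_derivative (R : comNzRingType) (N m n : nat) (G : groupType) (x : 'I_n -> G)
    (r : G -> 'M[R]_N) (B : 'I_n -> 'M[R]_(N, m)) : free_basis x -> mx_morphism r ->
  exists d : G -> 'M[R]_(N, m),
    [/\ mx_morphism (fun y => block_mx (r y) (d y) 0 1%:M),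
        forall y z, d (y * z)%g = d y + r y *m d z
      & forall i, d (x i) = B i].
Proof.
move=> fx rmor; have [r1 rM] := rmor.
pose A i : 'M_(N + m) := block_mx (r (x i)) (B i) 0 1%:M.
pose A' i : 'M_(N + m) := block_mx (r (x i)^-1%g) (- (r (x i)^-1%g *m B i)) 0 1%:M.
have one : 1%:M = block_mx 1%:M 0 0 1%:M :> 'M[R]_(N + m) by rewrite -scalar_mx_block.
have rVr y : r y^-1%g *m r y = 1%:M by rewrite -rM mulVg.
have [] := @mx_morphism_ext _ _ _ _ _ A A' fx.
- move=> i; rewrite mulmx_block one !mulmx0 !mul0mx !mulmx1 !addr0 add0r mx_morphismV //.
  by rewrite mulmxN mulmxA mx_morphismV // mul1mx addNr.
- move=> i; rewrite mulmx_block one !mulmx0 !mul0mx !mulmx1 !addr0 add0r rVr.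
  by rewrite addrC addNr.
move=> h [hmor hx hVx]; have [h1 hM] := hmor.
have shape y : ulsubmx (h y) = r y /\ (dlsubmx (h y) = 0 /\ drsubmx (h y) = 1%:M).
  move: y; apply: (@free_basis_ind _ _ x _ fx) => [|y z|i|i].
  - by rewrite h1 one block_mxKul block_mxKdl block_mxKdr r1.
  - rewrite hM -[h y]submxK -[h z]submxK !(block_mxKul, block_mxKdl, block_mxKdr).
    move=> [-> [-> ->]] [-> [-> ->]]; rewrite mulmx_block.
    by rewrite block_mxKul block_mxKdl block_mxKdr !mulmx0 !mul0mx !addr0 add0r mulmx1 rM.
  - by rewrite hx block_mxKul block_mxKdl block_mxKdr.
  - by rewrite hVx block_mxKul block_mxKdl block_mxKdr.
have hE y : h y = block_mx (r y) (ursubmx (h y)) 0 1%:M.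
  by rewrite -{1}[h y]submxK; have [-> [-> ->]] := shape y.
exists (fun y => ursubmx (h y)); split.
- by split=> [|y z]; rewrite -?hE ?h1 // hM.
- move=> y z; rewrite hM (hE y) (hE z) mulmx_block !block_mxKur.
  by rewrite mulmx1 addrC.
- by move=> i; rewrite hx block_mxKur.
Qed.

(** * Leading terms of representations *)

Section TensorMx.
Context {K : fieldType} {n m : nat} (X : 'I_n -> 'M[K]_m).
Local Notation T k := (tensor K n k).

Definition word_mx k (I : multi n k) : 'M[K]_m := \prod_(c < k) X (I c).

Definition tens_mx k (u : T k) : 'M[K]_m := \sum_I u I *: word_mx I.

Lemma tens_mxD k (u v : T k) : tens_mx (u + v) = tens_mx u + tens_mx v.
Proof.
by rewrite /tens_mx -big_split; apply: eq_bigr => I _; rewrite ffunE scalerDl.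
Qed.

Lemma tens_mxN k (u : T k) : tens_mx (- u) = - tens_mx u.
Proof.
by rewrite /tens_mx -sumrN; apply: eq_bigr => I _; rewrite ffunE scaleNr.
Qed.

Lemma tens_mx0 k : tens_mx (0 : T k) = 0.
Proof. by rewrite /tens_mx big1 // => I _; rewrite ffunE scale0r. Qed.

Lemma word_mx_cat k l (I : multi n k) (J : multi n l) :
  word_mx (multi_cat I J) = word_mx I *m word_mx J.
Proof.
rewrite /word_mx big_split_ord /=; congr (_ * _); apply: eq_bigr => c _.
  by rewrite !ffunE (unsplitK (inl c)).
by rewrite !ffunE (unsplitK (inr c)).
Qed.

Lemma tens_mx_tens k l (u : T k) (v : T l) :
  tens_mx (tens u v) = tens_mx u *m tens_mx v.
Proof.
rewrite /tens_mx mulmx_suml.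
transitivity (\sum_(J1 : multi n k) \sum_(J2 : multi n l)
    (u J1 * v J2) *: word_mx (multi_cat J1 J2)).
  apply/matrixP=> a b; rewrite summxE.
  under eq_bigr do rewrite mxE.
  rewrite (big_multi_cat (fun J => tens u v J * word_mx J a b)) summxE.
  apply: eq_bigr => J1 _; rewrite summxE; apply: eq_bigr => J2 _.
  by rewrite !mxE !ffunE multi_catl multi_catr.
apply: eq_bigr => J1 _; rewrite mulmx_sumr; apply: eq_bigr => J2 _.
by rewrite word_mx_cat -scalemxAl -scalemxAr scalerA.
Qed.

Lemma tens_mx_cast k l (e : k = l) (u : T k) : tens_mx (tens_cast e u) = tens_mx u.
Proof.
case: l / e; congr tens_mx; apply/ffunP=> I; rewrite ffunE; congr (u _).
by apply/ffunP=> i; rewrite ffunE cast_ord_id.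
Qed.

Lemma tens_mx_lie k l (u : T k) (v : T l) :
  tens_mx (lie u v) = tens_mx u *m tens_mx v - tens_mx v *m tens_mx u.
Proof. by rewrite /lie tens_mxD tens_mxN tens_mx_cast !tens_mx_tens. Qed.

Lemma tens_mx_basis_vec i : tens_mx (basis_vec i) = X i.
Proof.
rewrite /tens_mx (bigD1 [ffun=> i]) //= big1 => [|I Ii].
  by rewrite ffunE ffunE eqxx scale1r addr0 /word_mx big_ord1 ffunE.
rewrite ffunE; case: eqP => [Ii0|_]; last by rewrite scale0r.
by case/eqP: Ii; apply/ffunP=> c; rewrite ord1 ffunE.
Qed.
End TensorMx.

Section LeadingTerm.
Context {K : fieldType} {n m : nat} {G : groupType} {x : 'I_n -> G}.
Context {X : 'I_n -> 'M[K]_m} {r : G -> 'M[{poly K}]_m}.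
Hypotheses (fx : free_basis x) (rmor : mx_morphism r).
Hypothesis rx : forall i, exists Y,
  r (x i) = 1%:M + 'X *: map_mx polyC (X i) + 'X^2 *: Y.

Let r1 : r 1%g = 1%:M. Proof. by case: rmor. Qed.
Let rM y z : r (y * z)%g = r y *m r z. Proof. by case: rmor. Qed.
Let rV y : r y^-1%g *m r y = 1%:M. Proof. by rewrite -rM mulVg. Qed.

Definition mx_cong1 k y := exists Y, r y = 1%:M + 'X^k *: Y.

Lemma mx_cong1_mul k y z : mx_cong1 k y -> mx_cong1 k z -> mx_cong1 k (y * z)%g.
Proof.
move=> [Y Ey] [Z Ez]; exists (Y + r y *m Z).
by rewrite rM Ez mulmxDr mulmx1 -scalemxAr scalerDr addrA -Ey.
Qed.

Lemma mx_cong1_inv k y : mx_cong1 k y -> mx_cong1 k y^-1%g.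
Proof.
move=> [Y Ey]; exists (- (r y^-1%g *m Y)); have := rV y.
rewrite {1}Ey mulmxDr mulmx1 -scalemxAr => /(canRL (addrK _)) {1}->.
by rewrite scalerN.
Qed.

(** A group commutator minus 1 is thus a matrix commutator up to an invertible factor, which makes
    orders of vanishing in ['X] add up and turns brackets of group elements into Lie brackets. *)
Lemma mx_morphism_commg y z :
  r [~ y, z]%g = 1%:M + r (z * y)^-1%g *m (r y *m r z - r z *m r y).
Proof.
have -> : [~ y, z]%g = ((z * y)^-1 * (y * z))%g by rewrite invgM /commg /conjg mulgA.
by rewrite mulmxBr -!rM mulVg r1 addrC subrK.
Qed.

Lemma mulmx_comm1D (R : comNzRingType) p (P Q : 'M[R]_p) :
  (1%:M + P) *m (1%:M + Q) - (1%:M + Q) *m (1%:M + P) = P *m Q - Q *m P.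
Proof.
rewrite mulmxDr mulmx1 mulmxDl mul1mx mulmxDl mul1mx mulmxDr mulmx1.
by rewrite opprD addrACA subrr add0r opprD addrACA subrr add0r.
Qed.

Lemma mx_cong1_commg k l y z :
  mx_cong1 k y -> mx_cong1 l z -> mx_cong1 (k + l) [~ y, z]%g.
Proof.
move=> [Y Ey] [Z Ez]; exists (r (z * y)^-1%g *m (Y *m Z - Z *m Y)).
rewrite mx_morphism_commg Ey Ez mulmx_comm1D -!scalemxAl -!scalemxAr !scalerA.
by rewrite (mulrC 'X^l) -exprD -scalerBr -scalemxAr.
Qed.

Lemma mx_cong1_1 y : mx_cong1 1 y.
Proof.
have gen i : mx_cong1 1 (x i).
  have [Y EY] := rx i; exists (map_mx polyC (X i) + 'X *: Y).
  by rewrite EY expr1 scalerDr scalerA -expr2 addrA.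
move: y; apply: (free_basis_ind fx) => //.
- by exists 0; rewrite r1 scaler0 addr0.
- by move=> y z; exact: mx_cong1_mul.
- by move=> i; exact: mx_cong1_inv.
Qed.

Lemma mx_cong1_generated k (A : set G) y :
  (forall z, A z -> mx_cong1 k z) -> generated A y -> mx_cong1 k y.
Proof.
move=> Ak; elim=> [z /Ak //||a b _ ka _ kb|a _ ka].
- by exists 0; rewrite r1 scaler0 addr0.
- exact: mx_cong1_mul.
- exact: mx_cong1_inv.
Qed.

Lemma mx_cong1_lower_central k y : (0 < k)%N -> lower_central k y -> mx_cong1 k y.
Proof.
elim: k y => [//|[|k] IH] y _; first by move=> _; exact: mx_cong1_1.
apply: mx_cong1_generated => z [[a b] /= [_ lb] <-].
by apply: (@mx_cong1_commg 1 k.+1); [exact: mx_cong1_1|exact: IH].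
Qed.

Lemma gr_class_gt0 p w (q : tensor K n p) : gr_class x w q -> (0 < p)%N.
Proof. by elim=> // k l y z u v _ k0 _ _; rewrite addn_gt0 k0. Qed.

(** This is the Magnus expansion with the matrices [X i] substituted for the variables. Each
    constructor of [gr_class] is matched by a computation modulo the next power of ['X]; deeper
    elements of the lower central series only contribute to the error term. *)
Lemma gr_class_leading p w (q : tensor K n p) : gr_class x w q ->
  exists Y : 'M[{poly K}]_m,
    r w = 1%:M + 'X^p *: map_mx polyC (tens_mx X q) + 'X^(p.+1) *: Y.
Proof.
elim=> [i|k l y z u v /gr_class_gt0 k0 [Y Ey] /gr_class_gt0 l0 [Z Ez]
  |k y z u v /gr_class_gt0 k0 [Y Ey] _ [Z Ez]|k y u /gr_class_gt0 k0 [Y Ey]|k y k0].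
- by have [Y ->] := rx i; exists Y; rewrite tens_mx_basis_vec expr1.
- set a := tens_mx X u in Ey; set b := tens_mx X v in Ez.
  set a' := map_mx polyC a in Ey; set b' := map_mx polyC b in Ez.
  have [S ES] := mx_cong1_1 (z * y)^-1%g.
  have Ey' : r y = 1%:M + 'X^k *: (a' + 'X *: Y).
    by rewrite Ey scalerDr scalerA -exprSr addrA.
  have Ez' : r z = 1%:M + 'X^l *: (b' + 'X *: Z).
    by rewrite Ez scalerDr scalerA -exprSr addrA.
  pose P := a' *m Z + Y *m b' + 'X *: (Y *m Z).
  pose Q := b' *m Y + Z *m a' + 'X *: (Z *m Y).
  pose D := (a' + 'X *: Y) *m (b' + 'X *: Z) - (b' + 'X *: Z) *m (a' + 'X *: Y).
  have ED : D = map_mx polyC (a *m b - b *m a) + 'X *: (P - Q).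
    have mul2 (A B A1 B1 : 'M[{poly K}]_m) : (A + 'X *: A1) *m (B + 'X *: B1) =
        A *m B + 'X *: (A *m B1 + A1 *m B + 'X *: (A1 *m B1)).
      rewrite mulmxDr !mulmxDl -!scalemxAl -!scalemxAr !scalerDr.
      by rewrite -!addrA; congr (_ + _); rewrite addrCA.
    rewrite /D !mul2 map_mxB !map_mxM /= scalerBr opprD addrACA; congr (_ + (_ - _)).
  (* [P - Q] is the error of the matrix commutator itself, and [S *m D] comes from the factor
     [r (z * y)^-1], which is 1 modulo ['X]. *)
  exists (P - Q + S *m D).
  rewrite mx_morphism_commg Ey' Ez' mulmx_comm1D -!scalemxAl -!scalemxAr !scalerA.
  rewrite (mulrC 'X^l) -exprD -scalerBr -/D -scalemxAr ES expr1 mulmxDl mul1mx.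
  rewrite tens_mx_lie -/a -/b -[in RHS]addrA; congr (_ + _).
  rewrite exprSr -scalerA -scalerDr; congr (_ *: _).
  by rewrite {1}ED -addrA (scalerDr _ (P - Q)) -scalemxAl.
- have [S ES] := mx_cong1_1 y; set b := map_mx polyC (tens_mx X v) in Ez.
  exists (Y + (S *m b + r y *m Z)).
  rewrite rM Ez !mulmxDr mulmx1 -!scalemxAr {2}ES expr1 mulmxDl mul1mx -scalemxAl.
  rewrite tens_mxD map_mxD /= -/b {1}Ey !scalerDr !scalerA -exprSr !addrA.
  by congr (_ + _ + _); rewrite addrAC.
- have [S ES] := mx_cong1_1 y^-1%g; set a := map_mx polyC (tens_mx X u) in Ey.
  exists (- (S *m a + r y^-1%g *m Y)); have := rV y.
  rewrite {1}Ey !mulmxDr mulmx1 -!scalemxAr -addrA => /(canRL (addrK _)) {1}->.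
  rewrite tens_mxN map_mxN /= -/a -addrA; congr (_ + _).
  rewrite {1}ES expr1 mulmxDl mul1mx -scalemxAl scalerDr scalerA -exprSr.
  by rewrite !scalerN !scalerDr -!opprD addrA.
- move=> y0; have [Y ->] := mx_cong1_lower_central (ltn0Sn k) y0.
  by exists Y; rewrite tens_mx0 map_mx0 scaler0 addr0.
Qed.
End LeadingTerm.

(** * The trace of the Fox Jacobian *)

(** A permutation other than the identity moves at least two indices, i and [s i], so its term
    contains two off-diagonal entries and is divisible by [e ^+ 2]. The identity contributes the
    trace. *)
Lemma det_1D_scale (R : comNzRingType) N (e : R) (M : 'M[R]_N) :
  exists q, \det (1%:M + e *: M) = 1 + e * \tr M + e ^+ 2 * q.
Proof.
pose sq (y : R) := exists q, y = e ^+ 2 * q.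
have [q1 Eq1] : exists q, \prod_i (1 + e * M i i) = 1 + e * \tr M + e ^+ 2 * q.
  rewrite /mxtrace; elim/big_rec2: _ => [|i y1 y2 _ [q ->]].
    by exists 0; rewrite !mulr0 !addr0.
  by exists (q + M i i * y1 + e * M i i * q); ring.
have [q2 Eq2] : sq (\sum_(s : 'S_N | s != 1%g)
    (-1) ^+ s * \prod_i (1%:M + e *: M) i (s i)).
  apply: big_ind => [|y1 y2 [p1 ->] [p2 ->]|s s1]; rewrite /sq.
  - by exists 0; rewrite mulr0.
  - by exists (p1 + p2); rewrite mulrDr.
  have [i si] : exists i, s i != i.
    apply/existsP; rewrite -negb_forall; apply: contra s1 => /forallP s1.
    by apply/eqP/permP => i; rewrite perm1; apply/eqP.
  have ssi : s (s i) != s i by rewrite (inj_eq perm_inj).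
  rewrite (bigD1 i) //= (bigD1 (s i)) //= !mxE eq_sym (negbTE si) eq_sym (negbTE ssi).
  set z := \big[_/_]_(_ <- _ | _) _; exists ((-1) ^+ s * M i (s i) * M (s i) (s (s i)) * z).
  rewrite !add0r -!mulrA; move: {z}(_ ^+ s) (M _ _) (M _ _) z => a b c d.
  by ring.
exists (q1 + q2); rewrite /determinant (bigD1 (1%g : 'S_N)) //= Eq2 odd_perm1 mul1r.
under eq_bigr do rewrite perm1 !mxE eqxx.
by rewrite Eq1; ring.
Qed.

(* \det J divides a power of 'X, so it is a monomial; its two lowest possible
   coefficients are 1 and \tr M. *)
Lemma trace_leading_term (K : fieldType) N s (P J Y : 'M[{poly K}]_N) (M : 'M[K]_N) :
  (0 < s)%N -> P *m J = ('X ^+ 2)%:M ->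
  J = 'X *: (1%:M + 'X^s *: map_mx polyC M + 'X^(s.+1) *: Y) -> \tr M = 0.
Proof.
move=> s0 PJ EJ.
have {}EJ : J = 'X *: (1%:M + 'X^s *: (map_mx polyC M + 'X *: Y)).
  by rewrite EJ; congr (_ *: _); rewrite [in RHS]scalerDr scalerA -exprSr addrA.
have [q Eq] := det_1D_scale 'X^s (map_mx polyC M + 'X *: Y).
set D := \det _ in Eq.
have DX : D %| ('X - 0%:P) ^+ (2 * N).
  rewrite subr0 exprM -det_scalar -PJ det_mulmx EJ detZ -/D.
  by apply: dvdp_mull; apply: dvdp_mull.
have ED : D = 1 + 'X^s * ((\tr M)%:P + 'X * (\tr Y + 'X^(s.-1) * q)).
  rewrite Eq mxtraceD mxtraceZ -(prednK s0) /= exprS.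
  have -> : \tr (map_mx polyC M) = (\tr M)%:P.
    by rewrite /mxtrace rmorph_sum; apply: eq_bigr => i _; rewrite mxE.
  by ring.
have [d _] := dvdp_exp_XsubCP DX; rewrite subr0 => /andP[Dd dD].
(* Since [s] is positive, [D] takes the value 1 at 0, whereas a positive d would make ['X] divide
   it. *)
have d0 : d = 0%N.
  case: d dD {Dd} => // d; rewrite exprS => /dvdpP[p Ep].
  have /(congr1 (horner^~ 0)) := etrans (esym ED) Ep.
  rewrite -(prednK s0) !exprS !(hornerE, mul0r, mulr0, addr0) /= !(mul0r, mulr0) => /eqP.
  by rewrite oner_eq0.
have [c Ec] : exists c, D = c%:P.
  have D1 : D %| 1 by rewrite -(expr0 'X) -d0.
  have := dvdp_leq (oner_neq0 _) D1; rewrite size_poly1 => sD.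
  by exists D`_0; exact: size1_polyC.
have := congr1 (fun p : {poly K} => p`_s) ED.
rewrite Ec coefD coefC coef1 eqn0Ngt s0 add0r coefXnM ltnn subnn.
by rewrite coefD coefC eqxx coefXM eqxx addr0.
Qed.

Lemma ursubmxDZ (R : pzRingType) m1 m2 n1 n2 (c : R) (A B : 'M[R]_(m1 + m2, n1 + n2)) :
  ursubmx (A + c *: B) = ursubmx A + c *: ursubmx B.
Proof. by apply/matrixP=> i j; rewrite !mxE. Qed.

Section FoxJacobian.
Context {K : fieldType} {n N s : nat} {G : groupType} {x : 'I_n -> G}.
Context {alpha beta : G -> G} {X : 'I_n -> 'M[K]_N} {A A' : 'I_n -> 'M[{poly K}]_N}.
Context {u : 'I_n -> tensor K n s.+1}.
Hypotheses (fx : free_basis x) (s_gt0 : (0 < s)%N).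
Hypothesis alphaM : forall y z, alpha (y * z)%g = (alpha y * alpha z)%g.
Hypothesis betaK : forall z, alpha (beta z) = z.
Hypothesis AA' : forall i, A i *m A' i = 1%:M.
Hypothesis A'A : forall i, A' i *m A i = 1%:M.
Hypothesis AX : forall i, exists Y : 'M[{poly K}]_N,
  A i = 1%:M + 'X *: map_mx polyC (X i) + 'X^2 *: Y.
Hypothesis alpha_u : forall i, gr_class x ((x i)^-1 * alpha (x i))%g (u i).

(** The dimension is written as a sum because it is the size of an [\mxcol] of n blocks. [B i] and
    [C i] are the i-th block row and block column of the identity, so a derivation with values [B i]
    on the basis records all Fox derivatives side by side. *)
Let S := (\sum_(i < n) N)%N.
Let B i : 'M[K]_(N, S) := submxcol (p_ := fun=> N) 1%:M i.
Let C i : 'M[K]_(S, N) := submxrow (q_ := fun=> N) 1%:M i.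

Let BC i j : B i *m C j = (i == j)%:R%:M.
Proof.
rewrite /B /C submxcol_mul mul1mx.
apply/matrixP=> a b; rewrite !mxE -val_eqE tagnat.eq_Rank /=.
by case: (eqVneq i j) => ij /=; rewrite ?mul0rn.
Qed.

Let map_B i : map_mx polyC (B i) = submxcol (p_ := fun=> N) 1%:M i.
Proof. by apply/matrixP=> a b; rewrite !mxE rmorph_nat. Qed.

Let X' i : 'M[K]_(N + S) := block_mx (X i) (B i) 0 0.

Lemma word_mx_block k (I : multi n k) :
  ulsubmx (word_mx X' I) = word_mx X I /\ dlsubmx (word_mx X' I) = 0.
Proof.
rewrite /word_mx; elim/big_rec2: _ => [|c M1 M2 _ [E1 E2]].
  have -> : (1 : 'M[K]_(N + S)) = block_mx 1%:M 0 0 1%:M by rewrite -scalar_mx_block.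
  by rewrite block_mxKul block_mxKdl.
have -> : X' (I c) * M2 = X' (I c) *m block_mx (ulsubmx M2) (ursubmx M2) 0 (drsubmx M2).
  by rewrite -E2 submxK.
rewrite mulmx_block block_mxKul block_mxKdl !mulmx0 !mul0mx !addr0.
by rewrite E1.
Qed.

(** The lower blocks of each [X'] vanish, so [B] can enter only through the last letter: for words
    this is Fox differentiation, which removes that letter. *)
Lemma ursubmx_word_mx k (I : multi n k.+1) :
  ursubmx (word_mx X' I) =
  word_mx X [ffun c => I (widen_ord (leqnSn k) c)] *m B (I ord_max).
Proof.
rewrite /word_mx big_ord_recr /=.
set P := \big[_/_]_(_ <- _ | _) _.
have -> : P = word_mx X' [ffun c => I (widen_ord (leqnSn k) c)].
  by apply: eq_bigr => c _; rewrite ffunE.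
have [E1 E2] := word_mx_block [ffun c : 'I_k => I (widen_ord (leqnSn k) c)].
rewrite -[word_mx X' _]submxK E1 E2.
have -> : forall M1 M2 : 'M[K]_(N + S), M1 * M2 = M1 *m M2 by [].
by rewrite mulmx_block block_mxKur mulmx0 addr0.
Qed.

(** The Jacobian [J] of [alpha] has a left inverse up to ['X ^+ 2], by the chain rule applied to
    [beta]. Its leading term beyond the identity has the Fox derivatives of the [u i] as blocks, and
    the vanishing trace keeps from [u i] the words that end with the letter i. *)
Lemma fox_jacobian_trace :
  \sum_i \sum_(I : multi n s.+1 | I ord_max == i)
    u i I * \tr (word_mx X [ffun c => I (widen_ord (leqnSn s) c)]) = 0.
Proof.
have [r [rmor rx _]] := mx_morphism_ext fx AA' A'A.
have [r1 rM] := rmor.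
have alpha1 : alpha 1%g = 1%g by apply: (@mulgI _ (alpha 1%g)); rewrite -alphaM !mulg1.
have ramor : mx_morphism (r \o alpha) by split=> [|y z] /=; rewrite ?alpha1 // alphaM rM.
(* The factor ['X] makes the block representation trivial modulo ['X], so that [gr_class_leading]
   applies to it. It accounts for the extra powers of ['X] in [JE] and [PJ]. *)
have [d [dmor dM dx]] := fox_derivative (fun i => 'X *: map_mx polyC (B i)) fx rmor.
have [e [emor eM ex]] := fox_derivative (fun i => 'X *: map_mx polyC (B i)) fx ramor.
have d1 : d 1%g = 0.
  have := dM 1%g 1%g; rewrite mulg1 r1 mul1mx => /eqP.
  by rewrite -subr_eq0 opprD addrA subrr add0r oppr_eq0 => /eqP.
have e1 : e 1%g = 0.
  have := eM 1%g 1%g; rewrite mulg1 /= alpha1 r1 mul1mx => /eqP.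
  by rewrite -subr_eq0 opprD addrA subrr add0r oppr_eq0 => /eqP.
pose J : 'M[{poly K}]_S := \mxcol_i d (alpha (x i)).
(* The chain rule: both sides are derivations along the composite of [r] and [alpha], and they agree
   on the basis because [B i *m J] is the i-th block of [J]. *)
have JE w : 'X *: d (alpha w) = e w *m J.
  have m1 : mx_morphism (fun w => block_mx (r (alpha w)) ('X *: d (alpha w)) 0 1%:M
      : 'M_(N + S)).
    split=> [|y z]; first by rewrite alpha1 r1 d1 scaler0 -scalar_mx_block.
    rewrite mulmx_block !mulmx0 !mul0mx !addr0 !mulmx1 add0r -rM -alphaM.
    by rewrite [in LHS]alphaM dM scalerDr scalemxAr [in RHS]addrC -[in LHS]alphaM.
  have m2 : mx_morphism (fun w => block_mx (r (alpha w)) (e w *m J) 0 1%:M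
      : 'M_(N + S)).
    split=> [|y z]; first by rewrite alpha1 r1 e1 mul0mx -scalar_mx_block.
    rewrite mulmx_block !mulmx0 !mul0mx !addr0 !mulmx1 add0r -rM -alphaM.
    by rewrite [in LHS]eM mulmxDl mulmxA [in RHS]addrC.
  have gens i : block_mx (r (alpha (x i))) ('X *: d (alpha (x i))) 0 1%:M =
      block_mx (r (alpha (x i))) (e (x i) *m J) 0 1%:M :> 'M_(N + S).
    congr block_mx; rewrite ex -scalemxAl; congr (_ *: _).
    rewrite map_B submxcol_mul mul1mx.
    by rewrite /J mxcolK.
  by have /eq_block_mx[_ -> _ _] := mx_morphism_eq fx m1 m2 gens w.
have PJ : (\mxcol_i e (beta (x i))) *m J = ('X ^+ 2)%:M.
  rewrite mxcol_mul; under eq_mxcol => i do rewrite -JE betaK dx scalerA -expr2 map_B.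
  rewrite -[RHS]submxcolK; apply/eq_mxcol => i; rewrite -[in RHS]scalemx1.
  by apply/matrixP=> a b; rewrite !mxE.
pose m i := ursubmx (tens_mx X' (u i)).
(* Write [alpha (x i)] as [x i] times an element with leading term [u i] and apply the Leibniz rule.
   The factor [r (x i)] is 1 modulo ['X] and only alters the error term. *)
have dE i : exists Y : 'M[{poly K}]_(N, S), d (alpha (x i)) =
    'X *: (map_mx polyC (B i) + 'X^s *: map_mx polyC (m i) + 'X^(s.+1) *: Y).
  have lead j : exists Y : 'M[{poly K}]_(N + S),
      block_mx (r (x j)) (d (x j)) 0 1%:M = 1%:M + 'X *: map_mx polyC (X' j) + 'X^2 *: Y.
    have [Y AE] := AX j; exists (block_mx Y 0 0 0).
    rewrite rx AE dx map_block_mx !map_mx0 scalar_mx_block !scale_block_mx !scaler0.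
    by rewrite !add_block_mx !addr0 add0r.
  have [Y0] := gr_class_leading fx dmor lead (alpha_u i).
  move/(congr1 ursubmx); rewrite block_mxKur !ursubmxDZ -map_ursubmx.
  rewrite scalar_mx_block block_mxKur add0r -/(m i) => dy.
  have [Z AE] : exists Z, A i = 1%:M + 'X *: Z.
    have [Y ->] := AX i; exists (map_mx polyC (X i) + 'X *: Y).
    by rewrite scalerDr scalerA -expr2 addrA.
  exists (ursubmx Y0 + Z *m (map_mx polyC (m i) + 'X *: ursubmx Y0)).
  have -> : alpha (x i) = (x i * ((x i)^-1 * alpha (x i)))%g by rewrite mulgA mulgV mul1g.
  rewrite dM dx rx dy -addrA [in RHS]scalerDr; congr (_ + _).
  have shift k (a b : 'M[{poly K}]_(N, S)) :
      'X^k *: a + 'X^(k.+1) *: b = 'X^k *: (a + 'X *: b).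
    by rewrite scalerDr scalerA -exprSr.
  rewrite !shift exprS -scalerA -!scalemxAr; congr (_ *: (_ *: _)).
  by rewrite AE mulmxDl mul1mx -addrA scalerDr -scalemxAl.
have [Y_ {}dE] := fin_all_exists dE.
have JY : J = 'X *: (1%:M + 'X^s *: map_mx polyC (\mxcol_i m i) + 'X^(s.+1) *: \mxcol_i Y_ i).
  rewrite -[RHS]submxcolK; apply/eq_mxcol => i; rewrite dE map_B.
  rewrite -{1}(mxcolK m i) -{1}(mxcolK Y_ i).
  by apply/matrixP=> a b; rewrite !mxE.
have trM := trace_leading_term s_gt0 PJ JY.
have {}trM : \sum_i \tr (m i *m C i) = 0.
  rewrite -{}[RHS]trM -[\mxcol_i m i in RHS]mul1mx -[1%:M in RHS]submxrowK mul_mxrow_mxcol.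
  by rewrite linear_sum /=; apply: eq_bigr => i _; rewrite mxtrace_mulC.
rewrite -[RHS]trM; apply: eq_bigr => i _.
have -> : m i = \sum_I u i I *: ursubmx (word_mx X' I).
  by apply/matrixP=> a b; rewrite !mxE !summxE; apply: eq_bigr => I _; rewrite !mxE.
rewrite mulmx_suml linear_sum /= big_mkcond /=.
apply: eq_bigr => I _; rewrite -scalemxAl ursubmx_word_mx -mulmxA BC.
by case: eqP => _; rewrite ?mulmx1 mxtraceZ // raddf0 mulmx0 mxtrace0 mulr0.
Qed.
End FoxJacobian.

(** * Cyclic words *)

(** Each [1 + 'X E_(a, b)] with a != b has inverse [1 - 'X E_(a, b)], and first order terms add in
    products. Hence every sum of off-diagonal elementary matrices is the first order term of a
    matrix invertible over the polynomials. *)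
Lemma transvection_prod (K : fieldType) N (l : seq ('I_N * 'I_N)) :
  all (fun p => p.1 != p.2) l ->
  exists A A' Y : 'M[{poly K}]_N, [/\ A *m A' = 1%:M, A' *m A = 1%:M
    & A = 1%:M + 'X *: map_mx polyC (\sum_(p <- l) delta_mx p.1 p.2) + 'X^2 *: Y].
Proof.
elim: l => [_|[a b] l IH /= /andP[ab /IH[A [A' [Y [AA' A'A AE]]]]]].
  exists 1%:M, 1%:M, 0; rewrite mulmx1; split=> //.
  by rewrite big_nil map_mx0 !scaler0 !addr0.
set E : 'M[{poly K}]_N := 'X *: delta_mx a b.
have EE : E *m E = 0.
  by rewrite -scalemxAl -scalemxAr mul_delta_mx_0 ?scaler0 // eq_sym.
have E1 : (1%:M + E) *m (1%:M - E) = 1%:M.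
  by rewrite mulmxBr mulmx1 mulmxDl mul1mx EE addr0 addrK.
have E2 : (1%:M - E) *m (1%:M + E) = 1%:M.
  by rewrite mulmxBl mul1mx mulmxDr mulmx1 EE addr0 addrK.
set D := map_mx polyC (\sum_(p <- l) delta_mx p.1 p.2) in AE.
exists ((1%:M + E) *m A), (A' *m (1%:M - E)), (Y + delta_mx a b *m (D + 'X *: Y)); split.
- by rewrite mulmxA -(mulmxA _ A) AA' mulmx1.
- by rewrite mulmxA -(mulmxA A') E2 mulmx1.
rewrite big_cons map_mxD /= -/D map_delta_mx mulmxDl mul1mx /E -scalemxAl {2}AE.
rewrite -addrA mulmxDr mulmx1 [in RHS]scalerDr [in RHS]scalerDr AE.
have -> : 'X *: D + 'X^2 *: Y = 'X *: (D + 'X *: Y).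
  by rewrite scalerDr scalerA -expr2.
rewrite -scalemxAr scalerDr scalerA -expr2 -!addrA; congr (_ + _).
rewrite (addrCA (_ *: Y)) [LHS]addrCA; reflexivity.
Qed.

Lemma iter_ordS_val s k (a : 'I_s) : iter k (@ordS s) a = ((a + k) %% s)%N :> nat.
Proof.
elim: k => [|k IH] /=; first by rewrite addn0 modn_small.
by rewrite IH -addn1 modnDml addn1 addnS.
Qed.

Lemma iter_ord_pred_val s k (a : 'I_s) :
  iter k (@ord_pred s) a = ((a + k * s.-1) %% s)%N :> nat.
Proof.
elim: k => [|k IH] /=; first by rewrite addn0 modn_small.
have s0 : (0 < s)%N by case: s a {IH} => // -[].
have -> b : ((b + s).-1 = b + s.-1)%N by rewrite -(prednK s0) addnS.
by rewrite IH modnDml mulSn -addnA (addnC _ s.-1).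
Qed.

Section CyclicWord.
Context {K : fieldType} {n s : nat} (I : multi n s).

(* Along a word J of length s, the product of these matrices has as trace the
   number of rotations of I that are equal to J. *)
Definition cyclic_mx (i : 'I_n) : 'M[K]_s := \sum_(c | I c == i) delta_mx c (ordS c).

Lemma cyclic_mxE i a b : cyclic_mx i a b = ((I a == i) && (b == ordS a))%:R.
Proof.
rewrite summxE; case: eqP => [Ia|/eqP Ia] /=.
  rewrite (bigD1 a) ?Ia //= big1 => [|c /andP[_ ca]]; rewrite mxE ?eqxx ?addr0 //.
  by rewrite eq_sym (negbTE ca).
rewrite big1 // => c Ic; rewrite mxE; case: eqP => [ac|//].
by rewrite ac Ic in Ia.
Qed.

(** From row a a letter allows only the step to [ordS a], and only if it equals [I a]. The product
    thus follows a single walk around the cycle, which survives when [J] spells the letters of [I]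
    read from a. *)
Lemma word_cyclic_mx k (J : multi n k) a b : word_mx cyclic_mx J a b =
  ((b == iter k (@ordS s) a) && [forall c : 'I_k, I (iter c (@ordS s) a) == J c])%:R.
Proof.
rewrite /word_mx.
elim: k J b => [|k IH] J b.
  rewrite big_ord0 mxE eq_sym; have -> : [forall c : 'I_0, I (iter c (@ordS s) a) == J c] = true.
    by apply/forallP => -[].
  by rewrite andbT.
rewrite big_ord_recr /= mxE.
pose J' : multi n k := [ffun c => J (widen_ord (leqnSn k) c)].
have -> : \prod_(i < k) cyclic_mx (J (widen_ord (leqnSn k) i)) = \prod_(i < k) cyclic_mx (J' i).
  by apply: eq_bigr => d _; rewrite ffunE.
rewrite (bigD1 (iter k (@ordS s) a)) //= [X in _ + X]big1 => [|c ca]; last first.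
  by rewrite IH (negbTE ca) mul0r.
rewrite addr0 IH eqxx cyclic_mxE /= -natrM mulnb andbA andbC; congr (_ && _)%:R.
apply/andP/forallP => [[/forallP h1 h2] c|h].
  case: (unliftP ord_max c) => [d ->|-> //].
  have := h1 d; rewrite ffunE lift_max.
  by congr (_ == J _); apply: val_inj; rewrite /= /bump leqNgt ltn_ord.
split; last exact: (h ord_max).
by apply/forallP => c; rewrite ffunE; exact: (h (widen_ord (leqnSn k) c)).
Qed.

Lemma trace_word_cyclic_mx (u : tensor K n s) :
  \sum_J u J * \tr (word_mx cyclic_mx J) =
  (\sum_(j < s) iter j (@tens_rot K n s) u) I.
Proof.
have rotE j (J : multi n s) : iter j (@tens_rot K n s) u J =
    u [ffun c => J (iter j (@ord_pred s) c)].
  elim: j J => [|j IH] J /=; first by congr (u _); apply/ffunP=> c; rewrite ffunE.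
  rewrite ffunE IH; congr (u _); apply/ffunP=> c.
  by rewrite !ffunE.
transitivity (\sum_a u [ffun c : 'I_s => I (iter c (@ordS s) a)]).
  rewrite /mxtrace; under eq_bigr do rewrite mulr_sumr.
  rewrite exchange_big /=; apply: eq_bigr => a _.
  have itS : iter s (@ordS s) a = a.
    by apply: val_inj; rewrite /= iter_ordS_val modnDr modn_small.
  rewrite (bigD1 [ffun c : 'I_s => I (iter c (@ordS s) a)]) //= big1 => [|J Ja].
    rewrite addr0 word_cyclic_mx itS eqxx /=.
    by case: forallP => [_|[]]; rewrite ?mulr1 // => c; rewrite ffunE.
  rewrite word_cyclic_mx itS eqxx /=; case: forallP => [h|_]; last by rewrite mulr0.
  by case/eqP: Ja; apply/ffunP=> c; rewrite ffunE; apply/esym/eqP.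
rewrite sum_ffunE; case: s I u rotE => [|m] J v rotE; first by rewrite !big_ord0.
(* [tens_rot] shifts positions by [ord_pred], so reading [I] from position a corresponds to rotating
   -a times. The index 0 is separated below because the identity between natural numbers needs a
   positive index. *)
rewrite (reindex_inj (@oppr_inj 'I_m.+1)) /=; apply: eq_bigr => j _.
rewrite rotE; congr (v _); apply/ffunP=> c; rewrite !ffunE; congr (J _).
apply: val_inj; rewrite /= iter_ordS_val iter_ord_pred_val /= modnDml addnC.
case: j => -[|j] /= jm; first by rewrite subn0 mul0n addn0 modnDr.
have -> : (j.+1 * m = j * m.+1 + (m.+1 - j.+1))%N by lia.
by rewrite addnCA modnMDl.
Qed.
End CyclicWord.

(** * Vanishing on the Johnson image *)

Section MappingClassAction.
Import numFieldNormedType.Exports.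
Context {R : realType} {S : topologicalType} {B : set S} {x0 : S} (Bx0 : B x0).
Local Notation Mod := (mapping_class R B).
Local Notation act phi := (mapping_class_pi1 Bx0 phi).

Lemma mapping_class_pi1M (phi : Mod) y z :
  act phi (y * z)%g = (act phi y * act phi z)%g.
Proof.
elim/quotW: phi => f; elim/quotW: y => a; elim/quotW: z => b.
have mulE (c d : loop R x0) : (\pi_(pi1 R x0) c * \pi_(pi1 R x0) d)%g =
    \pi_(pi1 R x0) (loopM c d) by exact: pi1_mulE.
rewrite mulE !mapping_class_pi1E mulE; apply/pi1P.
(* The two loops agree pointwise without being the same record; reparametrizing by the identity
   makes them homotopic. *)
apply: (@homotopic_reparam _ _ _ _ _ id) => // [|t /=]; first exact: cont_id.
by case: ifP.
Qed.

Definition bhomeoV (f : bhomeo B) : bhomeo B.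
Proof.
exists (bhomeo_inv f) f.
- exact: bhomeo_inv_continuous.
- exact: bhomeo_continuous.
- exact: bhomeo_invK.
- exact: bhomeoK.
- by move=> y By; rewrite -{1}(bhomeo_fix f By) bhomeoK.
Defined.

Lemma mapping_class_pi1_inv (phi : Mod) :
  exists psi : Mod, forall y, act phi (act psi y) = y.
Proof.
elim/quotW: phi => f; exists (\pi_Mod (bhomeoV f)); elim/quotW => a.
rewrite (mapping_class_pi1E _ (bhomeoV f) a) mapping_class_pi1E; apply/pi1P.
apply: (@homotopic_reparam _ _ _ _ _ id) => // [|t /=]; first exact: cont_id.
by rewrite bhomeo_invK.
Qed.
End MappingClassAction.

Section ContractionTrace.
Context {K : fieldType} {g : nat}.
Local Notation n := (g + g)%N.
Local Notation T k := (tensor K n k).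

(** The second argument numbers the factors that remain once the first is removed, so [ord_max]
    designates the last factor. *)
Definition outer_contraction s : T s.+2 -> T s :=
  @tens_contraction K g s ord0 ord_max.

HB.instance Definition _ s := GRing.isLinear.Build K (T s.+2) (T s) _
  (@outer_contraction s) (@tens_contraction_is_linear K g s ord0 ord_max).

Definition multi_rcons k (I : multi n k) (i : 'I_n) : multi n k.+1 :=
  [ffun c => if unlift ord_max c is Some c' then I c' else i].

Lemma outer_contractionE s (t : T s.+2) I : outer_contraction t I =
  \sum_i \sum_j omega K g i j * t (multi_cons i (multi_rcons I j)).
Proof.
rewrite ffunE; apply: eq_bigr => i _; apply: eq_bigr => j _; congr (_ * t _).
by apply/ffunP=> c; rewrite !ffunE; case: unliftP => // c' _; rewrite ffunE.
Qed.

Lemma multi_rcons_max k (I : multi n k) i : multi_rcons I i ord_max = i.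
Proof. by rewrite ffunE unlift_none. Qed.

Lemma multi_rcons_widen k (I : multi n k) i :
  [ffun c => multi_rcons I i (widen_ord (leqnSn k) c)] = I.
Proof.
apply/ffunP=> c; rewrite !ffunE.
have -> : widen_ord (leqnSn k) c = lift ord_max c.
  by apply: val_inj; rewrite /= /bump leqNgt ltn_ord.
by rewrite liftK.
Qed.

Lemma big_multi_rcons k i (F : multi n k.+1 -> K) :
  \sum_(I : multi n k.+1 | I ord_max == i) F I = \sum_I F (multi_rcons I i).
Proof.
rewrite (reindex (fun I : multi n k => multi_rcons I i)) /=.
  by apply: eq_bigl => I; rewrite multi_rcons_max eqxx.
exists (fun I : multi n k.+1 => [ffun c => I (widen_ord (leqnSn k) c)]).
  by move=> I _; exact: multi_rcons_widen.
move=> I /eqP <-; apply/ffunP=> c; rewrite !ffunE.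
case: unliftP => [c' ->|-> //]; rewrite ffunE; congr (I _).
by apply: val_inj; rewrite /= /bump leqNgt ltn_ord.
Qed.

Lemma omega_anti i j : omega K g i j = - omega K g j i.
Proof.
have : (omega K g)^T = - omega K g.
  rewrite /omega tr_block_mx !trmx0 trmx1 linearN /= trmx1 opp_block_mx.
  by rewrite !oppr0 opprK.
by move/matrixP/(_ j i); rewrite !mxE.
Qed.

Lemma eval_tensor_basis m (t : T m.+1) i I :
  eval_tensor t (basis_vec i) I = \sum_j omega K g i j * t (multi_cons j I).
Proof.
rewrite /eval_tensor sum_ffunE (bigD1 i) //= [X in _ + X]big1 => [|k ki].
  rewrite addr0 sum_ffunE; apply: eq_bigr => j _.
  by rewrite !ffunE eqxx mul1r.
rewrite sum_ffunE big1 // => j _.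
by rewrite !ffunE (negbTE ki) mul0r scale0r.
Qed.
End ContractionTrace.

(** The Fox trace is taken for the matrices [cyclic_mx I], one word [I] at a time. Keeping in the
    image of [x i] the words ending with i amounts to contracting the first and last factors of [t],
    and the trace of the remaining word sums over its rotations. *)
Lemma outer_contraction_johnson (K : fieldType) (R : realType) g (S : bounded_surface R g)
    s (phi : mapping_class R (surface_boundary R S))
    (t : subvs_of (johnson_target K g s)) : (1 < s)%N -> johnson_hom phi t ->
  \sum_(j < s) iter j (@tens_rot K (g + g) s) (outer_contraction (vsval t)) = 0.
Proof.
move=> s1 ht; apply/ffunP=> I; rewrite -trace_word_cyclic_mx [RHS]ffunE.
set act := mapping_class_pi1 (surface_pt_boundary S) phi.
have [psi psiK] := mapping_class_pi1_inv (surface_pt_boundary S) phi.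
have gen i : exists p : 'M[{poly K}]_s * 'M[{poly K}]_s, [/\ p.1 *m p.2 = 1%:M,
    p.2 *m p.1 = 1%:M & exists Y : 'M[{poly K}]_s,
    p.1 = 1%:M + 'X *: map_mx polyC (cyclic_mx I i) + 'X^2 *: Y].
  pose l := [seq (c, ordS c) | c <- enum 'I_s & I c == i].
  (* As [1 < s], [ordS] has no fixed point, so all the elementary matrices are off-diagonal. *)
  have ll : all (fun p => p.1 != p.2) l.
    rewrite /l all_map; apply/allP => c _ /=; rewrite -val_eqE /= neq_ltn.
    have := ltn_ord c; rewrite leq_eqVlt => /orP[/eqP E|cs].
      by rewrite E modnn; apply/orP; right; move: E s1; case: (val c) => // <-.
    by rewrite modn_small // leqnn.
  have [A [A' [Y [AA' A'A AE]]]] := transvection_prod K ll.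
  exists (A, A'); split=> //; exists Y; rewrite /= AE /cyclic_mx /l big_map.
  by rewrite big_filter big_enum_cond.
have [p hp] := fin_all_exists gen.
have h1 i : (p i).1 *m (p i).2 = 1%:M by case: (hp i).
have h2 i : (p i).2 *m (p i).1 = 1%:M by case: (hp i).
have h3 i : exists Y : 'M[{poly K}]_s,
    (p i).1 = 1%:M + 'X *: map_mx polyC (cyclic_mx I i) + 'X^2 *: Y by case: (hp i).
have h4 i := ht _ _ (gr_class_gen _ K i).
have := fox_jacobian_trace (surface_gen_free S) (ltnW s1) (mapping_class_pi1M _ phi)
  psiK h1 h2 h3 h4.
under eq_bigr do rewrite big_multi_rcons.
(* [eval_tensor] pairs the last letter with the first one, [outer_contraction] the first with the
   last: the two sums are opposite. *)
rewrite exchange_big /= => /eqP; rewrite -oppr_eq0 => /eqP E; rewrite -[RHS]E -sumrN.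
apply: eq_bigr => J _; rewrite -sumrN outer_contractionE.
under [RHS]eq_bigr do rewrite eval_tensor_basis multi_rcons_widen -mulNr -sumrN.
rewrite -mulr_suml exchange_big /=; congr (_ * _).
by apply: eq_bigr => i _; apply: eq_bigr => j _; rewrite omega_anti mulNr.
Qed.

(** * Caterpillar trees *)

(* Tensors of all degrees are evaluated on infinite words, so that the
   associativity casts between tensor degrees disappear. *)
Section WordEvaluation.
Context {K : fieldType} {n : nat}.
Local Notation T k := (tensor K n k).
Implicit Type w : nat -> 'I_n.

Definition tens_eval k (u : T k) w : K := u [ffun i : 'I_k => w i].

Definition word_drop k w : nat -> 'I_n := fun i => w (k + i)%N.

Definition word_set k (j : 'I_n) w : nat -> 'I_n := fun i => if i == k then j else w i.

Lemma tens_eval_inj m (u v : T m.+1) : tens_eval u =1 tens_eval v -> u = v.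
Proof.
move=> uv; apply/ffunP=> I; have := uv (fun i => I (inord i)); rewrite /tens_eval.
by have -> : [ffun i : 'I_m.+1 => I (inord i)] = I by apply/ffunP=> i; rewrite ffunE inord_val.
Qed.

Lemma tens_cast_id k (e : k = k) (u : T k) : tens_cast e u = u.
Proof.
apply/ffunP=> I; rewrite ffunE; congr (u _); apply/ffunP=> i.
by rewrite ffunE cast_ord_id.
Qed.

Lemma tens_evalD k (u v : T k) w : tens_eval (u + v) w = tens_eval u w + tens_eval v w.
Proof. by rewrite /tens_eval ffunE. Qed.

Lemma tens_evalN k (u : T k) w : tens_eval (- u) w = - tens_eval u w.
Proof. by rewrite /tens_eval ffunE. Qed.

Lemma tens_eval0 k w : tens_eval (0 : T k) w = 0.
Proof. by rewrite /tens_eval ffunE. Qed.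

Lemma tens_eval_cast k l (e : k = l) (u : T k) w : tens_eval (tens_cast e u) w = tens_eval u w.
Proof. by rewrite /tens_eval ffunE; congr (u _); apply/ffunP=> i; rewrite !ffunE. Qed.

Lemma tens_eval_tens k l (u : T k) (v : T l) w :
  tens_eval (tens u v) w = tens_eval u w * tens_eval v (word_drop k w).
Proof.
by rewrite /tens_eval ffunE; congr (u _ * v _); apply/ffunP=> i; rewrite !ffunE.
Qed.

Lemma tens_eval_lie k l (u : T k) (v : T l) w :
  tens_eval (lie u v) w = tens_eval u w * tens_eval v (word_drop k w)
    - tens_eval v w * tens_eval u (word_drop l w).
Proof. by rewrite /lie tens_evalD tens_evalN tens_eval_cast !tens_eval_tens. Qed.

Lemma word_drop_drop k l w : word_drop k (word_drop l w) = word_drop (l + k) w.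
Proof. by apply/funext => i; rewrite /word_drop addnA. Qed.

Lemma word_drop_set k l j w :
  word_drop k (word_set (k + l) j w) = word_set l j (word_drop k w).
Proof. by apply/funext => i; rewrite /word_drop /word_set eqn_add2l. Qed.

Lemma tens_eval_set k (u : T k) l j w : (k <= l)%N ->
  tens_eval u (word_set l j w) = tens_eval u w.
Proof.
move=> kl; rewrite /tens_eval; congr (u _); apply/ffunP=> i; rewrite !ffunE /word_set.
by rewrite ltn_eqF // (leq_trans (ltn_ord i)).
Qed.

Lemma lie_jacobi k l p (u : T k.+1) (v : T l) (x : T p) w :
  tens_eval (lie (lie u v) x) w =
  tens_eval (lie u (lie v x)) w - tens_eval (lie v (lie u x)) w.
Proof.
rewrite !tens_eval_lie !word_drop_drop.
rewrite (addnC l k.+1) (addnC p k.+1) (addnC p l).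
by ring.
Qed.

Lemma free_lie1 (u : T 1) : u \in free_lie 1.
Proof. by apply: mem_vspan; exact: lie_monomial1. Qed.

Lemma free_lie_cast k l (e : k = l) (u : T k) : u \in free_lie k -> tens_cast e u \in free_lie l.
Proof. by case: l / e; rewrite tens_cast_id. Qed.

Lemma lieC k l (u : T k) (v : T l) : lie v u = - tens_cast (addnC k l) (lie u v).
Proof.
apply/ffunP=> I; rewrite !ffunE opprB; congr (_ * _ - _ * _).
all: by (congr (u _) || congr (v _)); apply/ffunP=> i; rewrite !ffunE; congr (I _);
  apply: val_inj.
Qed.

(** Linearity of [lie] in its second argument extends the closure from monomials to their span on
    that side; antisymmetry then gives the other side. *)
Lemma free_lie_lie k l (u : T k) (v : T l) :
  u \in free_lie k -> v \in free_lie l -> lie u v \in free_lie (k + l).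
Proof.
have step (a : T k) (b : T l) : lie_monomial a -> b \in free_lie l ->
    lie a b \in free_lie (k + l).
  move=> La; suff: (free_lie l <= linfun (@lie K n k l a) @^-1: free_lie (k + l))%VS.
    by move=> /subvP sub /sub; rewrite -memv_preim lfunE.
  apply/vspan_subvP => c Lc; rewrite -memv_preim lfunE /=; apply: mem_vspan.
  exact: lie_monomial_lie.
move=> Lu Lv; rewrite lieC rpredN; apply: free_lie_cast.
suff: (free_lie k <= linfun (@lie K n l k v) @^-1: free_lie (l + k))%VS.
  by move=> /subvP /(_ _ Lu); rewrite -memv_preim lfunE.
apply/vspan_subvP => c Lc; rewrite -memv_preim lfunE /= lieC rpredN.
by apply: free_lie_cast; exact: step.
Qed.

Fixpoint ad_chain (vs : seq (T 1)) (a : T 1) : T (size vs).+1 :=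
  match vs return T (size vs).+1 with
  | [::] => a
  | v :: vs' => lie v (ad_chain vs' a)
  end.

Fixpoint seq_pure (vs : seq (T 1)) w : K :=
  if vs is v :: vs' then tens_eval v w * seq_pure vs' (word_drop 1 w) else 1.

Lemma seq_pure_rcons vs v w :
  seq_pure (rcons vs v) w = seq_pure vs w * tens_eval v (word_drop (size vs) w).
Proof.
elim: vs w => [|v0 vs IH] w /=; first by rewrite mulr1 mul1r.
by rewrite IH mulrA word_drop_drop.
Qed.

Lemma ad_chain_free_lie vs a : ad_chain vs a \in free_lie (size vs).+1.
Proof.
elim: vs => [|v vs IH]; first exact: free_lie1.
exact: (free_lie_lie (free_lie1 v) IH).
Qed.
End WordEvaluation.

Section Caterpillar.
Context {K : fieldType} {g : nat}.
Local Notation n := (g + g)%N.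
Local Notation T k := (tensor K n k).
Implicit Type w : nat -> 'I_n.

Definition omega_pair (h : T 1) (j : 'I_n) : K := \sum_i omega K g i j * h [ffun=> i].

Definition omega_form (h v : T 1) : K := \sum_j omega_pair h j * v [ffun=> j].

Definition end_contraction m (h : T 1) (z : T m.+1) : T m :=
  [ffun I => \sum_j omega_pair h j * z (multi_rcons I j)].

Lemma omega_form_anti h v : omega_form h v = - omega_form v h.
Proof.
rewrite /omega_form /omega_pair -sumrN.
under eq_bigr do rewrite mulr_suml.
rewrite exchange_big /=; apply: eq_bigr => i _.
rewrite mulr_suml -sumrN; apply: eq_bigr => j _.
by rewrite omega_anti; ring.
Qed.

Lemma tens_eval_end_contraction m h (z : T m.+1) w :
  tens_eval (end_contraction h z) w = \sum_j omega_pair h j * tens_eval z (word_set m j w).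
Proof.
rewrite /tens_eval ffunE; apply: eq_bigr => j _; congr (_ * z _); apply/ffunP=> c.
rewrite !ffunE /word_set; case: unliftP => [c' ->|->]; last by rewrite eqxx.
have -> : lift ord_max c' = c' :> nat by rewrite /= /bump leqNgt ltn_ord.
by rewrite ffunE ltn_eqF.
Qed.

Lemma outer_contraction_tens s (h : T 1) (z : T s.+1) :
  outer_contraction (tens h z : T s.+2) = end_contraction h z.
Proof.
apply/ffunP=> I; rewrite outer_contractionE ffunE exchange_big /=.
apply: eq_bigr => j _; rewrite mulr_suml; apply: eq_bigr => i _.
rewrite ffunE mulrA; congr (_ * h _ * z _); apply/ffunP=> c; rewrite !ffunE.
  by rewrite (_ : lshift s.+1 c = ord0) ?unlift_none // ord1; exact: val_inj.
by rewrite (_ : rshift 1 c = lift ord0 c) ?liftK ?ffunE //; exact: val_inj.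
Qed.

(** The last factor of u (x) v belongs to v and that of v (x) u belongs to u, so the contraction
    falls on v in the first term and on u in the second. *)
Lemma tens_eval_contract_lie k l m (h : T 1) (u : T k.+1) (v : T l.+1)
    (e : (k.+1 + l.+1)%N = m.+1) w :
  tens_eval (end_contraction h (tens_cast e (lie u v))) w =
  tens_eval u w * tens_eval (end_contraction h v) (word_drop k.+1 w)
  - tens_eval v w * tens_eval (end_contraction h u) (word_drop l.+1 w).
Proof.
rewrite !tens_eval_end_contraction !mulr_sumr -sumrB; apply: eq_bigr => j _.
have e1 : m = (k.+1 + l)%N by case: e; rewrite addnS => <-.
have e2 : m = (l.+1 + k)%N by rewrite e1 !addSn addnC.
rewrite tens_eval_cast tens_eval_lie.
rewrite (tens_eval_set u) ?e1 ?leq_addr // word_drop_set -e1.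
rewrite (@tens_eval_set _ _ _ v m) ?e2 ?leq_addr // word_drop_set.
by ring.
Qed.

Lemma end_contraction_lie0 k l m (h : T 1) (u : T k.+1) (v : T l.+1)
    (e : (k.+1 + l.+1)%N = m.+1) :
  end_contraction h u = 0 -> end_contraction h v = 0 ->
  end_contraction h (tens_cast e (lie u v)) = 0.
Proof.
case: m e => [|m] e u0 v0; first by exfalso; lia.
apply: tens_eval_inj => w.
by rewrite tens_eval_contract_lie u0 v0 !tens_eval0 !mulr0 subrr.
Qed.
Lemma end_contraction1 (h v : T 1) : end_contraction h v = [ffun=> omega_form h v].
Proof.
apply/ffunP=> I; rewrite !ffunE; apply: eq_bigr => j _; congr (_ * v _).
by apply/ffunP=> c; rewrite !ffunE (_ : c = ord_max) ?unlift_none // ord1; exact: val_inj.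
Qed.

Lemma tens_eval_contract1 (h v : T 1) w : tens_eval (end_contraction h v) w = omega_form h v.
Proof. by rewrite end_contraction1 /tens_eval ffunE. Qed.

Lemma tens_eval_contract_ad m (h v : T 1) (z : T m.+1) w :
  tens_eval (end_contraction h (lie v z : T m.+2)) w =
  tens_eval v w * tens_eval (end_contraction h z) (word_drop 1 w)
  - omega_form h v * tens_eval z w.
Proof.
rewrite -(tens_cast_id (erefl (1 + m.+1)%N) (lie v z)).
by rewrite tens_eval_contract_lie tens_eval_contract1 (mulrC (tens_eval z w)).
Qed.

Lemma end_contraction_ad_chain (h : T 1) vs a :
  (forall v, v \in vs -> omega_form h v = 0) -> omega_form h a = 0 ->
  end_contraction h (ad_chain vs a) = 0.
Proof.
move=> hv ha; elim: vs hv => [|v vs IH] hv /=.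
  by rewrite end_contraction1 ha; apply/ffunP=> I; rewrite !ffunE.
apply: tens_eval_inj => w.
rewrite tens_eval_contract_ad IH => [|u uv]; last by apply: hv; rewrite inE uv orbT.
by rewrite hv ?mem_head // mul0r subr0 /tens_eval !ffunE mulr0.
Qed.

(** When the chain is expanded, the only word whose last letter can pair nontrivially with [b] is
    v_1 ... v_k a. *)
Lemma tens_eval_contract_ad_chain (b a : T 1) vs w :
  (forall v, v \in vs -> omega_form b v = 0) ->
  tens_eval (end_contraction b (ad_chain vs a)) w = seq_pure vs w * omega_form b a.
Proof.
elim: vs w => [|v vs IH] w hv /=; first by rewrite mul1r tens_eval_contract1.
rewrite tens_eval_contract_ad hv ?mem_head // mul0r subr0 IH ?mulrA //.
by move=> u uv; apply: hv; rewrite inE uv orbT.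
Qed.

Lemma end_contractionN m (h : T 1) (z : T m.+1) : end_contraction h (- z) = - end_contraction h z.
Proof.
by apply/ffunP=> I; rewrite !ffunE -sumrN; apply: eq_bigr => j _; rewrite ffunE mulrN.
Qed.

(* The recursion sums over the leaves of the tree obtained by joining the roots
   of [v_1, [v_2, ..., [v_k, a]]] and of y, leaf v_1 first. *)
Lemma leaf_sum (vs : seq (T 1)) (a : T 1) l (y : T l.+1) m
    (e : ((size vs).+1 + l.+1)%N = m.+2) :
  y \in free_lie l.+1 -> (forall u v, u \in vs -> v \in vs -> omega_form u v = 0) ->
  (forall v, v \in vs -> omega_form v a = 0) ->
  (forall v, v \in vs -> end_contraction v y = 0) ->
  exists x : T m.+2, [/\ x \in tens_free_lie m.+1,
    bracketing x = tens_cast e (lie (ad_chain vs a) y)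
    & forall w, tens_eval (outer_contraction x) w = (-1) ^+ size vs *
        seq_pure (rev vs) w * tens_eval (end_contraction a y) (word_drop (size vs) w)].
Proof.
elim: vs l y e => [|v vs IH] l y e yL vv va vy.
  have elm : l = m by case: e.
  case: m / elm e => e.
  exists (tens a y); split.
  - by apply: mem_vspan; exists a, y.
  - by rewrite bracketing_tens tens_cast_id.
  - move=> w; rewrite (outer_contraction_tens a y) expr0 !mul1r.
    by congr tens_eval; apply/funext => i.
have e1 : ((size vs).+1 + l.+1)%N = m.+1 := succn_inj e.
have e2 : ((size vs).+1 + l.+2)%N = m.+2 by rewrite addnS e1.
have vvs u : u \in vs -> u \in v :: vs by rewrite inE => ->; rewrite orbT.
have v0 : v \in v :: vs by exact: mem_head.
(* With w the chain of [vs], Jacobi reads [[v, w], y] = [v, [w, y]] + [w, - [v, y]]. The first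
   summand is the term of the leaf v, and the second is the induction hypothesis for [- lie v y]. *)
have [|||| x [xL xb xc]] := IH l.+1 (- lie v y) e2.
- by rewrite rpredN; exact: free_lie_lie (free_lie1 v) yL.
- by move=> u u' /vvs uv /vvs; exact: vv.
- by move=> u /vvs; exact: va.
- move=> u /vvs uv; apply: tens_eval_inj => w.
  rewrite end_contractionN tens_evalN tens_eval_contract_ad vy // tens_eval0 mulr0 sub0r.
  by rewrite vv // mul0r oppr0 oppr0 tens_eval0.
pose z := tens_cast e1 (lie (ad_chain vs a) y).
exists (tens v z + x); split.
- rewrite rpredD //; apply: mem_vspan; exists v, z; split=> //.
  by apply: free_lie_cast; apply: free_lie_lie => //; exact: ad_chain_free_lie.
- rewrite linearD /= (bracketing_tens v z) xb; apply: tens_eval_inj => w.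
  rewrite tens_evalD !tens_eval_cast linearN tens_evalN.
  rewrite [RHS](lie_jacobi v (ad_chain vs a) y w); congr (_ - _).
  by rewrite !(tens_eval_lie v) /z !tens_eval_cast -e1.
(* The leaf v contributes nothing, being orthogonal to the whole rest of the tree. *)
- move=> w; have z0 : end_contraction v z = 0.
    apply: end_contraction_lie0; last exact: vy.
    by apply: end_contraction_ad_chain => [u /vvs uv|]; [exact: vv|exact: va].
  rewrite linearD /= (outer_contraction_tens v z) z0 add0r xc end_contractionN tens_evalN.
  rewrite tens_eval_contract_ad (omega_form_anti a v) va // oppr0 mul0r subr0.
  rewrite rev_cons seq_pure_rcons size_rev word_drop_drop addn1 exprS.
  by rewrite mulrN mulN1r !mulNr !mulrA.
Qed.

(** The tensor is the sum over the leaves of the tree. Its bracketing vanishes because the leaf [b]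
    gives [b, chain] and the others add up to [chain, b]. Only the two end leaves contribute to the
    contraction: [b] gives the word [vs], and [a] its reversal with a sign. *)
Lemma caterpillar (vs : seq (T 1)) (a b : T 1) m : size vs = m ->
  (forall u v, u \in vs -> v \in vs -> omega_form u v = 0) ->
  (forall v, v \in vs -> omega_form v a = 0) ->
  (forall v, v \in vs -> omega_form v b = 0) ->
  exists2 t : T m.+2, t \in johnson_target K g m &
    forall w, tens_eval (outer_contraction t) w =
      omega_form b a * (seq_pure vs w + (-1) ^+ m.+1 * seq_pure (rev vs) w).
Proof.
move=> <- vv va vb.
have bL : b \in free_lie 1 by exact: free_lie1.
have vb' v : v \in vs -> end_contraction v b = 0.
  by move=> vvs; rewrite end_contraction1 vb //; apply/ffunP=> I; rewrite !ffunE.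
have [x [xL xb xc]] := leaf_sum (addn1 (size vs).+1) bL vv va vb'.
exists ((tens b (ad_chain vs a) : T (size vs).+2) + x) => [|w].
  rewrite memv_cap memv_ker lfunE rpredD //=; last first.
    by apply: mem_vspan; exists b, (ad_chain vs a); split=> //; exact: ad_chain_free_lie.
  rewrite linearD /= bracketing_tens xb (lieC (ad_chain vs a) b).
  apply/eqP/(@tens_eval_inj _ _ (size vs).+1) => w.
  by rewrite tens_evalD tens_evalN !tens_eval_cast addNr tens_eval0.
rewrite linearD /= (outer_contraction_tens b (ad_chain vs a)) tens_evalD xc.
rewrite tens_eval_contract_ad_chain => [|v vvs]; last by rewrite omega_form_anti vb ?oppr0.
rewrite tens_eval_contract1 (omega_form_anti a b) exprS.
move: (seq_pure vs w) (seq_pure _ w) (omega_form b a) (_ ^+ _) => p q c z.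
by ring.
Qed.

End Caterpillar.

(** * Isotropic tensors *)

(** This pairing makes the basis words orthonormal. It is not the symplectic one, but for it the
    insertion of the form is adjoint to the contraction. *)
Definition tens_dot (F : fieldType) (n k : nat) (u v : tensor F n k) : F := \sum_I u I * v I.

Section SymplecticForm.
Context {F : fieldType} {g : nat}.
Local Notation n := (g + g)%N.
Local Notation T k := (tensor F n k).
Implicit Types f h : 'rV[F]_n.

Definition symp_form f h : F := (f *m omega F g *m h^T) ord0 ord0.

Definition symp_p (k : 'I_g) : 'rV[F]_n := delta_mx ord0 (lshift g k).
Definition symp_q (k : 'I_g) : 'rV[F]_n := delta_mx ord0 (rshift g k).

Lemma symp_formDl f1 f2 h : symp_form (f1 + f2) h = symp_form f1 h + symp_form f2 h.
Proof. by rewrite /symp_form !mulmxDl mxE. Qed.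

Lemma symp_formDr f h1 h2 : symp_form f (h1 + h2) = symp_form f h1 + symp_form f h2.
Proof. by rewrite /symp_form linearD /= mulmxDr mxE. Qed.

Lemma symp_formZl c f h : symp_form (c *: f) h = c * symp_form f h.
Proof. by rewrite /symp_form -!scalemxAl mxE. Qed.

Lemma symp_formZr c f h : symp_form f (c *: h) = c * symp_form f h.
Proof. by rewrite /symp_form linearZ /= -scalemxAr mxE. Qed.

Lemma symp_formE f h : symp_form f h = \sum_i \sum_j omega F g i j * f ord0 i * h ord0 j.
Proof.
rewrite /symp_form mxE exchange_big /=; apply: eq_bigr => j _.
by rewrite !mxE mulr_suml; apply: eq_bigr => i _; rewrite (mulrC (f _ _)).
Qed.

Lemma symp_form_anti f h : symp_form f h = - symp_form h f.
Proof.
rewrite !symp_formE exchange_big /= -sumrN; apply: eq_bigr => i _.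
by rewrite -sumrN; apply: eq_bigr => j _; rewrite omega_anti; ring.
Qed.

Lemma symp_form_q f k : symp_form f (symp_q k) = f ord0 (lshift g k).
Proof.
rewrite /symp_form trmx_delta -colE mxE -{1}[f]hsubmxK mul_row_block.
by rewrite !mulmx0 mulmx1 mulmxN mulmx1 add0r addr0 row_mxEr !mxE.
Qed.

Lemma symp_pE k i : symp_p k ord0 i = (i == lshift g k)%:R.
Proof. by rewrite mxE eqxx. Qed.

Lemma symp_qE k i : symp_q k ord0 i = (i == rshift g k)%:R.
Proof. by rewrite mxE eqxx. Qed.

Lemma symp_form_pq k : symp_form (symp_p k) (symp_q k) = 1.
Proof. by rewrite symp_form_q symp_pE eqxx. Qed.

Definition pure s (v : 'I_s -> 'rV[F]_n) : T s :=
  [ffun I : multi n s => \prod_c v c ord0 (I c)].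

(** The hyperbolic pair orthogonal to all the vectors supplies the two end leaves of a caterpillar
    tree. *)
Definition isotropic s (v : 'I_s -> 'rV[F]_n) : Prop :=
  (forall c d, symp_form (v c) (v d) = 0) /\
  exists a b, [/\ symp_form b a = 1, forall c, symp_form (v c) a = 0
    & forall c, symp_form (v c) b = 0].

Definition vec1 f : T 1 := [ffun I : multi n 1 => f ord0 (I ord0)].

Lemma omega_form_vec1 f h : omega_form (vec1 f) (vec1 h) = symp_form f h.
Proof.
rewrite symp_formE exchange_big /=; apply: eq_bigr => j _.
by rewrite mulr_suml; apply: eq_bigr => i _; rewrite !ffunE.
Qed.

Lemma seq_pureE (l : seq 'rV[F]_n) s (w : nat -> 'I_n) : size l = s ->
  seq_pure (map vec1 l) w = \prod_(c < s) (nth 0 l c) ord0 (w c).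
Proof.
move=> <-; elim: l w => [|f l IH] w /=; first by rewrite big_ord0.
rewrite IH big_ord_recl /=; congr (_ * _).
by rewrite /tens_eval !ffunE.
Qed.

Lemma caterpillar_pure m (v : 'I_m.+1 -> 'rV[F]_n) (a b : 'rV[F]_n) :
  (forall c d, symp_form (v c) (v d) = 0) ->
  (forall c, symp_form (v c) a = 0) -> (forall c, symp_form (v c) b = 0) ->
  exists2 t, t \in johnson_target F g m.+1 &
    outer_contraction t = symp_form b a *: (pure v + tens_flip (pure v)).
Proof.
move=> vv va vb; pose l := [seq v c | c <- enum 'I_m.+1].
have sl : size l = m.+1 by rewrite size_map size_enum_ord.
have lE (c : 'I_m.+1) : nth 0 l c = v c by rewrite (nth_map c) ?size_enum_ord // nth_ord_enum.
have lP (f : T 1) : f \in map vec1 l -> exists c, f = vec1 (v c).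
  by case/mapP => h /mapP[c _ ->] ->; exists c.
have [||||t tJ tE] := @caterpillar F g (map vec1 l) (vec1 a) (vec1 b) m.+1.
- by rewrite size_map.
- by move=> _ _ /lP[c ->] /lP[d ->]; rewrite omega_form_vec1.
- by move=> _ /lP[c ->]; rewrite omega_form_vec1.
- by move=> _ /lP[c ->]; rewrite omega_form_vec1.
exists t => //; apply: tens_eval_inj => w; rewrite tE omega_form_vec1.
rewrite -map_rev (seq_pureE _ sl) (@seq_pureE _ m.+1) ?size_rev //.
rewrite /tens_eval !ffunE; congr (_ * (_ + _ * _)).
  by apply: eq_bigr => c _; rewrite ffunE lE.
rewrite (reindex_inj rev_ord_inj) /=; apply: eq_bigr => c _; rewrite !ffunE.
rewrite nth_rev sl; last exact: (ltn_ord (rev_ord c)).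
have -> : (m.+1 - (rev_ord c).+1)%N = c by have := ltn_ord c; rewrite /=; lia.
by rewrite lE.
Qed.

Definition tens_insertion m (a : 'I_m.+2) (b : 'I_m.+1) (u : T m) : T m.+2 :=
  [ffun J : multi n m.+2 =>
    omega F g (J a) (J (lift a b)) * u [ffun c => J (lift a (lift b c))]].

Lemma tens_dot_insertion m a b (u : T m) (v : T m.+2) :
  tens_dot (tens_insertion a b u) v = tens_dot u (tens_contraction a b v).
Proof.
rewrite /tens_dot (big_multi_insert a b).
under eq_bigr do rewrite exchange_big /=.
rewrite exchange_big /=; apply: eq_bigr => J _; rewrite ffunE mulr_sumr.
apply: eq_bigr => i _; rewrite mulr_sumr; apply: eq_bigr => j _.
rewrite !ffunE unlift_none liftK unlift_none mulrCA mulrA; congr (_ * u _ * _).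
by apply/ffunP=> c; rewrite !ffunE !liftK.
Qed.

Definition insertion_span m : {vspace T m.+2} :=
  vspan [set z | exists (a : 'I_m.+2) (b : 'I_m.+1) (u : T m), z = tens_insertion a b u].

Definition isotropic_span s : {vspace T s} :=
  vspan [set z | exists2 v, isotropic v & z = @pure s v].
End SymplecticForm.

Section PureTensors.
Context {F : fieldType} {g m : nat}.
Local Notation n := (g + g)%N.
Local Notation s := m.+2.
Local Notation T k := (tensor F n k).
Implicit Types (v : 'I_s -> 'rV[F]_n) (f h : 'rV[F]_n).

Definition update2 v (i : 'I_s) f (j : 'I_s) h : 'I_s -> 'rV[F]_n :=
  fun c => if c == i then f else if c == j then h else v c.

Lemma pure_update2 v i f j h (I : multi n s) : i != j ->
  pure (update2 v i f j h) I =
  f ord0 (I i) * h ord0 (I j) * \prod_(c | (c != i) && (c != j)) v c ord0 (I c).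
Proof.
move=> ij; rewrite ffunE (bigD1 i) //= (bigD1 j) ?(eq_sym j) //= /update2 eqxx.
rewrite (eq_sym j i) (negbTE ij) eqxx mulrA; congr (_ * _).
by apply: eq_bigr => c /andP[ci cj]; rewrite (negbTE ci) (negbTE cj).
Qed.

Lemma update2_id v i j : update2 v i (v i) j (v j) = v.
Proof. by apply/funext => c; rewrite /update2; case: eqP => [->//|_]; case: eqP => [->|]. Qed.

(** Expand in the factors i and j: the terms with exactly one of f and h change sign and cancel. *)
Lemma pure_update2_split v i f j h : i != j ->
  pure (update2 v i (v i + f) j (v j + h)) + pure (update2 v i (v i - f) j (v j - h)) =
  2 *: (pure v + pure (update2 v i f j h)).
Proof.
move=> ij; apply/ffunP=> I.
have vE : pure v I = pure (update2 v i (v i) j (v j)) I by rewrite update2_id.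
rewrite ffunE [RHS]ffunE [X in _ *: X]ffunE vE !pure_update2 // !mxE.
rewrite /GRing.scale /=.
by ring.
Qed.

Lemma omegaE i j : omega F g i j =
  \sum_k (((i == lshift g k) && (j == rshift g k))%:R -
          ((i == rshift g k) && (j == lshift g k))%:R).
Proof.
rewrite -[i]splitK -[j]splitK /omega.
have shiftE := (eq_lrshift, eq_rlshift, eq_lshift, eq_rshift).
case: (fintype.split i) => a; case: (fintype.split j) => b /=.
- by rewrite block_mxEul mxE big1 // => k _; rewrite !shiftE andbF subrr.
- rewrite block_mxEur mxE (bigD1 a) //= big1 => [|k ka].
    by rewrite !shiftE eqxx subr0 addr0 eq_sym.
  by rewrite !shiftE eq_sym (negbTE ka) subrr.
- rewrite block_mxEdl !mxE (bigD1 a) //= big1 => [|k ka].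
    by rewrite !shiftE eqxx sub0r addr0 eq_sym.
  by rewrite !shiftE (eq_sym a) (negbTE ka) subrr.
- by rewrite block_mxEdr mxE big1 // => k _; rewrite !shiftE andbF subrr.
Qed.

Lemma symp_form_sum f h : symp_form f h =
  \sum_k (f ord0 (lshift g k) * h ord0 (rshift g k) - f ord0 (rshift g k) * h ord0 (lshift g k)).
Proof.
rewrite /symp_form -{1}[f]hsubmxK mul_row_block !mulmx0 mulmx1 mulmxN mulmx1 add0r addr0.
rewrite -{1}[h]hsubmxK tr_row_mx mul_row_col mxE addrC sumrB; congr (_ + _).
  by rewrite mxE; apply: eq_bigr => k _; rewrite !mxE.
by rewrite mxE -sumrN; apply: eq_bigr => k _; rewrite !mxE mulNr.
Qed.

(** The symplectic form is the sum over k of the antisymmetrized p_k (x) q_k. A functional that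
    kills insertions therefore kills the sum of these replacements. *)
Lemma sum_hyperbolic_pairs v i b : let j := lift i b in
  \sum_k (pure (update2 v i (symp_p k) j (symp_q k)) -
          pure (update2 v i (symp_q k) j (symp_p k))) =
  tens_insertion i b (pure (fun c => v (lift i (lift b c)))).
Proof.
move=> j; have ij : i != j by rewrite /j neq_lift.
apply/ffunP=> I; rewrite sum_ffunE ffunE omegaE mulr_suml; apply: eq_bigr => k _.
rewrite ffunE [X in _ + X]ffunE !pure_update2 // -mulrBl !symp_pE !symp_qE.
rewrite -!natrM !mulnb; congr (_ * _).
rewrite big_mkcond /= ffunE (bigD1_ord i) //= (bigD1_ord b) //= eqxx mul1r.
rewrite -/j eqxx andbF mul1r; apply: eq_bigr => c _; rewrite ffunE.
by rewrite (eq_sym _ i) neq_lift /j (inj_eq lift_inj) (eq_sym _ b) neq_lift.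
Qed.

Lemma pure_basis_sum (u : T s) : u = \sum_I u I *: pure (fun c => delta_mx ord0 (I c)).
Proof.
apply/ffunP=> J; rewrite sum_ffunE (bigD1 J) //= big1 => [|I IJ].
  rewrite !ffunE big1 ?addr0 => [|c _]; last by rewrite mxE !eqxx.
  by rewrite -[LHS]mulr1.
rewrite !ffunE; have [c cI] : exists c, I c != J c.
  apply/existsP; rewrite -negb_forall; apply: contra IJ => /forallP h.
  by apply/eqP/ffunP=> c; apply/eqP.
by rewrite (bigD1 c) //= mxE eqxx eq_sym (negbTE cI) mul0r scaler0.
Qed.
End PureTensors.

(** * Bounds for functionals vanishing on isotropic tensors and on insertions *)

Section Estimate.
Context {F : realFieldType} {g m : nat}.
Local Notation n := (g + g)%N.
Local Notation s := m.+2.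
Local Notation T k := (tensor F n k).
Implicit Types (v : 'I_s -> 'rV[F]_n) (f h : 'rV[F]_n) (A : {set 'I_g}).
Context {lam : {linear T s -> F^o}}.
Hypothesis lam_iso : forall v, isotropic v -> lam (pure v) = 0.
Hypothesis lam_ins : forall i b u, lam (tens_insertion i b u) = 0.

Definition norm1 f : F := \sum_i `|f ord0 i|.

Lemma norm1_ge0 f : 0 <= norm1 f.
Proof. by apply: sumr_ge0 => i _. Qed.

Lemma norm1D f h : norm1 (f + h) <= norm1 f + norm1 h.
Proof. by rewrite /norm1 -big_split; apply: ler_sum => i _; rewrite mxE ler_normD. Qed.

Lemma norm1Z c f : norm1 (c *: f) = `|c| * norm1 f.
Proof. by rewrite /norm1 mulr_sumr; apply: eq_bigr => i _; rewrite mxE normrM. Qed.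

Lemma norm1_delta i : norm1 (delta_mx ord0 i) = 1.
Proof.
rewrite /norm1 (bigD1 i) //= big1 => [|j ji]; rewrite mxE eqxx ?eqxx /=.
  by rewrite normr1 addr0.
by rewrite (negbTE ji) normr0.
Qed.

Definition supported A f :=
  forall k, k \notin A -> f ord0 (lshift g k) = 0 /\ f ord0 (rshift g k) = 0.

Lemma supportedS A (B : {set 'I_g}) f : A \subset B -> supported A f -> supported B f.
Proof. by move=> /fintype.subsetP AB fA k kB; apply: fA; apply: contra kB => /AB. Qed.

Lemma supportedD A f h : supported A f -> supported A h -> supported A (f + h).
Proof.
move=> fA hA k kA; rewrite !mxE; have [-> ->] := fA k kA; have [-> ->] := hA k kA.
by rewrite !addr0.
Qed.

Lemma supportedZ A c f : supported A f -> supported A (c *: f).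
Proof. by move=> fA k kA; rewrite !mxE; have [-> ->] := fA k kA; rewrite !mulr0. Qed.

Lemma supported_p k : supported [set k]%SET (symp_p k).
Proof.
move=> l; rewrite finset.in_set1 => lk; rewrite !symp_pE eq_lshift eq_rlshift.
by rewrite (negbTE lk).
Qed.

Lemma supported_q k : supported [set k]%SET (symp_q k).
Proof.
move=> l; rewrite finset.in_set1 => lk; rewrite !symp_qE eq_rshift eq_lrshift.
by rewrite (negbTE lk).
Qed.

Lemma symp_form_fresh A k f h : supported A f -> supported [set k]%SET h -> k \notin A ->
  symp_form f h = 0.
Proof.
move=> fA hk kA; rewrite symp_form_sum big1 // => l _.
have [->|lk] := eqVneq l k; first by have [-> ->] := fA k kA; rewrite !mul0r subrr.
have [|-> ->] := hk l; first by rewrite finset.in_set1.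
by rewrite !mulr0 subrr.
Qed.

Definition basis_tensor (I : multi n s) : T s := pure (fun c => delta_mx ord0 (I c)).

(** In the expansion of [pure v] in basis words, the absolute values of the coefficients sum to the
    product of the l^1 norms of the factors; this dictates the choice of [norm1]. *)
Lemma lam_pure_bound M R v : (forall I, `|lam (basis_tensor I)| <= M) -> 0 <= M ->
  (forall c, norm1 (v c) <= R) -> `|lam (pure v)| <= M * R ^+ s.
Proof.
move=> lamM M0 vR; rewrite (pure_basis_sum (pure v)) linear_sum /=.
apply: le_trans (ler_norm_sum _ _ _) _.
apply: (@le_trans _ _ (\sum_(I : multi n s) M * \prod_c `|v c ord0 (I c)|)).
  apply: ler_sum => I _; rewrite linearZ /= normrM ffunE normr_prod mulrC.
  by apply: ler_wpM2r (lamM I); apply: prodr_ge0.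
rewrite -mulr_sumr; apply: ler_wpM2l => //.
rewrite -(bigA_distr_bigA (fun c i => `|v c ord0 i|)) /=.
rewrite -[s in _ ^+ s]card_ord -prodr_const.
by apply: ler_prod => c _; rewrite norm1_ge0 vR.
Qed.

Lemma exists_fresh A : (#|A| < g)%N -> exists k, k \notin A.
Proof.
move=> Ag; apply/existsP; rewrite -negb_forall; apply/negP => /forallP h.
have : A = [set: 'I_g]%SET by apply/setP=> k; rewrite h finset.in_setT.
by move=> E; move: Ag; rewrite E cardsT card_ord ltnn.
Qed.

(** A handle outside [A] provides the required orthogonal hyperbolic pair. *)
Lemma supported_isotropic A v : (#|A| < g)%N -> (forall c, supported A (v c)) ->
  (forall c d, symp_form (v c) (v d) = 0) -> isotropic v.
Proof.
move=> /exists_fresh[k kA] vA v0; split=> //; exists (symp_q k), (symp_p k).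
split=> [|c|c]; first exact: symp_form_pq.
  exact: symp_form_fresh (vA c) (@supported_q k) kA.
exact: symp_form_fresh (vA c) (@supported_p k) kA.
Qed.

Lemma lam_hyperbolic_pairs v i j : i != j ->
  \sum_k (lam (pure (update2 v i (symp_p k) j (symp_q k))) -
          lam (pure (update2 v i (symp_q k) j (symp_p k)))) = 0.
Proof.
case: (unliftP i j) => [b ->|->]; last by rewrite eqxx.
move=> _; under eq_bigr do rewrite -linearB.
by rewrite -linear_sum sum_hyperbolic_pairs lam_ins.
Qed.

Lemma lam_update2Z v i f j c h : i != j ->
  lam (pure (update2 v i f j (c *: h))) = c * lam (pure (update2 v i f j h)).
Proof.
move=> ij.
have -> : pure (update2 v i f j (c *: h)) = c *: pure (update2 v i f j h).
  by apply/ffunP=> I; rewrite [RHS]ffunE !pure_update2 // mxE /GRing.scale /=; ring.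
by rewrite linearZ.
Qed.

Lemma lam_update2_split v i f j h : i != j ->
  lam (pure (update2 v i (v i + f) j (v j + h))) +
  lam (pure (update2 v i (v i - f) j (v j - h))) =
  2 * (lam (pure v) + lam (pure (update2 v i f j h))).
Proof.
move=> ij; have := congr1 lam (pure_update2_split v f h ij).
by rewrite linearD linearZ /= linearD.
Qed.

(* Adding a hyperbolic pair of index k to the factors i and j makes them
   orthogonal; the average over signs and over the two gadgets (p_k, q_k) and
   (q_k, -p_k) leaves only an antisymmetrized pair, and the sum of the latter
   over all k vanishes. *)
Lemma fresh_average v i j A (B C c : F) : i != j -> `|c| <= 1 -> (#|A| < g)%N ->
  (forall k f h, k \notin A -> supported [set k]%SET f -> supported [set k]%SET h ->
     symp_form f h = - c -> norm1 f <= 1 -> norm1 h <= 1 ->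
     `|lam (pure (update2 v i (v i + f) j (v j + h)))| <= B) ->
  (forall k, `|lam (pure (update2 v i (symp_p k) j (symp_q k)))| <= C /\
    `|lam (pure (update2 v i (symp_q k) j (symp_p k)))| <= C) ->
  `|lam (pure v)| <= B + #|A|%:R / #|~: A|%:R * C.
Proof.
move=> ij c1 Ag vB hC.
pose a k := lam (pure (update2 v i (symp_p k) j (symp_q k))).
pose b k := lam (pure (update2 v i (symp_q k) j (symp_p k))).
(* Average the estimates for (f, h) and (-f, -h), which have the same pairing, using the splitting
   identity. *)
have gadget k f h : k \notin A -> supported [set k]%SET f -> supported [set k]%SET h ->
    symp_form f h = - c -> norm1 f <= 1 -> norm1 h <= 1 ->
    `|lam (pure v) + lam (pure (update2 v i f j h))| <= B.
  move=> kA fk hk fh f1 h1.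
  have t1 := vB k f h kA fk hk fh f1 h1.
  have t2 : `|lam (pure (update2 v i (v i - f) j (v j - h)))| <= B.
    apply: (vB k (- f) (- h)) => //.
    - by rewrite -scaleN1r; exact: supportedZ.
    - by rewrite -scaleN1r; exact: supportedZ.
    - by rewrite -(scaleN1r f) -(scaleN1r h) symp_formZl symp_formZr mulrA mulN1r opprK mul1r.
    - by rewrite -scaleN1r norm1Z normrN1 mul1r.
    - by rewrite -scaleN1r norm1Z normrN1 mul1r.
  move: t1 t2 (lam_update2_split v f h ij); rewrite !ler_norml.
  by move=> /andP[? ?] /andP[? ?] ?; apply/andP; split; lra.
have cZ h : norm1 h = 1 -> norm1 (c *: h) <= 1.
  by move=> h1; rewrite norm1Z h1 mulr1.
(* The pairs (p_k, -c q_k) and (q_k, c p_k) both have pairing -c; adding their estimates leaves only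
   the antisymmetrized difference. *)
have step k : k \notin A -> `|2 * lam (pure v) - c * (a k - b k)| <= 2 * B.
  move=> kA.
  have t1 : `|lam (pure v) - c * a k| <= B.
    rewrite -mulNr -lam_update2Z //; apply: (gadget k) => //.
    - exact: supported_p.
    - exact/supportedZ/supported_q.
    - by rewrite symp_formZr symp_form_pq mulr1.
    - by rewrite norm1_delta.
    - by rewrite scaleNr -scalerN -scaleN1r cZ // norm1Z normrN1 mul1r norm1_delta.
  have t2 : `|lam (pure v) + c * b k| <= B.
    rewrite -lam_update2Z //; apply: (gadget k) => //.
    - exact: supported_q.
    - exact/supportedZ/supported_p.
    - by rewrite symp_formZr symp_form_anti symp_form_pq mulrN1.
    - by rewrite norm1_delta.
    - by rewrite cZ // norm1_delta.
  move: t1 t2; rewrite !ler_norml.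
  by move=> /andP[? ?] /andP[? ?]; apply/andP; split; lra.
have cardA : (0 < #|~: A|)%N by rewrite cardsCs finset.setCK card_ord subn_gt0.
(* Since the sum over all handles is zero, the sum over the many fresh handles equals, up to sign,
   the sum over the few handles of [A]. *)
have sumC : \sum_(k in ~: A) (a k - b k) = - \sum_(k in A) (a k - b k).
  have := lam_hyperbolic_pairs v ij; rewrite (bigID (mem A)) /= addrC => /eqP.
  rewrite addr_eq0 => /eqP E; rewrite -[RHS]E.
  by apply: eq_bigl => k; rewrite finset.in_setC.
have sumA : `|\sum_(k in A) (a k - b k)| <= #|A|%:R * (2 * C).
  apply: le_trans (ler_norm_sum _ _ _) _.
  rewrite mulr_natl -sumr_const; apply: ler_sum => k _.
  have [ha hb] := hC k; apply: le_trans (ler_normB _ _) _.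
  by rewrite -/(a k) -/(b k) in ha hb *; lra.
have sumB : `|#|~: A|%:R * (2 * lam (pure v)) + c * \sum_(k in A) (a k - b k)| <=
    #|~: A|%:R * (2 * B).
  have -> : #|~: A|%:R * (2 * lam (pure v)) + c * \sum_(k in A) (a k - b k) =
      \sum_(k in ~: A) (2 * lam (pure v) - c * (a k - b k)).
    rewrite [RHS]sumrB sumr_const -[X in _ = _ - X]mulr_sumr sumC mulrN opprK; congr (_ + _).
    by rewrite mulr_natl.
  apply: le_trans (ler_norm_sum _ _ _) _.
  rewrite [leRHS]mulr_natl -sumr_const; apply: ler_sum => k; rewrite finset.in_setC => kA.
  exact: step.
have N0 : 0 < #|~: A|%:R :> F by rewrite ltr0n.
rewrite -(ler_pM2l N0) mulrDr mulrA mulrCA divff ?gt_eqF // mulr1 -[X in X * `|_|]gtr0_norm //.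
rewrite -normrM -(ler_pM2l (ltr0n _ 2)).
set S := \sum_(k in A) _ in sumA sumB; set N := #|~: A|%:R in sumB *.
have cS : `|c * S| <= #|A|%:R * (2 * C).
  by rewrite normrM; apply: le_trans sumA; rewrite ler_piMl.
move: cS sumB; rewrite !ler_norml => /andP[? ?] /andP[? ?].
have norm2 (z : F) : 2 * `|z| = `|2 * z| by rewrite normrM ger0_norm.
by rewrite norm2 ler_norml; apply/andP; split; lra.
Qed.
End Estimate.

Section IsotropicBound.
Context {F : realFieldType} {g m : nat}.
Local Notation n := (g + g)%N.
Local Notation s := m.+2.
Local Notation T k := (tensor F n k).
Implicit Types (v : 'I_s -> 'rV[F]_n) (f h : 'rV[F]_n) (A : {set 'I_g}).
Context {lam : {linear T s -> F^o}}.
Hypothesis lam_iso : forall v, isotropic v -> lam (pure v) = 0.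
Hypothesis lam_ins : forall i b u, lam (tens_insertion i b u) = 0.
Context {M R : F} {L : nat}.
Hypothesis lamM : forall I, `|lam (basis_tensor I)| <= M.
Hypotheses (M0 : 0 <= M) (R1 : 1 <= R) (Lg : (L < g)%N).

(** The price of making one pair of factors orthogonal: L / (g - L) bounds the ratio of used to
    fresh handles, and M R^s bounds [lam] on the tensors with an inserted hyperbolic pair. *)
Definition pair_error : F := L%:R / (g - L)%:R * (M * R ^+ s).

(** Induction on the list [ps] of pairs that may fail to be orthogonal. Treating one pair uses up
    one handle and raises norms by at most 1, whence the budgets [L] and [R]; when the list is empty
    the tensor is isotropic and [lam] vanishes on it. *)
Lemma isotropic_bound (ps : seq ('I_s * 'I_s)) A v :
  all (fun p => p.1 != p.2) ps -> (#|A| + size ps <= L)%N ->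
  (forall c, supported A (v c)) -> (forall c, norm1 (v c) + (size ps)%:R <= R) ->
  (forall c d, `|symp_form (v c) (v d)| <= 1) ->
  (forall c d, symp_form (v c) (v d) != 0 -> (c, d) \in ps \/ (d, c) \in ps) ->
  `|lam (pure v)| <= (size ps)%:R * pair_error.
Proof.
elim: ps A v => [|[i j] ps IH] A v /=.
  move=> _ AL vA _ _ v0; rewrite mul0r lam_iso ?normr0 //.
  apply: (supported_isotropic _ vA) => [|c d].
    by rewrite -[#|A|]addn0; exact: leq_ltn_trans AL Lg.
  by apply/eqP/negP => /negP /v0[].
move=> /andP[ij psd] AL vA vR v1 v0.
have Ag : (#|A| < g)%N by apply: leq_ltn_trans Lg; apply: leq_trans AL; exact: leq_addr.
set c := symp_form (v i) (v j).
have vR' d : norm1 (v d) <= R by apply: le_trans (vR d); rewrite lerDl ler0n.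
have C_bound f h : norm1 f <= 1 -> norm1 h <= 1 ->
    `|lam (pure (update2 v i f j h))| <= M * R ^+ s.
  move=> f1 h1; apply: lam_pure_bound => // d; rewrite /update2.
  by case: ifP => _; [exact: le_trans R1|case: ifP => _; [exact: le_trans R1|exact: vR']].
have step k f h : k \notin A -> supported [set k]%SET f -> supported [set k]%SET h ->
    symp_form f h = - c -> norm1 f <= 1 -> norm1 h <= 1 ->
    `|lam (pure (update2 v i (v i + f) j (v j + h)))| <= (size ps)%:R * pair_error.
  move=> kA fk hk fh f1 h1.
  pose d a := if a == i then f else if a == j then h else 0.
  have v'E a : update2 v i (v i + f) j (v j + h) a = v a + d a.
    rewrite /update2 /d; case: eqP => [->//|_]; case: eqP => [->//|_].
    by rewrite addr0.
  have supp0 : supported [set k]%SET (0 : 'rV[F]_n) by move=> l _; rewrite !mxE.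
  have dk a : supported [set k]%SET (d a) by rewrite /d; do 2 case: ifP => // _.
  have d1 a : norm1 (d a) <= 1.
    rewrite /d; do 2 case: ifP => // _.
    by rewrite /norm1 big1 ?ler01 // => l _; rewrite mxE normr0.
  have form0 x : symp_form x x = 0 :> F.
    by have := symp_form_anti x x; lra.
  have formx0 x : symp_form x 0 = 0 :> F by rewrite /symp_form trmx0 mulmx0 mxE.
  have form0x x : symp_form 0 x = 0 :> F by rewrite symp_form_anti formx0 oppr0.
  (* The added vectors live on a fresh handle, so they are orthogonal to all the old ones: only the
     pairing of factors i and j changes, and it becomes 0. *)
  have E a b : symp_form (v a + d a) (v b + d b) =
      if ((a == i) && (b == j)) || ((a == j) && (b == i)) then 0
      else symp_form (v a) (v b).
    rewrite symp_formDl !symp_formDr (symp_form_fresh (vA a) (@dk b) kA).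
    rewrite (symp_form_anti (d a)) (symp_form_fresh (vA b) (@dk a) kA) oppr0 addr0 add0r.
    have -> : symp_form (d a) (d b) = if (a == i) && (b == j) then - c
        else if (a == j) && (b == i) then c else 0.
      rewrite /d; have [->|ai] := eqVneq a i.
        rewrite (negbTE ij) /=; have [->|bi] := eqVneq b i.
          by rewrite (negbTE ij) form0.
        by case: (eqVneq b j) => _.
      have [_|_] /= := eqVneq a j; last by rewrite form0x.
      have [_|_] := eqVneq b i; first by rewrite symp_form_anti fh opprK.
      by case: (eqVneq b j) => _; rewrite ?form0 ?formx0.
    case: eqP => [->|_] /=.
      case: eqP => [->|_] /=; first by rewrite subrr.
      by rewrite (negbTE ij) addr0.
    case: eqP => [->|_] /=; last by rewrite addr0.
    case: eqP => [->|_] /=; last by rewrite addr0.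
    by rewrite symp_form_anti addNr.
  apply: (IH (k |: A)%SET) => //.
  - by rewrite cardsU1 kA add1n addSnnS.
  - move=> a; rewrite v'E; apply: supportedD.
      by apply: supportedS (vA a); exact: finset.subsetUr.
    by apply: supportedS (@dk a); exact: finset.subsetUl.
  - move=> a; rewrite v'E; have := vR a; have := d1 a; have := norm1D (v a) (d a).
    by rewrite -natr1; lra.
  - by move=> a b; rewrite !v'E E; case: ifP => _; rewrite ?normr0 ?ler01.
  - move=> a b; rewrite !v'E E; case: ifP => [|/negbT nab /v0]; first by rewrite eqxx.
    move: nab; rewrite !inE !xpair_eqE negb_or => /andP[/negbTE n1 /negbTE n2].
    by rewrite n1 (andbC (b == i)) n2.
have CB k : `|lam (pure (update2 v i (symp_p k) j (symp_q k)))| <= M * R ^+ s /\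
    `|lam (pure (update2 v i (symp_q k) j (symp_p k)))| <= M * R ^+ s.
  by split; apply: C_bound; rewrite ?norm1_delta.
apply: le_trans (fresh_average lam_ins ij (v1 i j) Ag step CB) _.
rewrite -natr1 mulrDl mul1r lerD2l; apply: ler_wpM2r.
  by apply: mulr_ge0 => //; apply: exprn_ge0; exact: le_trans R1.
have AL' : (#|A| <= L)%N by apply: leq_trans AL; exact: leq_addr.
have gL : (0 < g - L)%N by rewrite subn_gt0.
have cA : (g - L <= #|~: A|)%N.
  by rewrite cardsCs finset.setCK card_ord leq_sub2l.
apply: ler_pM; rewrite ?invr_ge0 ?ler0n ?ler_nat //.
by rewrite lef_pV2 ?posrE ?ltr0n ?ler_nat // (leq_trans gL).
Qed.
End IsotropicBound.

(* isotropic_bound contracts the sup norm of lam by the factor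
   s^2 * L / (g - L) * (1 + s^2)^s, where L bounds the number of handles used. *)
Definition genus_bound (m : nat) : nat :=
  let s := m.+2 in let L := (s + s ^ 2)%N in (L + s ^ 2 * L * (1 + s ^ 2) ^ s).+1.

Section Vanishing.
Context {F : realFieldType} {g m : nat}.
Local Notation n := (g + g)%N.
Local Notation s := m.+2.
Local Notation T k := (tensor F n k).
Context {lam : {linear T s -> F^o}}.
Hypothesis lam_iso : forall v, isotropic v -> lam (pure v) = 0.
Hypothesis lam_ins : forall i b u, lam (tens_insertion i b u) = 0.

Lemma symp_form_delta (i j : 'I_n) :
  symp_form (delta_mx ord0 i) (delta_mx ord0 j) = omega F g i j.
Proof. by rewrite /symp_form trmx_delta -rowE -colE !mxE. Qed.

Lemma omega_norm_le1 (i j : 'I_n) : `|omega F g i j| <= 1.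
Proof.
have b1 (b : bool) : `|b%:R : F| <= 1 by case: b; rewrite ?normr1 ?normr0 ?ler01.
rewrite /omega -[i]splitK -[j]splitK.
case: (fintype.split i) => a; case: (fintype.split j) => b /=.
- by rewrite block_mxEul mxE normr0 ler01.
- by rewrite block_mxEur mxE b1.
- by rewrite block_mxEdl !mxE normrN b1.
- by rewrite block_mxEdr mxE normr0 ler01.
Qed.

Definition handle (i : 'I_n) : 'I_g :=
  match fintype.split i with inl a => a | inr a => a end.

Lemma handle_lshift k : handle (lshift g k) = k.
Proof. by rewrite /handle (unsplitK (inl k)). Qed.

Lemma handle_rshift k : handle (rshift g k) = k.
Proof. by rewrite /handle (unsplitK (inr k)). Qed.

(** A basis word occupies at most s handles, has factors of norm 1 and at most s^2 nonorthogonal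
    ordered pairs, hence the values of [L] and [Rn]. The resulting bound is M times a factor smaller
    than 1 for g large, which forces M = 0. *)
Lemma functional_eq0 (u : T s) : (genus_bound m <= g)%N -> lam u = 0.
Proof.
move=> gm; pose L := (s + s ^ 2)%N; pose Rn := (1 + s ^ 2)%N.
have Lg : (L < g)%N by apply: leq_trans gm; rewrite ltnS leq_addr.
pose M := \big[Num.max/0]_(I : multi n s) `|lam (basis_tensor I)|.
have lamM I : `|lam (basis_tensor I)| <= M by exact: le_bigmax.
have M0 : 0 <= M by exact: bigmax_ge_id.
have R1 : 1 <= Rn%:R :> F by rewrite ler1n.
pose ps := [seq p <- enum {: 'I_s * 'I_s} | p.1 != p.2].
have sps : (size ps <= s ^ 2)%N.
  by rewrite size_filter (leq_trans (count_size _ _)) // -cardE card_prod card_ord.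
have bound I : `|lam (basis_tensor I)| <= (size ps)%:R * @pair_error F g m M Rn%:R L.
  apply: (isotropic_bound lam_iso lam_ins lamM M0 R1 Lg
            (A := [set handle (I c) | c : 'I_s]%SET)).
  - exact: filter_all.
  - by rewrite leq_add // (leq_trans (leq_imset_card _ _)) // card_ord.
  - move=> c k kA; rewrite !mxE /=; split; rewrite (_ : _ == _ = false) //.
      apply/eqP => kI; case/imsetP: kA; exists c => //.
      by rewrite -kI handle_lshift.
    apply/eqP => kI; case/imsetP: kA; exists c => //.
    by rewrite -kI handle_rshift.
  - by move=> c; rewrite norm1_delta nat1r ler_nat ltnS.
  - by move=> c d; rewrite symp_form_delta omega_norm_le1.
  - move=> c d cd; left; rewrite mem_filter mem_enum andbT /=.
    apply: contraNneq cd => ->; rewrite symp_form_delta.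
    by have := @omega_anti F g (I d) (I d); lra.
have MM : M <= (size ps)%:R * @pair_error F g m M Rn%:R L.
  apply: bigmax_le => //.
  (* The maximum starts from 0, so the bound must also be nonnegative; its validity for an arbitrary
     word shows this. *)
  exact: le_trans (bound [ffun=> lshift g (Ordinal (leq_ltn_trans (leq0n _) Lg))]).
have gL : (0 < g - L)%N by rewrite subn_gt0.
have M_eq0 : M = 0.
  apply/eqP; rewrite eq_le M0 andbT; rewrite leNgt; apply/negP => Mpos.
  move: MM; apply/negP; rewrite -ltNge /pair_error.
  have -> : (size ps)%:R * (L%:R / (g - L)%:R * (M * Rn%:R ^+ s)) =
      (size ps * L * Rn ^ s)%:R / (g - L)%:R * M :> F.
    by rewrite (natrM _ (size ps * L)) (natrM _ (size ps)) (natrX _ Rn); ring.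
  rewrite gtr_pMl // ltr_pdivrMr ?ltr0n // mul1r ltr_nat ltn_subRL.
  apply: leq_trans gm; rewrite /genus_bound ltnS leq_add2l.
  by rewrite leq_mul // leq_mul.
rewrite (pure_basis_sum u) linear_sum big1 // => I _.
rewrite linearZ /=; have := lamM I; rewrite M_eq0 normr_le0 => /eqP.
by rewrite /basis_tensor => ->; rewrite scaler0.
Qed.
End Vanishing.

(** * Base change from the rationals *)

Lemma rat_embedding (K : fieldType) : [pchar K] =i pred0 -> exists phi : {rmorphism rat -> K}, True.
Proof.
move=> /GRing.pcharf0P K0.
have int_neq0 (d : int) : d != 0 -> d%:~R != 0 :> K.
  by case: d => d d0; rewrite ?NegzE ?rmorphN ?oppr_eq0 /= -[_%:~R]/(_%:R) K0.
(* Any fraction representing x computes its image, so sums and products can be checked without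
   reducing fractions. *)
have ratrE x (a d : int) : d != 0 -> x * d%:~R = a%:~R -> @ratr K x = a%:~R / d%:~R.
  move=> d0 xd; apply/eqP; rewrite /ratr eqr_div ?int_neq0 ?denq_neq0 //.
  rewrite -!rmorphM; apply/eqP; congr _%:~R; apply: (@intr_inj rat).
  by rewrite !rmorphM /= numqE mulrAC xd.
have ratr_morphB : zmod_morphism (@ratr K).
  move=> x y.
  rewrite (@ratrE (x - y) (numq x * denq y - numq y * denq x) (denq x * denq y)).
  - rewrite /ratr rmorphB !rmorphM /= invfM mulrBl.
    have [dx dy] := (int_neq0 _ (denq_neq0 x), int_neq0 _ (denq_neq0 y)).
    by field; rewrite dx dy.
  - by rewrite mulf_neq0 ?denq_neq0.
  - by rewrite rmorphB !rmorphM /= !numqE; ring.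
have ratr_morphM : monoid_morphism (@ratr K).
  split=> [|x y]; first by rewrite /ratr divr1.
  rewrite (@ratrE (x * y) (numq x * numq y) (denq x * denq y)).
  - by rewrite /ratr !rmorphM /= invfM mulrACA.
  - by rewrite mulf_neq0 ?denq_neq0.
  - by rewrite !rmorphM /= !numqE; ring.
pose zm := GRing.isZmodMorphism.Build rat K (@ratr K) ratr_morphB.
pose mm := GRing.isMonoidMorphism.Build rat K (@ratr K) ratr_morphM.
by exists (HB.pack_for {rmorphism rat -> K} (@ratr K) zm mm).
Qed.

(** A proper subspace is killed by a nonzero functional. The subspace is given by a proposition
    because it will be the preimage of a K-subspace under the semilinear map [tens_map]. *)
Lemma separating_functional (F : fieldType) (n k : nat) (P : tensor F n k -> Prop) :
  P 0 -> (forall a x y, P x -> P y -> P (a *: x + y)) ->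
  (forall lam : {linear tensor F n k -> F^o},
     (forall x, P x -> lam x = 0) -> forall x, lam x = 0) ->
  forall x, P x.
Proof.
move=> P0 PL hlam.
pose Q d := `[< exists X : seq (tensor F n k), (forall x, x \in X -> P x) /\ \dim <<X>>%VS = d >].
have exQ : exists d, Q d.
  by exists 0%N; apply/asboolP; exists [::]; rewrite span_nil dimv0.
have ubQ d : Q d -> (d <= \dim {:tensor F n k})%N.
  by move=> /asboolP[X [_ <-]]; rewrite dimvS ?subvf.
have [d /asboolP[X [XP dX]] dmax] := ex_maxnP exQ ubQ.
have PX x : P x -> x \in <<X>>%VS.
  move=> Px; have sub : (<<X>> <= <<x :: X>>)%VS by rewrite span_cons addvSr.
  have : \dim <<X>>%VS == \dim <<x :: X>>%VS.
    rewrite eqn_leq dimvS //= dX; apply: dmax; apply/asboolP; exists (x :: X).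
    by split=> // y; rewrite inE => /predU1P[->//|/XP].
  have [_ ->] := dimv_leqif_eq sub; move/eqP => ->.
  by rewrite memv_span ?mem_head.
have XsubP x : x \in <<X>>%VS -> P x.
  move=> xX; rewrite (@coord_span _ _ _ (in_tuple X) _ xX).
  elim/big_ind: _ => // [a b Pa Pb|i _].
    by rewrite -[a]scale1r; exact: PL.
  by rewrite -[_ *: _]addr0; apply: PL => //; apply: XP; exact: mem_nth.
move=> x; apply: XsubP.
(* The coordinates of this complementary projection are functionals that vanish on [P]; if they are
   all zero, the span is everything. *)
pose p : 'End(tensor F n k) := (\1 - projv <<X>>%VS)%VF.
have pE y : p y = y - projv <<X>>%VS y by rewrite /p add_lfunE opp_lfunE id_lfunE.
suff: p x = 0 by rewrite pE => /subr0_eq ->; exact: memv_proj.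
apply/ffunP=> I; rewrite [RHS]ffunE.
have lin : linear (fun y : tensor F n k => p y I : F^o).
  by move=> a y z; rewrite linearP !ffunE.
pose lamI : {linear tensor F n k -> F^o} := HB.pack (fun y : tensor F n k => p y I : F^o)
  (GRing.isLinear.Build F (tensor F n k) F^o _ _ lin).
apply: (hlam lamI) => y /PX yX.
by rewrite /lamI /= pE projv_id // subrr ffunE.
Qed.

Section BaseChange.
Context {E K : fieldType} {g m : nat} (phi : {rmorphism E -> K}).
Local Notation n := (g + g)%N.

Definition tens_map k (u : tensor E n k) : tensor K n k :=
  [ffun I : multi n k => phi (u I)].

Lemma map_omega i j : phi (omega E g i j) = omega K g i j.
Proof.
have /matrixP/(_ i j) : map_mx phi (omega E g) = omega K g; last by rewrite mxE.
by rewrite /omega map_block_mx !map_mx0 map_mxN !map_mx1.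
Qed.

Lemma symp_form_map (f h : 'rV[E]_n) :
  symp_form (map_mx phi f) (map_mx phi h) = phi (symp_form f h).
Proof.
rewrite !symp_formE rmorph_sum; apply: eq_bigr => i _; rewrite rmorph_sum.
by apply: eq_bigr => j _; rewrite !rmorphM /= map_omega !mxE.
Qed.

Lemma tens_map_pure s (v : 'I_s -> 'rV[E]_n) :
  tens_map (pure v) = pure (fun c => map_mx phi (v c)).
Proof.
by apply/ffunP=> I; rewrite !ffunE rmorph_prod; apply: eq_bigr => c _; rewrite mxE.
Qed.

Lemma tens_map_insertion i b (u : tensor E n m) :
  tens_map (tens_insertion i b u) = tens_insertion i b (tens_map u).
Proof. by apply/ffunP=> I; rewrite !ffunE rmorphM /= map_omega. Qed.

Lemma isotropic_map s (v : 'I_s -> 'rV[E]_n) :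
  isotropic v -> isotropic (fun c => map_mx phi (v c)).
Proof.
move=> [v0 [a [b [ab va vb]]]]; split=> [c d|]; first by rewrite symp_form_map v0 rmorph0.
exists (map_mx phi a), (map_mx phi b); split=> [|c|c]; rewrite symp_form_map.
- by rewrite ab rmorph1.
- by rewrite va rmorph0.
- by rewrite vb rmorph0.
Qed.
End BaseChange.

(** The estimates need an ordered field, so they are applied to the rational tensors whose image in
    K lies in [W]. These turn out to be all rational tensors, and the basis words over K are images
    of rational ones. *)
Lemma isotropic_insertion_span (K : fieldType) g m :
  [pchar K] =i pred0 -> (genus_bound m <= g)%N ->
  (isotropic_span (F:=K) (g:=g) m.+2 + insertion_span m)%VS = fullv.
Proof.
move=> K0 gm; have [phi _] := rat_embedding K0.
set W := (_ + _)%VS.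
have isoW v : isotropic v -> pure v \in W.
  by move=> hv; apply: (subvP (addvSl _ _)); apply: mem_vspan; exists v.
have insW a b u : tens_insertion a b u \in W.
  by apply: (subvP (addvSr _ _)); apply: mem_vspan; exists a, b, u.
have full (x : tensor rat (g + g) m.+2) : tens_map phi x \in W.
  move: x; apply: separating_functional => [|a x y xW yW|lam lamW x].
  - suff -> : tens_map phi 0 = 0 :> tensor K (g + g) m.+2 by exact: mem0v.
    by apply/ffunP=> I; rewrite !ffunE rmorph0.
  - suff -> : tens_map phi (a *: x + y) = phi a *: tens_map phi x + tens_map phi y.
      by rewrite memvD // memvZ.
    by apply/ffunP=> I; rewrite !ffunE rmorphD rmorphM.
  - apply: functional_eq0 => [v hv|i b u|//]; apply: lamW.
      by rewrite tens_map_pure; apply: isoW; exact: isotropic_map.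
    by rewrite tens_map_insertion.
apply/eqP; rewrite eqEsubv subvf; apply/subvP => x _.
rewrite (pure_basis_sum x); apply: memv_suml => I _; apply: memvZ.
have := full (pure (fun c => delta_mx ord0 (I c))); rewrite tens_map_pure.
by congr (pure _ \in W); apply/funext => c; rewrite map_delta_mx.
Qed.

(** * Projection onto traceless tensors *)

Section TracelessProjection.
Context {K : fieldType} {g m : nat}.
Local Notation n := (g + g)%N.
Local Notation s := m.+2.
Local Notation T k := (tensor K n k).
Local Notation W := (traceless K g m.+2).
Local Notation Ins := (@insertion_span K g m).

Lemma tracelessP (t : T s) :
  reflect (forall a b, tens_contraction a b t = 0) (t \in W).
Proof.
rewrite memvE; apply: (iffP subv_bigcapP) => [t0 a b|t0 a _].
  have /subv_bigcapP/(_ b isT) := t0 a isT.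
  by rewrite -memvE memv_ker lfunE => /eqP.
by apply/subv_bigcapP => b _; rewrite -memvE memv_ker lfunE /= t0.
Qed.

Lemma pure_traceless (v : 'I_s -> 'rV[K]_n) :
  (forall c d, symp_form (v c) (v d) = 0) -> pure v \in W.
Proof.
move=> v0; apply/tracelessP => a b; apply/ffunP=> I; rewrite !ffunE.
have := v0 a (lift a b); rewrite symp_formE.
move/(congr1 ( *%R^~ (\prod_c v (lift a (lift b c)) ord0 (I c)))); rewrite mul0r => E.
rewrite -[RHS]E mulr_suml; apply: eq_bigr => i _; rewrite mulr_suml; apply: eq_bigr => j _.
rewrite ffunE (bigD1_ord a) //= (bigD1_ord b) //= !ffunE unlift_none liftK unlift_none.
rewrite !mulrA; congr (_ * _); apply: eq_bigr => c _; rewrite !ffunE !liftK //.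
Qed.

Fact tens_dotl_is_linear k (v : T k) : linear (fun u : T k => tens_dot u v : K^o).
Proof.
move=> a u u'; transitivity (a * tens_dot u v + tens_dot u' v) => //.
rewrite /tens_dot mulr_sumr -big_split; apply: eq_bigr => I _.
by rewrite !ffunE mulrDl mulrA.
Qed.

Lemma tens_dotC k (u v : T k) : tens_dot u v = tens_dot v u.
Proof. by apply: eq_bigr => I _; rewrite mulrC. Qed.

Lemma tens_dot_eq0 k (u : T k) : (forall v, tens_dot u v = 0) -> u = 0.
Proof.
move=> u0; apply/ffunP=> I; have := u0 [ffun J => (J == I)%:R].
rewrite /tens_dot (bigD1 I) //= big1 => [|J JI]; rewrite !ffunE ?eqxx ?mulr1 ?addr0 //.
by rewrite (negbTE JI) mulr0.
Qed.

Lemma insertion_traceless_dot x y : x \in Ins -> y \in W -> tens_dot x y = 0.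
Proof.
move=> xI /tracelessP y0.
pose l : {linear T s -> K^o} := HB.pack_for {linear T s -> K^o}
  (fun u : T s => tens_dot u y : K^o)
  (GRing.isLinear.Build K (T s) K^o _ _ (tens_dotl_is_linear y)).
have : (Ins <= lker (linfun l))%VS.
  apply/vspan_subvP => _ [a [b [u ->]]]; rewrite memv_ker lfunE /= tens_dot_insertion y0.
  by rewrite /tens_dot big1 // => I _; rewrite ffunE mulr0.
by move=> /subvP/(_ _ xI); rewrite memv_ker lfunE => /eqP.
Qed.

Hypothesis total : (isotropic_span (F:=K) (g:=g) s + Ins)%VS = fullv.

Lemma isotropic_sub_traceless : (isotropic_span (F:=K) (g:=g) s <= W)%VS.
Proof. by apply/vspan_subvP => _ [v [v0 _] ->]; exact: pure_traceless. Qed.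

Lemma traceless_insertion_total : (W + Ins)%VS = fullv.
Proof.
apply/eqP; rewrite eqEsubv subvf -total; apply: addvS => //.
exact: isotropic_sub_traceless.
Qed.

(** Over K the pairing may have self-orthogonal vectors, so the argument goes through the sum: an
    element of both spaces is orthogonal to both, hence to everything. *)
Lemma traceless_insertion_cap : (W :&: Ins)%VS = 0%VS.
Proof.
apply/eqP; rewrite -subv0; apply/subvP => x; rewrite memv_cap => /andP[xW xI].
rewrite memv0; apply/eqP/tens_dot_eq0 => y.
have : y \in (W + Ins)%VS by rewrite traceless_insertion_total memvf.
case/memv_addP => w wW [z zI ->]; rewrite tens_dotC.
have -> : tens_dot (w + z) x = tens_dot w x + tens_dot z x.
  by rewrite /tens_dot -big_split; apply: eq_bigr => I _; rewrite ffunE mulrDl.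
by rewrite (tens_dotC w) !insertion_traceless_dot ?addr0.
Qed.

(** The isotropic span lies in [W] and already complements the insertions together with which [W]
    intersects trivially, so the two coincide. *)
Lemma traceless_sub_isotropic : (W <= isotropic_span (F:=K) (g:=g) s)%VS.
Proof.
apply/subvP => x xW; have : x \in (isotropic_span (F:=K) (g:=g) s + Ins)%VS.
  by rewrite total memvf.
case/memv_addP => u uI [z zI xE].
have : z \in (W :&: Ins)%VS.
  rewrite memv_cap zI andbT -(addKr u z) -xE rpredD ?rpredN //.
  exact: (subvP isotropic_sub_traceless).
by rewrite traceless_insertion_cap memv0 xE => /eqP ->; rewrite addr0.
Qed.

Lemma insertionP x : reflect (forall w, w \in W -> tens_dot x w = 0) (x \in Ins).
Proof.
apply: (iffP idP) => [xI w|x0]; first exact: insertion_traceless_dot.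
have : x \in (W + Ins)%VS by rewrite traceless_insertion_total memvf.
case/memv_addP => w wW [z zI xE]; suff w0 : w = 0 by rewrite xE w0 add0r.
apply: tens_dot_eq0 => y.
have : y \in (W + Ins)%VS by rewrite traceless_insertion_total memvf.
have dotDr (a b c : T s) : tens_dot a (b + c) = tens_dot a b + tens_dot a c.
  by rewrite /tens_dot -big_split; apply: eq_bigr => I _; rewrite ffunE mulrDr.
case/memv_addP => w' w'W [z' z'I ->].
rewrite dotDr [X in _ + X]tens_dotC (insertion_traceless_dot z'I wW) addr0.
have := x0 _ w'W; rewrite xE tens_dotC dotDr [X in _ + X]tens_dotC.
by rewrite (insertion_traceless_dot zI w'W) addr0 tens_dotC.
Qed.

Definition traceless_proj : 'End(T s) := daddv_pi W Ins.

Lemma traceless_proj_mem x : traceless_proj x \in W.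
Proof. exact: memv_pi. Qed.

Lemma traceless_proj_id x : x \in W -> traceless_proj x = x.
Proof. by move=> xW; rewrite /traceless_proj daddv_pi_id ?traceless_insertion_cap. Qed.

Lemma traceless_proj0 x : x \in Ins -> traceless_proj x = 0.
Proof.
move=> xI; have cap' : (Ins :&: W)%VS = 0%VS by rewrite capvC traceless_insertion_cap.
have := daddv_pi_add traceless_insertion_cap (_ : x \in (W + Ins)%VS).
rewrite traceless_insertion_total memvf (daddv_pi_id cap' xI) => /(_ isT) /eqP.
by rewrite -subr_eq0 addrK => /eqP.
Qed.

(** By [insertionP] the insertions are the orthogonal of [W], so a map whose adjoint preserves [W]
    preserves them. Preserving both summands, it commutes with the projection. *)
Lemma traceless_proj_comm (h h' : {linear T s -> T s}) :
  (forall x y, tens_dot (h x) y = tens_dot x (h' y)) ->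
  (forall x, x \in W -> h x \in W) -> (forall x, x \in W -> h' x \in W) ->
  forall x, traceless_proj (h x) = h (traceless_proj x).
Proof.
move=> adj hW h'W x.
have hI z : z \in Ins -> h z \in Ins.
  move=> /insertionP z0; apply/insertionP => w wW; rewrite adj.
  by apply: z0; exact: h'W.
have : x \in (W + Ins)%VS by rewrite traceless_insertion_total memvf.
case/memv_addP => w wW [z zI ->].
rewrite !linearD /= (traceless_proj_id wW) (traceless_proj0 zI) (traceless_proj0 (hI _ zI)).
by rewrite (traceless_proj_id (hW _ wW)) raddf0.
Qed.
End TracelessProjection.

(** * Factor permutations, the symplectic action and their adjoints *)

Section TensPerm.
Context {K : fieldType} {n k : nat}.
Local Notation T k := (tensor K n k).

Definition tens_perm (sigma : 'I_k -> 'I_k) (t : T k) : T k :=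
  [ffun J : multi n k => t [ffun c => J (sigma c)]].

Fact tens_perm_is_linear sigma : linear (tens_perm sigma).
Proof. by move=> a u v; apply/ffunP=> I; rewrite !ffunE. Qed.
HB.instance Definition _ sigma :=
  GRing.isLinear.Build K (T k) (T k) _ (tens_perm sigma) (tens_perm_is_linear sigma).

Lemma tens_rotE t : @tens_rot K n k t = tens_perm (@ord_pred k) t.
Proof. by []. Qed.

Lemma tens_flipE t : @tens_flip K n k t = (-1) ^+ k.+1 *: tens_perm (@rev_ord k) t.
Proof. by apply/ffunP=> I; rewrite !ffunE. Qed.

Lemma tens_dot_perm sigma tau (u v : T k) : cancel sigma tau -> cancel tau sigma ->
  tens_dot (tens_perm sigma u) v = tens_dot u (tens_perm tau v).
Proof.
move=> st ts; rewrite /tens_dot (reindex (fun J : multi n k => [ffun c => J (tau c)])) /=.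
  apply: eq_bigr => J _; rewrite !ffunE; congr (u _ * _); apply/ffunP=> c.
  by rewrite !ffunE st.
exists (fun J : multi n k => [ffun c => J (sigma c)]) => J _.
  by apply/ffunP=> c; rewrite !ffunE st.
by apply/ffunP=> c; rewrite !ffunE ts.
Qed.

Lemma tensor_act_perm A sigma tau (t : T k) : cancel sigma tau -> cancel tau sigma ->
  tensor_act A (tens_perm sigma t) = tens_perm sigma (tensor_act A t).
Proof.
move=> st ts; apply/ffunP=> I; rewrite !ffunE.
rewrite (reindex (fun J : multi n k => [ffun c => J (tau c)])) /=; last first.
  exists (fun J : multi n k => [ffun c => J (sigma c)]) => J _.
    by apply/ffunP=> c; rewrite !ffunE st.
  by apply/ffunP=> c; rewrite !ffunE ts.
apply: eq_bigr => J _; rewrite ffunE; congr (_ * t _).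
  rewrite (reindex_inj (can_inj st)) /=; apply: eq_bigr => c _.
  by rewrite !ffunE st.
by apply/ffunP=> c; rewrite !ffunE st.
Qed.

Lemma tens_dot_act A (u v : T k) : tens_dot (tensor_act A u) v = tens_dot u (tensor_act A^T v).
Proof.
rewrite /tens_dot; under eq_bigr do rewrite ffunE mulr_suml.
rewrite exchange_big /=; apply: eq_bigr => I _; rewrite ffunE mulr_sumr.
apply: eq_bigr => J _; rewrite [RHS]mulrCA mulrA; congr (_ * _ * _).
by apply: eq_bigr => l _; rewrite mxE.
Qed.
End TensPerm.

Section TracelessStability.
Context {K : fieldType} {g m : nat}.
Local Notation n := (g + g)%N.
Local Notation s := m.+2.
Local Notation T k := (tensor K n k).
Local Notation W := (traceless K g m.+2).

(** Contracting two factors of the permuted tensor is contracting [t] at the images of their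
    positions by [tau]. *)
Lemma traceless_perm sigma tau (t : T s) : cancel sigma tau -> cancel tau sigma ->
  t \in W -> tens_perm sigma t \in W.
Proof.
move=> st ts /tracelessP t0; apply/tracelessP => a b; apply/ffunP=> I.
have [b' bE] : exists b', tau (lift a b) = lift (tau a) b'.
  case: (unliftP (tau a) (tau (lift a b))) => [b' ->|]; first by exists b'.
  by move/(can_inj ts) => /eqP; rewrite eq_sym (negbTE (neq_lift _ _)).
rewrite ffunE [RHS]ffunE.
case: (posnP n) => [n0|n_gt0].
  by rewrite big1 // => i; exfalso; case: i => i; rewrite n0.
(* A placeholder for the two contracted positions, which [I'] never reads. *)
pose z := Ordinal n_gt0.
pose I' : multi n m := [ffun c => multi_insert a b z z I (sigma (lift (tau a) (lift b' c)))].
have := congr1 (fun f : T m => f I') (t0 (tau a) b'); rewrite ffunE [RHS]ffunE => E.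
rewrite -[RHS]E; apply: eq_bigr => i _; apply: eq_bigr => j _; rewrite ffunE; congr (_ * t _).
apply/ffunP=> c; rewrite !ffunE.
case: (unliftP (tau a) c) => [c' ->|->]; last by rewrite ts unlift_none.
case: (unliftP b' c') => [d ->|->]; last by rewrite -bE ts liftK unlift_none.
rewrite !ffunE; case: unliftP => [e ae|ae]; last first.
  move/(congr1 tau): ae; rewrite st => E'.
  by have := neq_lift (tau a) (lift b' d); rewrite E' eqxx.
case: unliftP => [//|be]; move/(congr1 tau): ae; rewrite be st bE => /lift_inj E'.
by have := neq_lift b' d; rewrite E' eqxx.
Qed.

(** The adjoint of A for [tens_dot] is its transpose, which must therefore be symplectic too. Since
    omega squares to -1, the defining equation exhibits a left inverse of A, and this is also a
    right inverse. *)
Lemma Sp_trmx (A : 'M[K]_n) : Sp A -> Sp A^T.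
Proof.
rewrite /Sp /= trmxK => SpA.
have oo : omega K g *m omega K g = - 1%:M.
  rewrite /omega mulmx_block !mul0mx !mulmx0 !mulmx1 !mul1mx !add0r !addr0.
  by rewrite scalar_mx_block opp_block_mx oppr0.
have AV : (- (omega K g *m A^T *m omega K g)) *m A = 1%:M.
  by rewrite mulNmx -!mulmxA (mulmxA A^T) SpA oo opprK.
have := mulmx1C AV; rewrite mulmxN !mulmxA.
move/(congr1 (mulmxr (omega K g))) => /=; rewrite mulNmx mul1mx -!mulmxA oo.
by rewrite !mulmxN mulmx1 opprK !mulmxA.
Qed.

Lemma traceless_proj_act (A : 'M[K]_n) :
  (isotropic_span (F:=K) (g:=g) s + insertion_span m)%VS = fullv -> Sp A ->
  forall x : T s, traceless_proj (tensor_act A x) = tensor_act A (traceless_proj x).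
Proof.
move=> total SpA.
apply: (traceless_proj_comm total (h' := [the {linear T s -> T s} of tensor_act A^T])).
- by move=> x y; exact: tens_dot_act.
- by move=> x; exact: tensor_act_traceless.
- by move=> x; apply: tensor_act_traceless; exact: Sp_trmx.
Qed.

Lemma traceless_proj_perm sigma tau :
  (isotropic_span (F:=K) (g:=g) s + insertion_span m)%VS = fullv ->
  cancel sigma tau -> cancel tau sigma ->
  forall x : T s, traceless_proj (tens_perm sigma x) = tens_perm sigma (traceless_proj x).
Proof.
move=> total st ts.
apply: (traceless_proj_comm total (h' := [the {linear T s -> T s} of tens_perm tau])).
- by move=> x y; exact: tens_dot_perm.
- by move=> x; exact: traceless_perm st ts.
- by move=> x; exact: traceless_perm ts st.
Qed.
End TracelessStability.

(** * The dihedral trace *)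

Lemma vquot_map (K : fieldType) (V V' : vectType K) (U : {vspace V}) (U' : {vspace V'})
    (h : 'Hom(V, V')) : (U <= h @^-1: U')%VS ->
  exists f : {linear vquot U -> vquot U'}, forall x, f (vquot_pi U x) = vquot_pi U' (h x).
Proof.
move=> hU; pose f (c : vquot U) : vquot U' := vquot_pi U' (h (repr c)).
have fE x : f (vquot_pi U x) = vquot_pi U' (h x).
  apply/eqP; rewrite vquot_piP -linearB memv_preim; apply: (subvP hU).
  by rewrite -vquot_piP /vquot_pi reprK.
have lin : linear f.
  move=> a; elim/quotW=> x; elim/quotW=> y; rewrite -/(vquot_pi U x) -/(vquot_pi U y).
  by rewrite -linearP !fE !linearP.
by exists (HB.pack_for {linear vquot U -> vquot U'} f
  (GRing.isLinear.Build K (vquot U) (vquot U') _ f lin)).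
Qed.

Section DihedralTrace.
Context {K : fieldType} {g m : nat}.
Hypothesis K0 : [pchar K] =i pred0.
Hypothesis total : (isotropic_span (F:=K) (g:=g) m.+2 + insertion_span m)%VS = fullv.
Local Notation n := (g + g)%N.
Local Notation s := m.+2.
Local Notation T k := (tensor K n k).
Local Notation W := (traceless K g m.+2).
Local Notation rel := (dihedral_relations K g m.+2).
Local Notation rot := (@tens_rot K n s).
Local Notation flip := (@tens_flip K n s).

Lemma dihedral_traceless i j (x : T s) : x \in W -> iter i rot (iter j flip x) \in W.
Proof.
move=> xW; have : iter j flip x \in W.
  elim: j => //= j IH; rewrite tens_flipE memvZ //.
  exact: traceless_perm (@rev_ordK s) (@rev_ordK s) IH.
elim: i => //= i IH yW; rewrite tens_rotE.
by apply: traceless_perm (@ord_predK s) (@ordSK s) _; exact: IH.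
Qed.

Lemma dihedral_relation i j (x : T s) : x \in W ->
  vsproj W (iter i rot (iter j flip x) - x) \in rel.
Proof.
move=> xW; apply: mem_vspan; exists i, j, (vsproj W x).
by rewrite !vsprojK // rpredB ?dihedral_traceless.
Qed.

Lemma proj_iter_rot i (x : T s) : traceless_proj (iter i rot x) = iter i rot (traceless_proj x).
Proof.
elim: i => //= i IH.
by rewrite !tens_rotE (traceless_proj_perm total (@ord_predK s) (@ordSK s)) IH.
Qed.

(** If the rotations of y sum to zero, then y is -1/s times the sum of the differences between the
    rotations of y and y, each of which is a relation. Characteristic 0 allows the division by s. *)
Lemma cyclic_norm_relation (x : T s) : \sum_(j < s) iter j rot x = 0 ->
  vsproj W (traceless_proj x) \in rel.
Proof.
move=> x0; set y := traceless_proj x.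
have yW : y \in W by exact: traceless_proj_mem.
have y0 : \sum_(j < s) iter j rot y = 0.
  have := congr1 traceless_proj x0; rewrite linear_sum linear0 => E; rewrite -[RHS]E.
  by apply: eq_bigr => j _; rewrite /= proj_iter_rot.
have sK : s%:R != 0 :> K by have /pcharf0P -> := K0.
have yE : y = - s%:R^-1 *: \sum_(j < s) (iter j rot y - y).
  rewrite sumrB y0 sub0r sumr_const card_ord scalerN scaleNr opprK.
  by rewrite -scaler_nat scalerA mulVf ?scale1r.
rewrite yE linearZ /= memvZ // linear_sum; apply: rpred_sum => j _.
exact: (dihedral_relation j 0 yW).
Qed.

Definition dihedral_trace : 'Hom(subvs_of (johnson_target K g s), subvs_of W) :=
  linfun (vsproj W \o (traceless_proj \o (@outer_contraction K g s \o vsval))).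

Lemma dihedral_traceE x :
  vsval (dihedral_trace x) = traceless_proj (outer_contraction (vsval x)).
Proof. by rewrite lfunE /= vsprojK // traceless_proj_mem. Qed.

Lemma dihedral_trace_johnson (R : realType) (S : bounded_surface R g) :
  (johnson_image S K s <= dihedral_trace @^-1: rel)%VS.
Proof.
apply/vspan_subvP => t [phi _ tphi]; rewrite -memv_preim lfunE /=.
by apply: cyclic_norm_relation; exact: outer_contraction_johnson tphi.
Qed.

Lemma dihedral_trace_act A x : Sp A ->
  dihedral_trace (subvs_act A x) = subvs_act A (dihedral_trace x).
Proof.
move=> SpA; apply: val_inj; rewrite /= -/(vsval _) -/(vsval _).
rewrite traceless_actE // !dihedral_traceE johnson_target_actE.
by rewrite /outer_contraction tens_contraction_act // traceless_proj_act.
Qed.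

Lemma dihedral_relations_act A (z : subvs_of W) : Sp A -> z \in rel -> subvs_act A z \in rel.
Proof.
move=> SpA; pose h : 'End(subvs_of W) := linfun (vsproj W \o (tensor_act A \o vsval)).
have hE y : h y = subvs_act A y by rewrite lfunE.
suff /subvP sub : (rel <= h @^-1: rel)%VS by move=> /sub; rewrite -memv_preim hE.
apply/vspan_subvP => y [i [j [x yE]]]; rewrite -memv_preim hE.
apply: mem_vspan; exists i, j, (subvs_act A x).
rewrite !traceless_actE // yE linearB /=; congr (_ - _).
have actrot t : tensor_act A (rot t) = rot (tensor_act A t).
  by rewrite !tens_rotE (tensor_act_perm _ _ (@ord_predK s) (@ordSK s)).
have actflip t : tensor_act A (flip t) = flip (tensor_act A t).
  by rewrite !tens_flipE linearZ /= (tensor_act_perm _ _ (@rev_ordK s) (@rev_ordK s)).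
have -> (t : T s) : tensor_act A (iter i rot t) = iter i rot (tensor_act A t).
  by elim: i {yE} => //= i IH; rewrite actrot IH.
by congr (iter i _ _); elim: j {yE} => //= j IH; rewrite actflip IH.
Qed.

(** For isotropic v a caterpillar maps to [pure v] plus its flip, which is twice [pure v] modulo the
    relations. Dividing by 2 reaches all isotropic tensors, and these span the traceless ones. *)
Lemma dihedral_trace_surj : (limg dihedral_trace + rel)%VS = fullv.
Proof.
have two : 2 != 0 :> K by have /pcharf0P -> := K0.
set Z := (_ + _)%VS.
have pureZ v : isotropic v -> vsproj W (pure v) \in Z.
  move=> [v0 [a [b [ab va vb]]]].
  have [t tJ tE] := caterpillar_pure v0 va vb.
  have pW := pure_traceless v0.
  have fW : flip (pure v) \in W by exact: (dihedral_traceless 0 1).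
  have trE : dihedral_trace (vsproj _ t) = vsproj W (pure v) + vsproj W (flip (pure v)).
    apply: val_inj; apply: (etrans (dihedral_traceE _)); rewrite vsprojK // tE ab scale1r.
    rewrite (traceless_proj_id total) ?rpredD //; apply/esym.
    exact: (etrans (linearD vsval _ _) (congr2 +%R (vsprojK pW) (vsprojK fW))).
  have rE := dihedral_relation 0 1 pW; rewrite /= linearB /= in rE.
  have -> : vsproj W (pure v) = 2^-1 *: (dihedral_trace (vsproj _ t)
      - (vsproj W (flip (pure v)) - vsproj W (pure v))).
    rewrite trE opprB addrA addrAC addrK -[in RHS]mulr2n -scaler_nat scalerA mulVf //.
    by rewrite scale1r.
  apply: memvZ; apply: memv_add; first exact: memv_img (memvf _).
  by rewrite memvN.
apply/eqP; rewrite eqEsubv subvf; apply/subvP => z _.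
have /subvP sub : (isotropic_span (F:=K) (g:=g) s <= linfun (vsproj W) @^-1: Z)%VS.
  by apply/vspan_subvP => _ [v hv ->]; rewrite -memv_preim lfunE; exact: pureZ.
have := sub _ (subvP (traceless_sub_isotropic total) _ (subvsP z)).
by rewrite -memv_preim lfunE /= vsvalK.
Qed.
End DihedralTrace.

Theorem theorem1p1 (s : nat) (hs : (1 < s)%N) :
  exists g0 : nat, forall g : nat, (g0 <= g)%N ->
  forall K : fieldType, [pchar K] =i pred0 ->
  forall (R : realType) (S : bounded_surface R g),
  exists f : {linear johnson_cokernel S K s -> dihedral_coinvariants K g s},
    (forall c, exists x, f x = c) /\
    (forall A : 'M[K]_(g + g), Sp A ->
     forall (x : subvs_of (johnson_target K g s)) (y : subvs_of (traceless K g s)),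
       f (vquot_pi _ x) = vquot_pi _ y ->
       f (vquot_pi _ (subvs_act A x)) = vquot_pi _ (subvs_act A y)).
Proof.
case: s hs => [|[|m]] // _; exists (genus_bound m) => g gm K K0 R S.
have total := isotropic_insertion_span K0 gm.
have [f fE] := vquot_map (dihedral_trace_johnson K0 total S).
exists f; split=> [|A SpA x y].
  elim/quotW=> y; rewrite -/(vquot_pi _ y).
  have : y \in (limg dihedral_trace + dihedral_relations K g m.+2)%VS.
    by rewrite dihedral_trace_surj // memvf.
  case/memv_addP => _ /memv_imgP[x _ ->] [z zrel ->].
  exists (vquot_pi _ x); rewrite fE; apply/eqP; rewrite vquot_piP.
  by rewrite opprD addrA subrr sub0r memvN.
(* The hypothesis says that [dihedral_trace x - y] is a relation, and relations are stable under the
   symplectic group. *)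
rewrite !fE => /eqP; rewrite vquot_piP => xy; apply/eqP; rewrite vquot_piP.
rewrite dihedral_trace_act //.
suff <- : subvs_act A (dihedral_trace x - y) = subvs_act A (dihedral_trace x) - subvs_act A y.
  exact: dihedral_relations_act.
by rewrite /subvs_act (linearB vsval) (linearB (tensor_act A)) (linearB (vsproj _)).
Qed.
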